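(* Let $f:(\mathbb{C}^2,0)\to(\mathbb{C},0)$ be an irreducible nondegenerate isolated singularity, and let $p<q$ be the coprime positive integers such that, possibly after interchanging the variables $x$ and $y$, $$f=\sum_{p\alpha+q\beta\ \ge\ pq} c_{\alpha\beta}\,x^{\alpha}y^{\beta},\qquad c_{q,0}\,c_{0,p}\neq 0 .$$ Let $r$ be the remainder of the division of $q$ by $p$. Then the sequence of jumps of Milnor numbers of $f$ begins with $$\underbrace{1,\ \dots,\ 1}_{r(p-r)},$$ that is, its first $r(p-r)$ terms are all equal to $1$.
   Context: An isolated (plane curve) singularity is an analytic germ $f:(\mathbb{C}^2,0)\to(\mathbb{C},0)$ such that $0$ is the only solution (near $0$) of the system $\nabla f(x,y)=0$, $f(x,y)=0$. Its Milnor number $\mu(f)$ is the multiplicity of $\nabla f$ at $0$, i.e. $\dim_{\mathbb{C}}\mathbb{C}\{x,y\}/(\partial f/\partial x,\partial f/\partial y)$. Irreducible means irreducible in $\mathbb{C}\{x,y\}$. A deformation of $f$ is an analytic function germ $F:(\mathbb{C}^3,0)\to\mathbb{C}$, $F=F(t,x,y)$, such that $F(0,\cdot)=f$ and $F(t,\cdot)$ is an isolated singularity (at the origin) for every sufficiently small $t$. The Milnor number of the deformation is the value of $\mu(F(t,\cdot))$ for sufficiently small $t\neq 0$; it is always at most $\mu(f)$. Let $(\mu_i)_{i=0,\dots,w}$ be the strictly decreasing sequence of all positive integers attained as Milnor numbers of deformations of $f$; thus $\mu_0=\mu(f)$ and $\mu_w=1$. The sequence of jumps of Milnor numbers of $f$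 is $(\mu_{i-1}-\mu_i)_{i=1,\dots,w}$. Nondegenerate means nondegenerate in the sense of Kouchnirenko: writing $f=\sum c_{ij}x^iy^j$, for every compact edge $\gamma$ of the boundary of the convex hull of $\bigcup_{c_{ij}\ne 0}\left((i,j)+[0,\infty)^2\right)$, the polynomial $f_\gamma=\sum_{(i,j)\in\gamma}c_{ij}x^iy^j$ is such that $\partial f_\gamma/\partial x$ and $\partial f_\gamma/\partial y$ have no common zero in $(\mathbb{C}\setminus\{0\})^2$. Every irreducible nondegenerate isolated singularity has, up to interchanging the variables, the displayed form with $p<q$ coprime and $c_{q,0}c_{0,p}\ne0$: its Newton diagram is the single segment joining $(q,0)$ and $(0,p)$. *)

(* Defs.v *)
From mathcomp Require Export all_boot all_order all_algebra.
From mathcomp Require Export all_classical all_reals all_analysis.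
From mathcomp.real_closed Require Export complex.
Export Order.TTheory GRing.Theory Num.Theory.
Export numFieldNormedType.Exports.

Set Implicit Arguments.
Unset Strict Implicit.
Unset Printing Implicit Defensive.

Local Open Scope classical_set_scope.
Local Open Scope ring_scope.

(* A germ at 0 is represented by its Taylor coefficients: [f i j] is the
   coefficient of x^i y^j, and [F k i j] that of t^k x^i y^j. *)
Definition series2 (K : Type) := nat -> nat -> K.
Definition series3 (K : Type) := nat -> nat -> nat -> K.

Section PowerSeries.
Variable K : numFieldType.
Implicit Types f g h : series2 K.

(* Cauchy's estimates: positive radius of convergence. The inequalities in [K]
   force [r] and [M] to be real. *)
Definition convergent2 f :=
  exists r M : K, 0 < r /\ forall i j, `|f i j| * r ^+ (i + j) <= M.

Definition convergent3 (F : series3 K) :=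
  exists r M : K, 0 < r /\ forall k i j, `|F k i j| * r ^+ (k + i + j) <= M.

(* The sum of the series, as the limit of its square partial sums; meaningful
   at points where the series converges absolutely. *)
Definition eval2 f (x y : K) : K :=
  limn (fun n => \sum_(i < n) \sum_(j < n) f i j * x ^+ i * y ^+ j).

(* The Taylor coefficients of the germ F(t, -). *)
Definition slice (F : series3 K) (t : K) : series2 K :=
  fun i j => limn (fun n => \sum_(k < n) F k i j * t ^+ k).

Definition dx f : series2 K := fun i j => f i.+1 j *+ i.+1.
Definition dy f : series2 K := fun i j => f i j.+1 *+ j.+1.

Definition swap f : series2 K := fun i j => f j i.

Definition one2 : series2 K := fun i j => ((i == 0) && (j == 0))%:R.

Definition mul2 f g : series2 K := fun i j =>
  \sum_(a < i.+1) \sum_(b < j.+1) f a b * g (i - a)%N (j - b)%N.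

Definition unit2 f := exists g, convergent2 g /\ mul2 f g = one2.

Definition irreducible2 f :=
  [/\ f <> (fun _ _ => 0), ~ unit2 f &
      forall g h, convergent2 g -> convergent2 h -> f = mul2 g h ->
        unit2 g \/ unit2 h].

Definition isolated_singularity f :=
  convergent2 f /\
  exists eps : K, 0 < eps /\
    forall x y, `|x| < eps -> `|y| < eps ->
      ([/\ eval2 (dx f) x y = 0, eval2 (dy f) x y = 0 & eval2 f x y = 0]
       <-> x = 0 /\ y = 0).

Definition ideal2 f g h := exists u v, [/\ convergent2 u, convergent2 v &
  h = fun i j => mul2 u f i j + mul2 v g i j].

(* dim K{x,y} / (df/dx, df/dy) = m: the classes of e_0, ..., e_(m-1) form a
   basis of the quotient. *)
Definition milnor_number f (m : nat) :=
  exists e : 'I_m -> series2 K, (forall l, convergent2 (e l)) /\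
    forall g, convergent2 g -> exists! a : {ffun 'I_m -> K},
      ideal2 (dx f) (dy f) (fun i j => g i j - \sum_l a l * e l i j).

Definition deformation f (F : series3 K) :=
  [/\ convergent3 F, slice F 0 = f &
      exists eps : K, 0 < eps /\
        forall t, `|t| < eps -> isolated_singularity (slice F t)].

Definition deformation_milnor_number (F : series3 K) (m : nat) :=
  exists eps : K, 0 < eps /\
    forall t, 0 < `|t| -> `|t| < eps -> milnor_number (slice F t) m.

Definition milnor_sequence f (s : seq nat) :=
  sorted gtn s /\
  forall m, m \in s <->
    (0 < m)%N /\ exists F, deformation f F /\ deformation_milnor_number F m.

Definition newton_form (p q : nat) f :=
  [/\ forall a b, f a b != 0 -> (p * q <= p * a + q * b)%N,
      f q 0 != 0 & f 0 p != 0].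

Lemma milnor_sequence_uniq f s1 s2 :
  milnor_sequence f s1 -> milnor_sequence f s2 -> s1 = s2.
Proof.
move=> [so1 h1] [so2 h2]; apply: (irr_sorted_eq (leT := gtn)) => //.
- by move=> a b c /= ab bc; exact: ltn_trans bc ab.
- by move=> a /=; rewrite ltnn.
- by move=> m; apply/idP/idP => [/h1/h2|/h2/h1].
Qed.

End PowerSeries.

Definition jumps (s : seq nat) : seq nat :=
  [seq (u.1 - u.2)%N | u <- zip s (behead s)].

Section NewtonDiagram.
Variable R : realType.
Local Notation plane := (R^o * R^o)%type.
Implicit Types (f : series2 R[i]) (S g : set plane).

Definition convex_hull S : set plane :=
  smallest (@convex_set R plane) S.

Definition newton_polyhedron f : set plane := convex_hull
  [set P | exists i j, [/\ f i j != 0, i%:R <= P.1 & j%:R <= P.2]].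

Definition face (a b : R) S : set plane :=
  [set P | S P /\ forall Q, S Q -> a * P.1 + b * P.2 <= a * Q.1 + b * Q.2].

Definition segment (P Q : plane) : set plane :=
  [set t *: P + (1 - t) *: Q | t in [set t : R | 0 <= t <= 1]].

(* A one-dimensional compact face: the intersection with a supporting line,
   when it is a nondegenerate segment. *)
Definition compact_edge S g :=
  (exists a b : R, (a, b) <> (0, 0) /\ g = face a b S) /\
  (exists P Q, P <> Q /\ g = segment P Q).

Definition edge_part f g : series2 R[i] :=
  fun i j => if `[< g (i%:R, j%:R) >] then f i j else 0.

(* On a compact edge, [edge_part f g] has finite support, so that [eval2] is
   here the value of a polynomial. *)
Definition nondegenerate f :=
  forall g, compact_edge (newton_polyhedron f) g ->
    forall x y : R[i], x != 0 -> y != 0 ->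
      ~ (eval2 (dx (edge_part f g)) x y = 0 /\
         eval2 (dy (edge_part f g)) x y = 0).

End NewtonDiagram.

(* Main.v *)
(* Adding t times the monomials at the interior vertices of a convex lattice chain
   from (q, 0) to (0, p) to f replaces the Newton segment of f by that chain, and
   by Kouchnirenko's formula the Milnor number drops by twice the area between
   the chain and the segment. The triangle (q, 0), (0, p), (m (p - r), r), where
   q = m p + r, is unimodularly equivalent to the right triangle with the coprime
   legs r and p - r, and a Euclidean algorithm finds in it chains cutting off
   every double area from 0 to r (p - r). Hence (p - 1) (q - 1) - k is attained
   for all these k, while Nakayama's lemma and the semicontinuity of the rank show
   that no deformation has a Milnor number above (p - 1) (q - 1).

   Kouchnirenko's formula is proved for the two series x f_x + y f_y and y f_y by
   splitting the first one, up to high order, into factors with one edge each.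
   Paired with the second series, such a factor can be given coprime initial forms
   for a suitable weight, so that the codimension is read off a monomial basis. *)

From HB Require Import structures.
Require Import Defs.
From mathcomp Require Import ring lra zify.

Set Implicit Arguments.
Unset Strict Implicit.
Unset Printing Implicit Defensive.

Local Open Scope classical_set_scope.
Local Open Scope ring_scope.

(** * The ring of convergent power series *)

(** Only vertices of the chain meet the support of the deformed series, so every edge form is a
    binomial, and coprimality of two series along an edge is the nonvanishing of one 2 x 2 minor.
    Passing from f to x f_x + y f_y and y f_y multiplies the coefficient at (i, j) by i + j and by
    j; the minor is then a multiple of the determinant of two neighbouring vertices, which is
    nonzero in characteristic zero. The factorisation along the edges is never carried to a
    convergent limit. An ideal of codimension n contains the n-th power of the maximal ideal, so
    agreement up to a sufficiently high order already determines the codimension. Multiplicities are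
    handled in the same spirit, through the chain of the ideals I + m^i. The bound r (p - r) is the
    double area of the right triangle with legs r and p - r. The unimodular map from this triangle
    has positive entries, so even horizontal and vertical edges become edges with both coordinates
    positive, as a Newton polygon requires. The polygon is the same for all t other than 0, hence so
    is the Milnor number. *)

Definition powerseries (R : Type) := nat -> R.

Section PowerSeriesRing.
Variable R : comNzRingType.

HB.instance Definition _ := GRing.Zmodule.copy (powerseries R) (nat -> R).

Implicit Types f g h : powerseries R.

Definition psmul f g : powerseries R :=
  fun n => \sum_(a < n.+1) f a * g (n - a)%N.

Definition psone : powerseries R := fun n => (n == 0%N)%:R.

Definition trunc n f : {poly R} := \poly_(k < n) f k.

(* The ring axioms are inherited from polynomials by truncation. *)
Lemma psmul_trunc n m f g : (n < m)%N ->
  psmul f g n = (trunc m f * trunc m g)`_n.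
Proof.
move=> nm; rewrite coefM; apply: eq_bigr => a _; rewrite !coef_poly.
by rewrite (leq_ltn_trans _ nm) ?(leq_ltn_trans _ nm) ?leq_subr // -ltnS.
Qed.

Lemma psmulC f g : psmul f g = psmul g f.
Proof.
by apply/funext => n; rewrite !(@psmul_trunc n n.+1) // mulrC.
Qed.

Lemma psmulA f g h : psmul f (psmul g h) = psmul (psmul f g) h.
Proof.
apply/funext => n; pose t := trunc n.+1.
transitivity ((t f * (t g * t h))`_n).
  rewrite coefM; apply: eq_bigr => a _; rewrite coef_poly ltn_ord.
  by rewrite (@psmul_trunc _ n.+1) // ltnS leq_subr.
rewrite mulrA coefM; apply: eq_bigr => a _; rewrite coef_poly ltnS leq_subr.
by rewrite (@psmul_trunc _ n.+1).
Qed.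

Lemma psmul1 f : psmul psone f = f.
Proof.
apply/funext => n; rewrite /psmul big_ord_recl subn0 mul1r big1 ?addr0 //.
by move=> a _; rewrite mul0r.
Qed.

Lemma psmulDl f g h : psmul (f + g) h = psmul f h + psmul g h.
Proof.
apply/funext => n; rewrite [RHS]/GRing.add /= /psmul -big_split /=.
by apply: eq_bigr => a _; rewrite -mulrDl.
Qed.

Lemma psone_neq0 : psone != 0.
Proof.
by apply/eqP => /(congr1 (fun f => f 0%N)) /eqP; rewrite oner_eq0.
Qed.

HB.instance Definition _ := GRing.Zmodule_isComNzRing.Build (powerseries R)
  psmulA psmulC psmul1 psmulDl psone_neq0.

Lemma ps_inverse f (c : R) : c * f 0%N = 1 -> exists g : powerseries R, g * f = 1.
Proof.
move=> cf.
(* [s n] lists the first n coefficients of the inverse; [step] solves the degree n equation for the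
   next one. *)
pose step n s := rcons s (c * ((n == 0%N)%:R - \sum_(k < n) s`_k * f (n - k)%N)).
pose s := fix s n : seq R := if n is n'.+1 then step n' (s n') else [::].
have size_s n : size (s n) = n by elim: n => //= n IH; rewrite size_rcons IH.
have s_stable n m k : (k < n)%N -> (n <= m)%N -> (s m)`_k = (s n)`_k.
  move=> kn /subnK <-; elim: (m - n)%N => //= d IH.
  by rewrite nth_rcons size_s ifT // (leq_trans kn) // leq_addl.
exists (fun n => (s n.+1)`_n); apply/funext => n.
rewrite [LHS]/(psmul _ _ n) big_ord_recr /= subnn nth_rcons size_s ltnn eqxx.
have -> : \sum_(i < n) (s i.+1)`_i * f (n - i)%N = \sum_(i < n) (s n)`_i * f (n - i)%N.
  by apply: eq_bigr => i _; rewrite -(s_stable i.+1 n).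
rewrite mulrAC cf mul1r addrC subrK; by [].
Qed.

End PowerSeriesRing.

Section ConvergentSeries.
Variable K : numFieldType.
Implicit Types f g : series2 K.
Local Notation pps := (powerseries (powerseries K)).

(* A series in two variables is a series in y-series: its row [f i] is the
   coefficient of x^i. *)
Lemma mul2E (f g : pps) : f * g = mul2 f g.
Proof.
apply/funext => i; apply/funext => j.
rewrite [LHS]/(psmul f g i j) /psmul fct_sumE.
by apply: eq_bigr => a _.
Qed.

Lemma one2E : (1 : pps) = @one2 K.
Proof.
apply/funext => -[|i]; apply/funext => -[|j] //=.
Qed.

Lemma convergent2_bound f : convergent2 f -> exists r M : K,
  [/\ 0 < r, r <= 1, 0 <= M & forall i j, `|f i j| * r ^+ (i + j) <= M].
Proof.
move=> [r [M [r0 H]]].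
have rr : r \is Num.real by rewrite gtr0_real.
exists (Num.min r 1), M; split.
- by rewrite comparable_lt_min ?r0 ?ltr01 // real_comparable // real1.
- by rewrite comparable_ge_min ?lexx ?orbT // real_comparable // real1.
- by apply: le_trans (H 0%N 0%N); rewrite mulr_ge0 // exprn_ge0 // ltW.
- move=> i j; apply: le_trans (H i j); rewrite ler_wpM2l // lerXn2r //.
  + rewrite nnegrE comparable_le_min ?ler01 ?ltW //.
    by rewrite real_comparable // real1.
  + by rewrite nnegrE ltW.
  + by rewrite comparable_ge_min ?lexx // real_comparable // real1.
Qed.

Lemma convergent2_common f g : convergent2 f -> convergent2 g -> exists r M : K,
  [/\ 0 < r, r <= 1, 0 <= M, forall i j, `|f i j| * r ^+ (i + j) <= M
   & forall i j, `|g i j| * r ^+ (i + j) <= M].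
Proof.
move=> /convergent2_bound [r [M [r0 r1 M0 H]]] /convergent2_bound [r' [M' [r'0 r'1 M'0 H']]].
exists (r * r'), (M + M'); split.
- exact: mulr_gt0.
- by rewrite mulr_ile1 // ltW.
- exact: addr_ge0.
- move=> i j; apply: (le_trans (le_trans _ (H i j))); last by rewrite lerDl.
  rewrite exprMn mulrA ler_piMr ?mulr_ge0 ?exprn_ge0 ?(ltW r0) ?(ltW r'0) //.
  by apply: exprn_ile1 => //; exact: ltW.
- move=> i j; apply: (le_trans (le_trans _ (H' i j))); last by rewrite lerDr.
  rewrite exprMn mulrCA ler_piMl ?mulr_ge0 ?exprn_ge0 ?(ltW r0) ?(ltW r'0) //.
  by apply: exprn_ile1 => //; exact: ltW.
Qed.

Lemma convergent2_sub f g : convergent2 f -> convergent2 g ->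
  convergent2 (fun i j => f i j - g i j).
Proof.
move=> cf cg; have [r [M [r0 r1 M0 Hf Hg]]] := convergent2_common cf cg.
exists r, (M + M); split=> // i j.
apply: le_trans (lerD (Hf i j) (Hg i j)); rewrite -mulrDl ler_wpM2r ?ler_normB //.
by rewrite exprn_ge0 // ltW.
Qed.

Lemma leq_S_exp2 i : (i.+1%:R : K) <= 2 ^+ i.
Proof. by rewrite -natrX ler_nat; exact: ltn_expl. Qed.

Lemma convergent2_mul f g : convergent2 f -> convergent2 g ->
  convergent2 (mul2 f g).
Proof.
move=> cf cg; have [r [M [r0 r1 M0 Hf Hg]]] := convergent2_common cf cg.
(* Halving the radius absorbs the number (i + 1)(j + 1) of summands into 2^(i + j). *)
exists (r / 2), (M * M); split=> [|i j]; first by rewrite divr_gt0.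
rewrite exprMn mulrA exprVn ler_pdivrMr ?exprn_gt0 //.
apply: (@le_trans _ _ (\sum_(a < i.+1) \sum_(b < j.+1) (M * M))); last first.
  rewrite !sumr_const !card_ord -mulrnA -[X in X <= _]mulr_natr ler_wpM2l ?mulr_ge0 //.
  by rewrite exprD mulnC natrM ler_pM // leq_S_exp2.
rewrite /mul2; apply: le_trans (ler_wpM2r _ (ler_norm_sum _ _ _)) _.
  by rewrite exprn_ge0 // ltW.
rewrite mulr_suml; apply: ler_sum => a _.
apply: le_trans (ler_wpM2r _ (ler_norm_sum _ _ _)) _.
  by rewrite exprn_ge0 // ltW.
rewrite mulr_suml; apply: ler_sum => b _.
have -> : (i + j = (a + b) + ((i - a) + (j - b)))%N.
  by have := ltn_ord a; have := ltn_ord b; lia.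
rewrite normrM exprD mulrACA ler_pM ?mulr_ge0 ?exprn_ge0 // ltW //.
Qed.

Lemma convergent2_one : convergent2 (@one2 K).
Proof.
exists 1, 1; split=> // i j; rewrite expr1n mulr1 /one2.
by case: (_ && _); rewrite /= ?normr1 ?normr0.
Qed.

Definition is_convergent : {pred pps} := fun f => `[< convergent2 (f : series2 K) >].

Lemma is_convergent_subring : subring_closed is_convergent.
Proof.
split=> [|f g|f g].
- by apply/asboolP; rewrite one2E; exact: convergent2_one.
- by move=> /asboolP cf /asboolP cg; apply/asboolP; exact: convergent2_sub cf cg.
- move=> /asboolP cf /asboolP cg; apply/asboolP; rewrite mul2E.
  exact: convergent2_mul.
Qed.

HB.instance Definition _ := GRing.isSubringClosed.Build pps is_convergent
  is_convergent_subring.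

(** Packaging convergence into a type gives a commutative ring, so that [ring], determinants and big
    sums apply to germs. *)
Record cseries := CSeries { cs_val : pps; cs_valP : cs_val \in is_convergent }.
HB.instance Definition _ := [isSub for cs_val].
HB.instance Definition _ := [Choice of cseries by <:].
HB.instance Definition _ := [SubChoice_isSubComNzRing of cseries by <:].

Definition coef (f : cseries) (i j : nat) : K := cs_val f i j.
End ConvergentSeries.
Coercion coef : cseries >-> Funclass.

Arguments coef {K} f (i j)%_N.

Section Coefficients.
Variable K : numFieldType.
Local Notation cseries := (cseries K).
Implicit Types f g h : cseries.

Lemma coefP f g : (forall i j, f i j = g i j) -> f = g.
Proof.
by move=> fg; apply/val_inj/funext => i; apply/funext => j; exact: fg.
Qed.

Lemma coefD f g i j : (f + g) i j = f i j + g i j. Proof. by []. Qed.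
Lemma coefN f i j : (- f) i j = - f i j. Proof. by []. Qed.
Lemma coefB f g i j : (f - g) i j = f i j - g i j. Proof. by []. Qed.
Lemma coef0 i j : (0 : cseries) i j = 0. Proof. by []. Qed.
Lemma coef_sum (I : Type) (s : seq I) (P : pred I) (F : I -> cseries) i j :
  (\sum_(k <- s | P k) F k) i j = \sum_(k <- s | P k) F k i j.
Proof. by apply: (big_morph (fun f => coef f i j)). Qed.
Lemma coefM f g : coef (f * g) = mul2 f g.
Proof. exact: mul2E. Qed.
Lemma coef1 : coef (1 : cseries) = @one2 K.
Proof. exact: one2E. Qed.

Definition mkcs (f : series2 K) (cf : convergent2 f) : cseries :=
  CSeries (introT (asboolP _) cf).

Lemma mkcsE (f : series2 K) (cf : convergent2 f) : coef (mkcs cf) = f.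
Proof. by []. Qed.

Lemma coef_cvg f : convergent2 f.
Proof. exact: (elimT (asboolP _) (cs_valP f)). Qed.

Lemma convergent2_dom (f : cseries) (g : series2 K) :
  (forall i j, `|g i j| <= `|f i j|) -> convergent2 g.
Proof.
move=> fg; have [r [M [r0 H]]] := coef_cvg f; exists r, M; split=> // i j.
by apply: le_trans (H i j); rewrite ler_wpM2r ?fg // exprn_ge0 // ltW.
Qed.

Lemma convergent2_mon a b :
  convergent2 (fun i j => ((i == a) && (j == b))%:R : K).
Proof.
exists 1, 1; split=> // i j; rewrite expr1n mulr1.
by case: (_ && _); rewrite /= ?normr1 ?normr0.
Qed.
Definition mon a b : cseries := mkcs (convergent2_mon a b).

Lemma coef_mon a b i j : mon a b i j = ((i == a) && (j == b))%:R.
Proof. by []. Qed.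

Lemma convergent2_cst (c : K) :
  convergent2 (fun i j => if (i == 0%N) && (j == 0%N) then c else 0).
Proof.
exists 1, `|c|; split=> // i j; rewrite expr1n mulr1.
by case: (_ && _); rewrite /= ?normr0.
Qed.
Definition cst c : cseries := mkcs (convergent2_cst c).

Lemma convergent2_restrict (P : nat -> nat -> bool) f :
  convergent2 (fun i j => if P i j then f i j else 0).
Proof.
by apply: (@convergent2_dom f) => i j; case: (P _ _); rewrite ?normr0.
Qed.
Definition restrict P f : cseries := mkcs (convergent2_restrict P f).

Lemma convergent2_shift a b f : convergent2 (fun i j => f (i + a)%N (j + b)%N).
Proof.
have [r [M [r0 H]]] := coef_cvg f.
exists r, (M / r ^+ (a + b)); split=> // i j.
rewrite ler_pdivlMr ?exprn_gt0 // -mulrA -exprD.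
by have -> : (i + j + (a + b) = i + a + (j + b))%N by lia.
Qed.
Definition shift a b f : cseries := mkcs (convergent2_shift a b f).

Lemma coef_monM a b f i j :
  (mon a b * f) i j = if (a <= i)%N && (b <= j)%N then f (i - a)%N (j - b)%N else 0.
Proof.
rewrite coefM /mul2; case: ifP => [/andP[ai bj]|ab].
  rewrite (bigD1 (inord a)) //= [X in _ + X]big1 ?addr0; last first.
    move=> a' na; rewrite big1 // => b' _.
    have /negbTE -> : (a' : nat) != a.
      by apply: contraNneq na => <-; rewrite inord_val.
    by rewrite mul0r.
  rewrite (bigD1 (inord b)) //= [X in _ + X]big1 ?addr0; last first.
    move=> b' nb; have /negbTE -> : (b' : nat) != b.
      by apply: contraNneq nb => <-; rewrite inord_val.
    by rewrite andbF mul0r.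
  by rewrite !inordK ?ltnS // !eqxx mul1r.
rewrite big1 // => a' _; rewrite big1 // => b' _ /=.
have [ea|_] := eqVneq (a' : nat) a; last by rewrite mul0r.
have [eb|_] := eqVneq (b' : nat) b; last by rewrite mul0r.
by move: ab; rewrite -ea -eb -ltnS ltn_ord -ltnS ltn_ord.
Qed.

Lemma coef_cstM c f i j : (cst c * f) i j = c * f i j.
Proof.
rewrite coefM /mul2 big_ord_recl [X in _ + X]big1 ?addr0; last first.
  by move=> a _; rewrite big1 // => b _; rewrite mul0r.
rewrite big_ord_recl [X in _ + X]big1 ?addr0 /= ?subn0 // => b _.
by rewrite mul0r.
Qed.

Lemma monM a b c d : mon a b * mon c d = mon (a + c)%N (b + d)%N.
Proof.
apply: coefP => i j; rewrite coef_monM /=; case: ifP => [/andP[ai bj]|ab].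
  congr ((_ && _)%:R); lia.
have [ei|//] := eqVneq i (a + c)%N; have [ej|//] := eqVneq j (b + d)%N.
by move: ab; rewrite ei ej !leq_addr.
Qed.

Lemma cst_zmod_morphism : zmod_morphism cst.
Proof. by move=> c d; apply: coefP => i j; rewrite coefB /=; case: ifP => //; rewrite subr0. Qed.
Lemma cst_monoid_morphism : monoid_morphism cst.
Proof.
split; first by apply: coefP => i j; rewrite coef1 /one2 /=; case: (_ && _).
by move=> c d; apply: coefP => i j; rewrite coef_cstM /=; case: ifP; rewrite ?mulr0.
Qed.
HB.instance Definition _ := GRing.isZmodMorphism.Build K cseries cst cst_zmod_morphism.
HB.instance Definition _ := GRing.isMonoidMorphism.Build K cseries cst cst_monoid_morphism.

Definition coef00 f : K := f 0%N 0%N.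
Lemma coef00_zmod_morphism : zmod_morphism coef00. Proof. by []. Qed.
Lemma coef00_monoid_morphism : monoid_morphism coef00.
Proof.
split; first by rewrite /coef00 coef1.
by move=> f g; rewrite /coef00 coefM /mul2 !big_ord1.
Qed.
HB.instance Definition _ := GRing.isZmodMorphism.Build cseries K coef00 coef00_zmod_morphism.
HB.instance Definition _ := GRing.isMonoidMorphism.Build cseries K coef00 coef00_monoid_morphism.

Lemma geometric_sum_le (e : K) n : 0 <= e -> e <= 1 / 2 ->
  \sum_(a < n) e ^+ a.+1 <= 2 * e.
Proof.
move=> e0 e2; have e1 : 0 < 1 - e.
  by rewrite subr_gt0; apply: le_lt_trans e2 _; rewrite ltr_pdivrMr // mul1r ltr1n.
rewrite -(ler_pM2l e1).
have -> : (1 - e) * \sum_(a < n) e ^+ a.+1 = e - e ^+ n.+1.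
  elim: n => [|n IH]; first by rewrite big_ord0 mulr0 expr1 subrr.
  rewrite big_ord_recr mulrDr IH /=; rewrite !exprS; ring.
apply: (@le_trans _ _ e); first by rewrite gerBl exprn_ge0.
have -> : (1 - e) * (2 * e) = e + e * (1 - 2 * e) by ring.
by rewrite lerDl mulr_ge0 // subr_ge0; move: e2; rewrite ler_pdivlMr // mulrC.
Qed.

(** The sum equals s + t + s t for two geometric tails s, t of size at most 2 e, where 2 e <= 1;
    hence the constant 6. *)
Lemma box_sum_le (e : K) i j : 0 <= e -> e <= 1 / 2 ->
  \sum_(a < i.+1) \sum_(b < j.+1) ((a + b)%N != 0%N)%:R * e ^+ (a + b) <= 6 * e.
Proof.
move=> e0 e2.
have -> : \sum_(a < i.+1) \sum_(b < j.+1) ((a + b)%N != 0%N)%:R * e ^+ (a + b)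
    = (\sum_(a < i.+1) e ^+ a) * (\sum_(b < j.+1) e ^+ b) - 1.
  rewrite mulr_suml (bigD1 ord0) //= [in RHS](bigD1 ord0) //=.
  rewrite (bigD1 ord0) //= mul0r add0r expr0 mul1r.
  rewrite [X in _ = X + _ - 1](bigD1 ord0) //= expr0 addrAC [1 + _]addrC addrK.
  congr (_ + _).
    by apply: eq_bigr => b nb; rewrite !add0n; case: b nb => -[] //= *; rewrite mul1r.
  apply: eq_bigr => a na; rewrite mulr_sumr; apply: eq_bigr => b _.
  by case: a na => -[] //= *; rewrite mul1r exprD.
rewrite !big_ord_recl expr0.
have h n := geometric_sum_le n e0 e2; have := h i; have := h j.
have h0 n : 0 <= \sum_(a < n) e ^+ a.+1 by apply: sumr_ge0 => a _; rewrite exprn_ge0.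
have := h0 i; have := h0 j; rewrite /bump /=.
set s := \sum_(a < j) _; set t := \sum_(a < i) _ => s0 t0 sE tE.
have -> : (1 + t) * (1 + s) - 1 = s + t + t * s by ring.
have -> : 6 * e = 2 * e + 2 * e + 2 * e * 1 by ring.
apply: lerD; first exact: lerD.
apply: ler_pM => //; apply: le_trans sE _.
by move: e2; rewrite ler_pdivlMr // mulrC.
Qed.

(** The formal inverse comes from inverting first the constant row and then the series of rows. Its
    convergence is proved by induction on the degree, on a radius shrunk by a factor e. *)
Lemma cs_inverse f : f 0%N 0%N != 0 -> exists g, g * f = 1.
Proof.
move=> f0; pose F : powerseries (powerseries K) := cs_val f.
have [c cF] : exists c : powerseries K, c * F 0%N = 1.
  by apply: (@ps_inverse _ (F 0%N) ((f 0%N 0%N)^-1)); rewrite mulVf.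
have [G GF] := ps_inverse cF.
suff cG : convergent2 (G : series2 K) by exists (mkcs cG); apply/val_inj.
have [r [M [r0 r1 M0 H]]] := convergent2_bound (coef_cvg f).
set d := `|f 0%N 0%N|; have d0 : 0 < d by rewrite normr_gt0.
have M6 : 0 < 6 * M + 2 * d by rewrite ltr_wpDl ?mulr_ge0 // mulr_gt0.
(* Chosen so that e <= 1/2 and 6 M e <= d: all terms but the leading one then contribute at most d =
   |f(0)| times the inductive bound 1/d. *)
pose e := d / (6 * M + 2 * d).
have e0 : 0 < e by rewrite divr_gt0.
have e2 : e <= 1 / 2.
  by rewrite ler_pdivrMr // mulrAC ler_pdivlMr // mul1r mulrC lerDr mulr_ge0.
have eM : M * (6 * e) <= d.
  rewrite /e mulrA mulrA ler_pdivrMr //.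
  have -> : d * (6 * M + 2 * d) = M * 6 * d + 2 * d * d by ring.
  by rewrite mulrA lerDl !mulr_ge0 // ltW.
clearbody e; pose C := d^-1; have C0 : 0 < C by rewrite invr_gt0.
suff Hn n : forall i j, (i + j < n)%N -> `|G i j| * (r * e) ^+ (i + j) <= C.
  exists (r * e), C; split=> [|i j]; first exact: mulr_gt0.
  exact: (Hn (i + j).+1).
elim: n => // n IH i j ijn.
have GFE : mul2 G F i j = one2 K i j by rewrite -mul2E GF one2E.
have split_sum : G i j * f 0%N 0%N = one2 K i j -
    \sum_(a < i.+1) \sum_(b < j.+1)
       ((a + b)%N != 0%N)%:R * (G (i - a)%N (j - b)%N * f a b).
  rewrite -GFE -mul2E [in RHS](mulrC G) mul2E /mul2.
  rewrite big_ord_recl /= big_ord_recl /= !subn0 [in X in _ - X]big_ord_recl.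
  rewrite [in X in _ - (X + _)]big_ord_recl /= mul0r add0r.
  under [in X in _ - (X + _)]eq_bigr => b _ do rewrite mul1r mulrC subn0.
  under [in X in _ - (_ + X)]eq_bigr => a _ do under eq_bigr => b _ do rewrite mul1r mulrC.
  rewrite /bump /= -addrA; apply/esym; rewrite mulrC.
  have cancel_tail (x s t : K) : x + s + (t - (s + t)) = x by ring.
  exact: cancel_tail.
have ge0 : 0 <= (r * e) ^+ (i + j) by rewrite exprn_ge0 // mulr_ge0 ?ltW.
have [/eqP|ij0] := eqVneq (i + j)%N 0%N.
  rewrite addn_eq0 => /andP[/eqP i0 /eqP j0]; move: split_sum.
  rewrite i0 j0 /one2 !big_ord1 /= mul0r subr0 expr0 mulr1 => /(congr1 Num.norm).
  rewrite normrM normr1 => Gd; rewrite /C -[X in _ <= X]mul1r ler_pdivlMr //.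
  by rewrite Gd.
rewrite -(ler_pM2r d0) /C mulVf ?gt_eqF // mulrAC -normrM split_sum.
have -> : one2 K i j = 0 by rewrite /one2; move: ij0; case: i {ijn GFE split_sum ge0}; case: j.
rewrite sub0r normrN.
apply: le_trans (ler_wpM2r ge0 (ler_norm_sum _ _ _)) _; rewrite mulr_suml.
apply: (@le_trans _ _ (\sum_(a < i.+1) \sum_(b < j.+1)
    C * M * (((a + b)%N != 0%N)%:R * e ^+ (a + b)))); last first.
  under eq_bigr => a _ do rewrite -mulr_sumr.
  rewrite -mulr_sumr -mulrA.
  apply: le_trans (ler_wpM2l (ltW C0) (ler_wpM2l M0 (box_sum_le i j (ltW e0) e2))) _.
  by apply: le_trans (ler_wpM2l (ltW C0) eM) _; rewrite mulVf ?gt_eqF.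
apply: ler_sum => a _.
apply: le_trans (ler_wpM2r ge0 (ler_norm_sum _ _ _)) _; rewrite mulr_suml.
apply: ler_sum => b _; have [->|ab0] := eqVneq (a + b)%N 0%N.
  by rewrite !mul0r normr0 mul0r mulr0.
rewrite !mul1r normrM.
have ai := ltn_ord a; have bj := ltn_ord b.
have -> : (i + j = (i - a + (j - b)) + (a + b))%N by clear -ai bj; lia.
rewrite exprD [(r * e) ^+ (a + b)]exprMn.
have -> : forall x y z u v : K, x * y * (z * (u * v)) = x * z * (y * u) * v.
  by move=> *; ring.
apply: ler_wpM2r; first by rewrite exprn_ge0 // ltW.
apply: ler_pM => //; rewrite ?mulr_ge0 ?exprn_ge0 ?mulr_ge0 ?(ltW r0) ?(ltW e0) //.
by apply: IH; clear -ai bj ab0 ijn; lia.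
Qed.

End Coefficients.
Arguments mon {K} (a b)%_N.
Arguments shift {K} (a b)%_N f.
Arguments cst {K}.

(** * Orders, ideals and codimension *)

Section WeightedOrder.
Variable K : numFieldType.
Local Notation cseries := (cseries K).
Implicit Types f g h : cseries.

(* All monomials of [f] have weight at least [n], where x has weight [w1] and y
   has weight [w2]. *)
Definition wge (w1 w2 n : nat) f :=
  forall i j, (w1 * i + w2 * j < n)%N -> f i j = 0.

Variables w1 w2 : nat.

Lemma wge_le n m f : (m <= n)%N -> wge w1 w2 n f -> wge w1 w2 m f.
Proof. by move=> mn fn i j ij; apply: fn; exact: leq_trans mn. Qed.

Lemma wge0 f : wge w1 w2 0 f. Proof. by []. Qed.

Lemma wgeD n f g : wge w1 w2 n f -> wge w1 w2 n g -> wge w1 w2 n (f + g).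
Proof. by move=> fn gn i j ij; rewrite coefD fn ?gn ?addr0. Qed.

Lemma wgeN n f : wge w1 w2 n f -> wge w1 w2 n (- f).
Proof. by move=> fn i j ij; rewrite coefN fn ?oppr0. Qed.

Lemma wgeB n f g : wge w1 w2 n f -> wge w1 w2 n g -> wge w1 w2 n (f - g).
Proof. by move=> fn gn; apply: wgeD => //; exact: wgeN. Qed.

Lemma wge_sum n (I : Type) (s : seq I) (P : pred I) (F : I -> cseries) :
  (forall k, P k -> wge w1 w2 n (F k)) -> wge w1 w2 n (\sum_(k <- s | P k) F k).
Proof.
by move=> H; apply: big_ind => // *; exact: wgeD.
Qed.

Lemma wgeM n m f g : wge w1 w2 n f -> wge w1 w2 m g -> wge w1 w2 (n + m)%N (f * g).
Proof.
move=> fn gm i j ij; rewrite coefM /mul2 big1 // => a _; rewrite big1 // => b _.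
have [ab|ab] := ltnP (w1 * a + w2 * b) n; first by rewrite fn ?mul0r.
rewrite (gm (i - a)%N) ?mulr0 //.
have := ltn_ord a; have := ltn_ord b; rewrite !ltnS => bj ai.
move: ij; rewrite -{1}(subnKC ai) -{1}(subnKC bj) !mulnDr; lia.
Qed.

Lemma wgeMl n f g : wge w1 w2 n g -> wge w1 w2 n (f * g).
Proof. by move=> gn; rewrite -[n]add0n; apply: wgeM => //; exact: wge0. Qed.

Lemma wge_mon a b : wge w1 w2 (w1 * a + w2 * b)%N (mon a b : cseries).
Proof.
move=> i j ij /=; have [ia|//] := eqVneq i a; have [jb|//] := eqVneq j b.
by move: ij; rewrite ia jb ltnn.
Qed.

End WeightedOrder.
Arguments wge {K} (w1 w2 n)%_N f.

Section Codimension.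
Variable K : numFieldType.
Local Notation cseries := (cseries K).
Implicit Types (f g h : cseries) (I J : cseries -> Prop).

(* Membership in the n-th power of the maximal ideal. *)
Definition ordge n f := wge 1 1 n f.
Arguments ordge n%_N f.

Lemma wge_ordge w1 w2 n f : (0 < w1)%N -> (0 < w2)%N ->
  wge w1 w2 ((w1 + w2) * n) f -> ordge n f.
Proof.
by move=> w10 w20 fn i j ij; apply: fn; nia.
Qed.

Lemma ordge_wge w1 w2 n f : (0 < w1)%N -> (0 < w2)%N ->
  ordge n f -> wge w1 w2 n f.
Proof. by move=> w10 w20 fn i j ij; apply: fn; nia. Qed.

(** Assigning the monomial x^i y^j to a = min(i, N) sorts the terms of f into disjoint groups, each
    divisible by its x^a y^(N - a). *)
Lemma ordge_decomposition N f : ordge N f -> exists h : 'I_N.+1 -> cseries,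
  f = \sum_a h a * mon a (N - a) /\ forall a, h a 0%N 0%N = f a (N - a)%N.
Proof.
move=> fN; exists (fun a : 'I_N.+1 =>
  shift a (N - a)%N (restrict (fun i j => minn i N == a) f)); split; last first.
  by move=> a; have := ltn_ord a; rewrite ltnS => aN; rewrite /= !add0n (minn_idPl aN) eqxx.
apply: coefP => i j; rewrite coef_sum.
under eq_bigr => a _ do rewrite mulrC coef_monM /=.
have iN : (minn i N < N.+1)%N by lia.
rewrite (bigD1 (Ordinal iN)) //= big1 ?addr0; last first.
  move=> a /eqP na; case: ifP => // /andP[ai aj].
  rewrite !subnK //; case: eqP => // e; case: na; apply: val_inj; exact/esym.
case: ifP => [/andP[ai bj]|ab]; first by rewrite !subnK // eqxx.
by rewrite fN //; lia.
Qed.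

Definition ideal I := [/\ I 0, (forall f g, I f -> I g -> I (f + g)) &
  forall f g, I g -> I (f * g)].

Definition gen2 f g : cseries -> Prop := fun h => exists u v, h = u * f + v * g.

Lemma ideal_gen2 f g : ideal (gen2 f g).
Proof.
split; first by exists 0, 0; rewrite !mul0r addr0.
- by move=> _ _ [u [v ->]] [u' [v' ->]]; exists (u + u'), (v + v'); ring.
- by move=> h _ [u [v ->]]; exists (h * u), (h * v); ring.
Qed.

Lemma gen2_l f g : gen2 f g f. Proof. by exists 1, 0; ring. Qed.
Lemma gen2_r f g : gen2 f g g. Proof. by exists 0, 1; ring. Qed.

Lemma gen2_sub I f g : ideal I -> I f -> I g -> forall h, gen2 f g h -> I h.
Proof. by move=> [_ ID IM] If Ig _ [u [v ->]]; apply: ID; apply: IM. Qed.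

Lemma gen2C f g h : gen2 f g h -> gen2 g f h.
Proof. by move=> [u [v ->]]; exists v, u; rewrite addrC. Qed.

(* The ideal I + m^N. *)
Definition addord I N : cseries -> Prop := fun f => exists2 g, I g & ordge N (f - g).

Lemma ideal_addord I N : ideal I -> ideal (addord I N).
Proof.
move=> [I0 ID IM]; split; first by exists 0; rewrite ?subrr.
- move=> f g [f' If' Nf] [g' Ig' Ng]; exists (f' + g'); first exact: ID.
  by rewrite opprD addrACA; apply: wgeD.
- move=> f g [g' Ig' Ng]; exists (f * g'); first exact: IM.
  by rewrite -mulrBr; apply: wgeMl.
Qed.

Lemma addord_sub I N f : I f -> addord I N f.
Proof. by move=> If; exists f; rewrite ?subrr. Qed.

Lemma ideal_sub I f g : ideal I -> I f -> I g -> I (f - g).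
Proof. by move=> [_ ID IM] If Ig; apply: ID => //; rewrite -mulN1r; apply: IM. Qed.

Lemma ideal_sum I (T : Type) (s : seq T) (P : pred T) (F : T -> cseries) :
  ideal I -> (forall k, P k -> I (F k)) -> I (\sum_(k <- s | P k) F k).
Proof. by move=> [I0 ID _] H; apply: big_ind. Qed.

Arguments ideal_sum {I T s P F}.

(* The monomials X of degree N satisfy (1 - C) X = 0 modulo I for a matrix C over
   the maximal ideal, and det (1 - C) is a unit. *)
Lemma nakayama I N : ideal I ->
  (forall f, ordge N f -> addord I N.+1 f) -> forall f, ordge N f -> I f.
Proof.
move=> idI H; have [I0 ID IM] := idI.
pose X (a : 'I_N.+1) : cseries := mon a (N - a).
have XN a : ordge N (X a).
  by have := @wge_mon K 1 1 a (N - a)%N; rewrite !mul1n subnKC // -ltnS ltn_ord.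
have /choice[io Hi] : forall a, exists g, I g /\ exists h : 'I_N.+1 -> cseries,
    X a - g = \sum_b h b * X b /\ forall b, h b 0%N 0%N = 0.
  move=> a; have [g Ig Ng] := H _ (XN a); exists g; split=> //.
  have [h [e hb]] := ordge_decomposition (wge_le (leqnSn N) Ng).
  exists h; split=> [|b]; first exact: e.
  by rewrite hb; apply: Ng; have := ltn_ord b; lia.
have /choice[C HC] : forall a, exists h : 'I_N.+1 -> cseries,
    X a - io a = \sum_b h b * X b /\ forall b, h b 0%N 0%N = 0.
  by move=> a; have [_ [h]] := Hi a; exists h.
pose M : 'M[cseries]_N.+1 := 1%:M - \matrix_(a, b) C a b.
have MX : M *m (\col_a X a) = \col_a io a.
  apply/matrixP => a k; rewrite /M mulmxBl mul1mx !mxE.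
  have [e _] := HC a.
  under eq_bigr => b _ do rewrite !mxE.
  by rewrite -e opprB addrC subrK.
have detM : (\det M) 0%N 0%N = 1.
  rewrite -[LHS]/(coef00 (\det M)) -det_map_mx.
  have -> : map_mx (@coef00 K) M = 1%:M.
    apply/matrixP => a b; rewrite !mxE rmorphB /= rmorph_nat.
    by have [_ Cab] := HC a; rewrite [X in _ - X]Cab subr0.
  by rewrite det1.
have [d dM] : exists d, d * \det M = 1.
  by apply: cs_inverse; rewrite detM oner_neq0.
have IX a : I (X a).
  have e : X a = d * \sum_b (\adj M) a b * io b.
    have := congr1 (fun A : 'cV_N.+1 => d * (\adj M *m A) a 0) MX.
    rewrite mulmxA mul_adj_mx mul_scalar_mx mxE [X in d * (_ * X)]mxE mulrA dM mul1r.
    move=> ->; congr (_ * _); rewrite mxE.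
    by apply: eq_bigr => b _; rewrite [(\col_a _) _ _]mxE.
  rewrite e; apply: (IM d); apply: (ideal_sum idI) => b _; apply: (IM _ (io b)).
  by have [] := Hi b.
move=> f fN; have [h [-> _]] := ordge_decomposition fN.
by apply: (ideal_sum idI) => a _; apply: IM; apply: IX.
Qed.

Definition lincomb m (a : 'I_m -> K) (e : 'I_m -> cseries) : cseries :=
  \sum_l cst (a l) * e l.

(** The quotient by I is represented only through families of series whose classes span it or are
    independent in it. *)
Definition spans I m (e : 'I_m -> cseries) :=
  forall f, exists a, I (f - lincomb a e).

Definition freemod I m (e : 'I_m -> cseries) :=
  forall a, I (lincomb a e) -> forall l, a l = 0.

Definition codim I m := exists e : 'I_m -> cseries, spans I e /\ freemod I e.

Lemma steinitz I m n (e : 'I_m -> cseries) (e' : 'I_n -> cseries) :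
  ideal I -> spans I e -> freemod I e' -> (n <= m)%N.
Proof.
move=> idI se fe'; rewrite leqNgt; apply/negP => mn.
have /choice[A HA] : forall i, exists a, I (e' i - lincomb a e) by move=> i; exact: se.
pose M : 'M[K]_(n, m) := \matrix_(i, j) A i j.
have : kermx M != 0.
  by rewrite -mxrank_eq0 mxrank_ker subn_eq0 -ltnNge (leq_ltn_trans (rank_leq_col M)).
case/rowV0Pn => v /sub_kermxP vM v0.
have /fe' Hv : I (lincomb (fun i => v 0 i) e').
  have -> : lincomb (fun i => v 0 i) e' =
      \sum_i cst (v 0 i) * (e' i - lincomb (A i) e).
    rewrite /lincomb; under [RHS]eq_bigr => i _ do rewrite mulrBr.
    rewrite sumrB; set s := (X in _ - X); suff -> : s = 0 by rewrite subr0.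
    rewrite /s; under eq_bigr => i _ do rewrite mulr_sumr.
    rewrite exchange_big /= big1 // => j _.
    under eq_bigr => i _ do rewrite mulrA -rmorphM /=.
    rewrite -mulr_suml -rmorph_sum /=.
    have -> : \sum_i v 0 i * A i j = (v *m M) 0 j.
      by rewrite mxE; apply: eq_bigr => i _; rewrite mxE.
    by rewrite vM mxE rmorph0 mul0r.
  by apply: (ideal_sum idI) => i _; have [_ _ IM] := idI; exact: IM.
by move/eqP: v0; apply; apply/rowP => i; rewrite Hv mxE.
Qed.

Lemma codim_uniq I m n : ideal I -> codim I m -> codim I n -> m = n.
Proof.
move=> idI [e [se fe]] [e' [se' fe']]; apply/eqP; rewrite eqn_leq.
by rewrite (steinitz idI se' fe) (steinitz idI se fe').
Qed.

Lemma spans_codim I m (e : 'I_m -> cseries) : ideal I -> spans I e ->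
  exists2 n, (n <= m)%N & codim I n.
Proof.
move=> idI; have [I0 ID IM] := idI.
elim: m e => [|m IH] e se; first by exists 0%N => //; exists e; split=> // a _ [].
have [fe|] := pselect (freemod I e); first by exists m.+1 => //; exists e.
move=> /existsNP[a /not_implyP[Ia /existsNP[k ak]]].
move/eqP: ak => ak.
have [f|n nm cn] := IH (fun l => e (lift k l)); last by exists n => //; exact: leqW.
have [b Hb] := se f.
exists (fun l => b (lift k l) - b k / a k * a (lift k l)).
have -> : f - lincomb (fun l => b (lift k l) - b k / a k * a (lift k l))
      (fun l => e (lift k l))
    = f - lincomb b e + cst (b k / a k) * lincomb a e.
  rewrite /lincomb !(bigD1_ord k) //=.
  under eq_bigr => l _ do rewrite rmorphB rmorphM mulrBl -mulrA.
  rewrite sumrB -mulr_sumr mulrDr mulrA -rmorphM mulfVK //.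
  ring.
by apply: ID => //; apply: IM.
Qed.

Lemma codim_sub I J m : ideal J -> (forall f, I f -> J f) -> codim I m ->
  exists2 n, (n <= m)%N & codim J n.
Proof.
move=> idJ IJ [e [se _]]; apply: (@spans_codim J m e) => // f.
by have [a /IJ ?] := se f; exists a.
Qed.

Lemma codim_ext I J m : (forall f, I f <-> J f) -> codim I m -> codim J m.
Proof.
move=> IJ [e [se fe]]; exists e; split.
- by move=> f; have [a /IJ ?] := se f; exists a.
- by move=> a /IJ; exact: fe.
Qed.

(** The coefficients vanish one after the other: a first nonzero one, at l, would put [e l] into I +
    m^(l + 1). *)
Lemma chain_free I N (e : 'I_N -> cseries) : ideal I ->
  (forall i : 'I_N, ordge i (e i) /\ ~ addord I i.+1 (e i)) -> freemod (addord I N) e.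
Proof.
move=> idI H a [g Ig Ng].
suff Hk k : (k <= N)%N -> forall l : 'I_N, (l < k)%N -> a l = 0.
  by move=> l; apply: (Hk N) => //.
elim: k => // k IH kN l; rewrite ltnS leq_eqVlt => /orP[/eqP lk|lk]; last first.
  by apply: IH => //; exact: ltnW.
apply/eqP/negPn/negP => al; have [el nel] := H l; apply: nel.
have [I0 ID IM] := idI.
exists (cst (a l)^-1 * g); first exact: IM.
have -> : e l - cst (a l)^-1 * g = cst (a l)^-1 * (lincomb a e - g)
   - cst (a l)^-1 * \sum_(i | i != l) cst (a i) * e i.
  rewrite /lincomb (bigD1 l) //= mulrBr mulrDr mulrA -rmorphM mulVf //=.
  rewrite rmorph1; ring.
apply: wgeB; apply: wgeMl; first by apply: wge_le Ng; exact: ltn_ord.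
apply: wge_sum => i il; have [ik|ik] := ltnP i k.
  by rewrite IH ?rmorph0 ?mul0r //; exact: ltnW.
apply: wgeMl; have [ei _] := H i; apply: wge_le ei.
by move: il; rewrite -val_eqE /= => il; lia.
Qed.

(* If the chain I + m^i is strictly decreasing up to N, then picking one element
   in each step gives a free family. *)
Lemma chain_dichotomy I N : ideal I ->
  (exists2 i, (i < N)%N & forall f, ordge i f -> I f) \/
  exists e : 'I_N -> cseries, freemod (addord I N) e.
Proof.
move=> idI.
have [[i iN Hi]|no] := pselect (exists2 i, (i < N)%N &
    forall f, ordge i f -> addord I i.+1 f).
  by left; exists i => //; exact: nakayama.
right; have /choice[e He] : forall i : 'I_N, exists f, ordge i f /\ ~ addord I i.+1 f.
  move=> i; apply: contrapT => ne; apply: no; exists (i : nat) => // f fi.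
  by apply: contrapT => nf; apply: ne; exists f.
by exists e; exact: chain_free.
Qed.

(** If the chain I + m^i dropped n + 1 times, it would yield n + 1 independent classes in a quotient
    of dimension n. So it stops before, and Nakayama's lemma applies. *)
Lemma codim_ord I n : ideal I -> codim I n -> forall f, ordge n f -> I f.
Proof.
move=> idI [e [se _]]; have [[i iN Hi]|[e' fe']] := chain_dichotomy n.+1 idI.
  by move=> f fn; apply: Hi; apply: wge_le fn.
have : (n.+1 <= n)%N; last by rewrite ltnn.
apply: (@steinitz _ n _ e _ (ideal_addord n.+1 idI) _ fe').
by move=> f; have [a Ia] := se f; exists a; exact: addord_sub Ia.
Qed.

(* Additivity of the intersection multiplicity, from the exact sequence
   0 -> O/(h, f) -> O/(g h, f) -> O/(g, f) -> 0. Injectivity needs f to be regular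
   modulo g; knowing this up to arbitrarily high order is enough, since (h, f)
   contains a power of the maximal ideal. *)
Lemma codim_mul g h f m n :
  codim (gen2 g f) m -> codim (gen2 h f) n ->
  (forall u v N, u * g + v * f = 0 -> exists w, ordge N (u - w * f)) ->
  codim (gen2 (g * h) f) (m + n).
Proof.
move=> [e [se fe]] cn syz; have [e' [se' fe']] := cn.
exists (fun l : 'I_(m + n) => match fintype.split l with inl a => e a | inr b => g * e' b end).
have lcE (a : 'I_(m + n) -> K) :
  lincomb a (fun l : 'I_(m + n) => match fintype.split l with inl a => e a | inr b => g * e' b end)
   = lincomb (fun i => a (lshift n i)) e + g * lincomb (fun i => a (rshift m i)) e'.
  rewrite /lincomb big_split_ord /=; congr (_ + _).
    by apply: eq_bigr => i _; rewrite (unsplitK (inl i)).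
  rewrite mulr_sumr; apply: eq_bigr => i _; rewrite (unsplitK (inr i)); ring.
split.
- move=> F; have [a [u [v uv]]] := se F; have [b [u' [v' uv']]] := se' u.
  exists (fun l : 'I_(m + n) => match fintype.split l with inl i => a i | inr j => b j end).
  rewrite lcE.
  have -> : lincomb (fun i => match fintype.split (lshift n i) with inl i => a i | inr j => b j end) e
      = lincomb a e by apply: eq_bigr => i _; rewrite (unsplitK (inl i)).
  have -> : lincomb (fun i => match fintype.split (rshift m i) with inl i => a i | inr j => b j end) e'
      = lincomb b e' by apply: eq_bigr => i _; rewrite (unsplitK (inr i)).
  exists u', (v + g * v').
  have -> : F - (lincomb a e + g * lincomb b e') = (F - lincomb a e) - g * lincomb b e' by ring.
  have -> : lincomb b e' = u - (u - lincomb b e') by ring.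
  rewrite uv uv'; ring.
- move=> a; rewrite lcE => -[u [v uv]].
  set A := lincomb _ e in uv; set B := lincomb _ e' in uv.
  have A0 i : a (lshift n i) = 0.
    apply: (fe (fun i => a (lshift n i))); exists (u * h - B), v; rewrite -/A.
    by rewrite -[A](addrK (g * B)) uv; ring.
  have eA : A = 0 by rewrite /A /lincomb big1 // => i _; rewrite A0 rmorph0 mul0r.
  have B0 i : a (rshift m i) = 0.
    apply: (fe' (fun i => a (rshift m i))); rewrite -/B.
    have /syz-/(_ n)[w wn] : (B - u * h) * g + (- v) * f = 0.
      move: uv; rewrite eA add0r => uv.
      by rewrite mulrBl [B * g]mulrC uv; ring.
    have -> : B = (B - u * h - w * f) + (u * h + w * f) by ring.
    have [_ ID IM] := ideal_gen2 h f; apply: ID; last by exists u, w.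
    exact: (codim_ord (ideal_gen2 h f) cn).
  by move=> l; case: (splitP l) => i li;
    [rewrite -(A0 i)|rewrite -(B0 i)]; congr a; exact: val_inj.
Qed.

(** Since m^n lies in (f, g), an element of m^n changes only by an element of m^(n + 1) when f is
    replaced by f'. Nakayama's lemma then puts m^n into (f', g), and each ideal contains the
    generators of the other. *)
Lemma gen2_perturb f g f' n : codim (gen2 f g) n -> ordge n.+1 (f' - f) ->
  codim (gen2 f' g) n.
Proof.
move=> cn ff'; have [_ ID IM] := ideal_gen2 f g; have id' := ideal_gen2 f' g.
have sub := codim_ord (ideal_gen2 f g) cn.
have small h : ordge n h -> gen2 f' g h.
  apply: nakayama => // {}h /sub[u [v ->]].
  exists (u * f' + v * g); first by exists u, v.
  have -> : u * f + v * g - (u * f' + v * g) = - u * (f' - f) by ring.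
  exact: wgeMl.
apply: (codim_ext _ cn) => h; split; apply: gen2_sub.
- exact: id'.
- have -> : f = f' - (f' - f) by ring.
  apply: ideal_sub => //; first exact: gen2_l.
  by apply: small; apply: wge_le ff'.
- exact: gen2_r.
- exact: ideal_gen2.
- have -> : f' = f + (f' - f) by ring.
  by apply: ID; [exact: gen2_l|apply: sub; apply: wge_le ff'].
- exact: gen2_r.
Qed.

End Codimension.

(** * Pairs of series with coprime initial forms *)

(** Counts, row by row, the staircase of basis monomials of a regular pair. *)
Lemma sum_steps al a be b :
  (\sum_(j <- iota 0 b) (al + (j < be) * a) = b * al + a * minn be b)%N.
Proof.
elim: b => [|b IH]; first by rewrite big_nil; lia.
by rewrite -[in LHS]addn1 iotaD big_cat /= IH add0n big_seq1; case: ltnP => h; nia.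
Qed.

Section MonomialBasis.
Variable K : numFieldType.
Local Notation cseries := (cseries K).

Definition supported (P : nat -> nat -> bool) (g : cseries) :=
  forall i j, ~~ P i j -> g i j = 0.

Lemma supportedD P f g : supported P f -> supported P g -> supported P (f + g).
Proof. by move=> fP gP i j ij; rewrite coefD fP ?gP ?addr0. Qed.

Lemma supportedM P c f : supported P f -> supported P (cst c * f).
Proof. by move=> fP i j ij; rewrite coef_cstM fP ?mulr0. Qed.

Definition monomials (s : seq (nat * nat)) (l : 'I_(size s)) : cseries :=
  mon (nth (0, 0)%N s l).1 (nth (0, 0)%N s l).2.

Lemma coef_lincomb_monomials s (a : 'I_(size s) -> K) (l : 'I_(size s)) : uniq s ->
  lincomb a (@monomials s) (nth (0, 0)%N s l).1 (nth (0, 0)%N s l).2 = a l.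
Proof.
move=> us; rewrite /lincomb coef_sum (bigD1 l) // big1 => [|k /andP[_ kl]].
  by rewrite [LHS]addr0 coef_cstM /= !eqxx mulr1.
rewrite coef_cstM /= -[_ && _]/(_ == _ :> nat * nat).
rewrite nth_uniq // eq_sym; move: kl; rewrite -val_eqE => /negbTE /= -> .
by rewrite mulr0.
Qed.

Lemma lincomb_monomials_supported s (a : 'I_(size s) -> K) :
  supported (fun i j => (i, j) \in s) (lincomb a (@monomials s)).
Proof.
move=> i j ij; rewrite coef_sum big1 // => l _; rewrite coef_cstM /=.
case: eqP => [ei|_]; last by rewrite mulr0.
case: eqP => [ej|_]; last by rewrite mulr0.
by move: ij; rewrite ei ej -surjective_pairing mem_nth.
Qed.

Lemma supported_lincomb s (g : cseries) : uniq s ->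
  supported (fun i j => (i, j) \in s) g ->
  g = lincomb (fun l => g (nth (0, 0)%N s l).1 (nth (0, 0)%N s l).2) (@monomials s).
Proof.
move=> us gs; apply: coefP => i j.
have [ij|ij] := boolP ((i, j) \in s); last by rewrite gs ?lincomb_monomials_supported.
have ls : (index (i, j) s < size s)%N by rewrite index_mem.
have := coef_lincomb_monomials
  (fun l : 'I_(size s) => g (nth (0, 0)%N s l).1 (nth (0, 0)%N s l).2)
  (Ordinal ls) us.
by rewrite /= nth_index.
Qed.

End MonomialBasis.

(* For the weights (b, a), G has the initial form A x^a + B y^b and H the initial
   form C x^al y^be. The monomials x^i y^j with [inB i j] form a basis of O/(G, H);
   regularity follows by lifting the graded relations degree by degree. *)
Section RegularPair.
Variable K : numFieldType.
Local Notation cseries := (cseries K).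

Definition syzygies (G H : cseries) := forall u v N, u * G + v * H = 0 ->
  exists w, ordge N (u - w * H) /\ ordge N (v + w * G).

Variables (G H : cseries) (a b al be : nat).
Hypotheses (a0 : (0 < a)%N) (b0 : (0 < b)%N).
Hypothesis suppG : forall i j, (b * i + a * j <= a * b)%N -> G i j != 0 ->
  (i, j) = (a, 0)%N \/ (i, j) = (0, b)%N.
Hypothesis Ga : G a 0 != 0.
Hypothesis Gb : al = 0%N \/ G 0 b != 0.
Hypothesis suppH : forall i j, (b * i + a * j <= b * al + a * be)%N -> H i j != 0 ->
  (i, j) = (al, be).
Hypothesis Hab : H al be != 0.
Hypothesis beb : (be <= b)%N.

Let D := (b * al + a * be)%N.
(** The monomials outside the ideal of x^al y^be, y^b and x^(al + a). The last one stems from x^al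
    G, whose other leading term x^al y^b is a multiple of the initial form of H. *)
Let inB i j := (j < b)%N && (i < al + (j < be) * a)%N.

Let G1 := G - (cst (G a 0) * mon a 0 + cst (G 0 b) * mon 0 b).
Let H1 := H - cst (H al be) * mon al be.

Let wG1 : wge b a (a * b).+1 G1.
Proof.
move=> i j; rewrite ltnS => ij; rewrite coefB coefD !coef_cstM /=.
have [G0|/suppG-/(_ ij)[[-> ->]|[-> ->]]] := eqVneq (G i j) 0.
- rewrite G0; have [/= ia|_] := eqVneq i a; have [/= j0|_] := eqVneq j 0%N;
  have [/= i0|_] := eqVneq i 0%N; have [/= jb|_] := eqVneq j b; subst; rewrite ?G0 ?mulr0 ?mul0r ?addr0 ?subrr //.
- by rewrite !eqxx /= mulr1 (gtn_eqF a0) mulr0 addr0 subrr.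
- by rewrite !eqxx /= mulr1 (ltn_eqF a0) mulr0 add0r subrr.
Qed.

Let wH1 : wge b a D.+1 H1.
Proof.
move=> i j; rewrite ltnS => ij; rewrite coefB coef_cstM /=.
have [H0|/suppH-/(_ ij)[-> ->]] := eqVneq (H i j) 0.
  rewrite H0; have [ia|_] := eqVneq i al; have [jb|_] := eqVneq j be; subst;
  by rewrite ?H0 ?mulr0 ?mul0r ?subrr.
by rewrite !eqxx mulr1 subrr.
Qed.

Let GE : G = cst (G a 0) * mon a 0 + cst (G 0 b) * mon 0 b + G1.
Proof. by rewrite /G1; ring. Qed.
Let HE : H = cst (H al be) * mon al be + H1.
Proof. by rewrite /H1; ring. Qed.

Let wG : wge b a (a * b) G.
Proof.
rewrite GE; apply: wgeD; last by apply: wge_le wG1.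
apply: wgeD; apply: wgeMl.
- by have := @wge_mon K b a a 0; rewrite muln0 addn0 mulnC.
- by have := @wge_mon K b a 0 b; rewrite muln0 add0n.
Qed.

(** In weight n only the initial forms of G and H contribute, as [u] and [v] have the least weights
    compatible with n. *)
Let leading_eq u v n i j : wge b a (n - a * b) u -> wge b a (n - D) v ->
  (b * i + a * j = n)%N ->
  (u * G + v * H) i j =
    G a 0 * (if (a <= i)%N then u (i - a)%N j else 0)
  + G 0 b * (if (b <= j)%N then u i (j - b)%N else 0)
  + H al be * (if (al <= i)%N && (be <= j)%N then v (i - al)%N (j - be)%N else 0).
Proof.
move=> un vn ijn; rewrite [in LHS]GE [in LHS]HE.
set c := G a 0; set d := G 0 b; set e := H al be.
have -> : u * (cst c * mon a 0 + cst d * mon 0 b + G1) + v * (cst e * mon al be + H1)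
  = cst c * (mon a 0 * u) + cst d * (mon 0 b * u) + cst e * (mon al be * v)
    + (u * G1 + v * H1) by ring.
rewrite coefD [X in _ + X](_ : _ = 0) ?addr0.
  by rewrite !coefD !coef_cstM !coef_monM !leq0n andbT /= !subn0.
apply: (_ : wge b a n.+1 _) => [|]; last by rewrite ijn.
apply: wgeD.
- by apply: wge_le (wgeM un wG1); lia.
- by apply: wge_le (wgeM vn wH1); lia.
Qed.

(** Reading the coefficients of weight n outside [inB] shows that the part of [u] of weight n - a b
    is divisible by the initial form of H. Subtracting a multiple of H removes this part, and the
    weight of [v] rises as a consequence. *)
Let step u v n : supported inB (u * G + v * H) ->
  wge b a (n - a * b) u -> wge b a (n - D) v ->
  (forall i j, (b * i + a * j = n)%N -> (u * G + v * H) i j = 0) /\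
  exists w, wge b a (n.+1 - a * b) (u - w * H) /\ wge b a (n.+1 - D) (v + w * G).
Proof.
move=> sB un vn; have lead := leading_eq un vn.
have claim1 i j : (b * i + a * j + a * b = n)%N -> (i < al)%N -> u i j = 0.
  (* The coefficient is read off at x^i y^(j + b); the term x^a of G contributes there only through
     [u (i - a) (j + b)], which the induction covers. *)
  elim/ltn_ind: i j => i IH j ijn ial.
  have Gb0 : G 0 b != 0 by case: Gb => // al0; move: ial; rewrite al0.
  have ijbn : (b * i + a * (j + b) = n)%N by nia.
  have := lead _ _ ijbn; rewrite sB; last by rewrite /inB ltnNge leq_addl.
  rewrite leq_addl addnK [(al <= i)%N]leqNgt ial /= mulr0 addr0 => /esym/eqP.
  rewrite (_ : (if _ then _ else _) = 0) ?mulr0 ?add0r ?mulf_eq0 ?(negbTE Gb0) //=.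
    by move/eqP.
  by case: ifP => // ai; apply: IH; nia.
have claim2 i j : (b * i + a * j + a * b = n)%N -> (j < be)%N -> u i j = 0.
  move=> ijn jbe; have [ial|ial] := ltnP i al; first exact: claim1.
  have jb : (j < b)%N by exact: leq_trans beb.
  have ijan : (b * (i + a) + a * j = n)%N by nia.
  have := lead _ _ ijan; rewrite sB; last first.
    by rewrite /inB jb jbe mul1n ltn_add2r -leqNgt.
  rewrite leq_addl addnK !(leqNgt _ j) jb jbe andbF /= !mulr0 !addr0.
  move=> /esym/eqP.
  by rewrite mulf_eq0 (negbTE Ga) /= => /eqP.
have e0 i j : (b * i + a * j = n)%N -> (u * G + v * H) i j = 0.
  move=> ijn; have [|nB] := boolP (inB i j); last exact: sB.
  move=> /andP[jb]; rewrite (lead _ _ ijn) [(b <= j)%N]leqNgt jb mulr0 addr0.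
  have [jbe iB|jbe] := ltnP j be.
    rewrite andbF mulr0 addr0; case: ifP => ai; last by rewrite mulr0.
    by rewrite claim2 ?mulr0 //; nia.
  rewrite mul0n addn0 => ial; rewrite [(al <= i)%N]leqNgt ial /= mulr0 addr0.
  case: ifP => ai; last by rewrite mulr0.
  by rewrite claim1 ?mulr0 //; nia.
split=> //.
(* The lowest part of [u], divided by x^al y^be. *)
pose r := shift al be (restrict (fun i j => b * i + a * j + a * b == n)%N u).
pose w := cst (H al be)^-1 * r.
have wr : wge b a (n - a * b - D) r.
  move=> i j ij /=; case: eqP => // e; exfalso; move: e ij; rewrite /D; nia.
have ww : wge b a (n - a * b - D) w by exact: wgeMl.
have u'n : wge b a (n.+1 - a * b) (u - w * H).
  rewrite [in w * H]HE.
  have -> : u - w * (cst (H al be) * mon al be + H1)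
      = u - (cst (H al be)^-1 * cst (H al be)) * (mon al be * r) - w * H1.
    by rewrite /w; ring.
  rewrite -rmorphM mulVf // rmorph1 mul1r; apply: wgeB.
    move=> i j ij; rewrite coefB coef_monM /=.
    have [ijn|ijn] := eqVneq (b * i + a * j + a * b)%N n; last first.
      have u0 : u i j = 0 by apply: un; lia.
      by rewrite u0; case: ifP => [/andP[ali bej]|_]; rewrite ?subr0 // !subnK // u0 if_same subr0.
    case: ifP => [/andP[ali bej]|/negbT]; first by rewrite !subnK // ijn eqxx subrr.
    rewrite negb_and -!ltnNge subr0 => /orP[ial|jbe]; [exact: claim1|exact: claim2].
  by apply: wge_le (wgeM ww wH1); lia.
exists w; split=> // i j ij.
have v'n : wge b a (n - D) (v + w * G).
  apply: wgeD => //; apply: wge_le (wgeM ww wG); lia.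
have [ijn|ijn] := ltnP (b * i + a * j) (n - D); first exact: v'n.
have u'n' : wge b a (n - a * b) (u - w * H) by apply: wge_le u'n; lia.
have E : (u - w * H) * G + (v + w * G) * H = u * G + v * H by ring.
have ijn' : (b * (i + al) + a * (j + be) = n)%N.
  by rewrite !mulnDr addnACA -/D; lia.
have := leading_eq u'n' v'n ijn'.
rewrite E (e0 _ _ ijn') (leq_addl i al) (leq_addl j be) andTb !addnK.
rewrite (_ : (if (a <= _)%N then _ else _) = 0) ?mulr0 ?add0r; last first.
  case: ifP => [ai|//]; apply: u'n; rewrite mulnBr.
  have ba : (b * a <= b * (i + al))%N by rewrite leq_mul2l ai orbT.
  by clear -ba ijn' b0; lia.
rewrite (_ : (if (b <= _)%N then _ else _) = 0) ?mulr0 ?add0r; last first.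
  case: ifP => [bj|//]; apply: u'n; rewrite mulnBr.
  have ba : (a * b <= a * (j + be))%N by rewrite leq_mul2l bj orbT.
  by clear -ba ijn' b0; lia.
by move=> /esym/eqP; rewrite mulf_eq0 (negbTE Hab) /= => /eqP.
Qed.

(** One induction serves two ends: the first half gives the independence of the monomials in [inB],
    the second the regularity of the pair. *)
Let iterate u v n : supported inB (u * G + v * H) ->
  wge b a n (u * G + v * H) /\
  exists w, wge b a (n - a * b) (u - w * H) /\ wge b a (n - D) (v + w * G).
Proof.
move=> sB; elim: n => [|n [en [w [un vn]]]].
  by split=> //; exists 0; split; exact: wge0.
have E : (u - w * H) * G + (v + w * G) * H = u * G + v * H by ring.
have [e0 [w' [un' vn']]] : _ /\ _ := step (eq_ind_r _ sB E) un vn.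
split.
  move=> i j; rewrite ltnS leq_eqVlt => /orP[/eqP ijn|]; last exact: en.
  by rewrite -E; exact: e0.
exists (w + w'); split.
- by have -> : u - (w + w') * H = u - w * H - w' * H by ring.
- by have -> : v + (w + w') * G = v + w * G + w' * G by ring.
Qed.

Lemma regular_pair_syzygies : syzygies G H.
Proof.
move=> u v N uv; have sB : supported inB (u * G + v * H) by rewrite uv.
have [_ [w [un vn]]] := iterate ((b + a) * N + a * b + D) sB.
by exists w; split; apply: (@wge_ordge _ b a) => //; apply: wge_le; [|exact: un| |exact: vn]; lia.
Qed.

Let reduces n (f : cseries) := exists g h, [/\ supported inB g, wge b a n g,
  gen2 G H h & wge b a n.+1 (f - g - h)].

Let reducesD n f g : reduces n f -> reduces n g -> reduces n (f + g).
Proof.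
move=> [f1 [f2 [? ? ? ?]]] [g1 [g2 [? ? ? ?]]]; exists (f1 + g1), (f2 + g2).
have [_ ID _] := ideal_gen2 G H.
split; [exact: supportedD|exact: wgeD|exact: ID|].
have -> : f + g - (f1 + g1) - (f2 + g2) = (f - f1 - f2) + (g - g1 - g2) by ring.
exact: wgeD.
Qed.

Let reducesM n c f : reduces n f -> reduces n (cst c * f).
Proof.
move=> [f1 [f2 [? ? ? ?]]]; exists (cst c * f1), (cst c * f2).
have [_ _ IM] := ideal_gen2 G H.
split; [exact: supportedM|exact: wgeMl|exact: IM|].
by rewrite -!mulrBr; exact: wgeMl.
Qed.

Let reduces_ideal n h f : gen2 G H h -> wge b a n.+1 (f - h) -> reduces n f.
Proof. by move=> hI fh; exists 0, h; rewrite subr0. Qed.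

Let reduces_shift n h f f' : gen2 G H h -> wge b a n.+1 (f - f' - h) ->
  reduces n f' -> reduces n f.
Proof.
move=> hI fh f'n; rewrite (_ : f = f' + (f - f')); last by ring.
by apply: reducesD; [exact: f'n|exact: (reduces_ideal hI fh)].
Qed.

Let GI c : gen2 G H (c * G).
Proof. by exists c, 0; rewrite mul0r addr0. Qed.
Let HI c : gen2 G H (c * H).
Proof. by exists 0, c; rewrite mul0r add0r. Qed.

(** Rewriting with the initial forms: x^al y^be goes to 0, y^b to a multiple of x^a when i < al, and
    x^a to a multiple of y^b when i >= al + a and j < be. The second rule lowers j, and after the
    third the first applies at once. *)
Let reduces_mon i j : reduces (b * i + a * j) (mon i j).
Proof.
have Hcase i' j' : (al <= i')%N -> (be <= j')%N -> reduces (b * i' + a * j') (mon i' j').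
  move=> ali bej; pose c := cst (H al be)^-1 * mon (i' - al) (j' - be).
  apply: (@reduces_ideal _ (c * H)) => //; rewrite HE.
  have -> : mon i' j' - c * (cst (H al be) * mon al be + H1) =
     mon i' j' - (cst (H al be)^-1 * cst (H al be)) * (mon (i' - al) (j' - be) * mon al be)
     - c * H1 by rewrite /c; ring.
  rewrite -rmorphM mulVf // rmorph1 mul1r monM !subnK //.
  rewrite subrr sub0r; apply: wgeN.
  have wc : wge b a (b * (i' - al) + a * (j' - be)) c by apply: wgeMl; exact: wge_mon.
  by apply: wge_le (wgeM wc wH1); rewrite /D; nia.
elim/ltn_ind: j i => j IH i.
have [iB|nB] := boolP (inB i j).
  exists (mon i j), 0; split; rewrite ?subrr //; last by exists 0, 0; rewrite !mul0r addr0.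
  - move=> i' j' nij /=; have [ei|//] := eqVneq i' i; have [ej|//] := eqVneq j' j.
    by move: nij; rewrite ei ej iB.
  - exact: wge_mon.
have [ial|ali] := ltnP i al.
  have Gb0 : G 0 b != 0 by case: Gb => // al0; move: ial; rewrite al0.
  have bj : (b <= j)%N.
    by rewrite leqNgt; apply: contra nB => jb; rewrite /inB jb ltn_addr.
  pose c := cst (G 0 b)^-1 * mon i (j - b).
  pose f' : cseries := cst (- (G 0 b)^-1 * G a 0) * mon (i + a) (j - b).
  apply: (@reduces_shift _ (c * G) _ f') => //.
    rewrite GE.
    have -> : mon i j - f' - c * (cst (G a 0) * mon a 0 + cst (G 0 b) * mon 0 b + G1)
       = (mon i j - cst (G 0 b)^-1 * cst (G 0 b) * (mon i (j - b) * mon 0 b))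
        + (cst (G 0 b)^-1 * cst (G a 0) *
             (mon (i + a) (j - b) - mon i (j - b) * mon a 0)) - c * G1.
      by rewrite /f' /c rmorphM rmorphN /=; ring.
    rewrite -rmorphM mulVf // rmorph1 mul1r !monM !addn0 subnK // !subrr mulr0 addr0 sub0r.
    apply: wgeN.
    have wc : wge b a (b * i + a * (j - b)) c by apply: wgeMl; exact: wge_mon.
    by apply: wge_le (wgeM wc wG1); nia.
  apply: reducesM; have -> : (b * i + a * j = b * (i + a) + a * (j - b))%N by nia.
  by apply: IH; lia.
have [jbe|bej] := ltnP j be; last exact: Hcase.
have ai : (al + a <= i)%N.
  rewrite leqNgt; apply: contra nB => iala.
  by rewrite /inB jbe mul1n iala (leq_trans jbe beb).
pose c := cst (G a 0)^-1 * mon (i - a) j.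
pose f' : cseries := cst (- (G a 0)^-1 * G 0 b) * mon (i - a) (j + b).
apply: (@reduces_shift _ (c * G) _ f') => //.
  rewrite GE.
  have -> : mon i j - f' - c * (cst (G a 0) * mon a 0 + cst (G 0 b) * mon 0 b + G1)
     = (mon i j - cst (G a 0)^-1 * cst (G a 0) * (mon (i - a) j * mon a 0))
      + (cst (G a 0)^-1 * cst (G 0 b) *
           (mon (i - a) (j + b) - mon (i - a) j * mon 0 b)) - c * G1.
    by rewrite /f' /c rmorphM rmorphN /=; ring.
  rewrite -rmorphM mulVf // rmorph1 mul1r !monM !addn0 subnK ?subrr ?mulr0 ?addr0 ?sub0r; last lia.
  apply: wgeN.
  have wc : wge b a (b * (i - a) + a * j) c by apply: wgeMl; exact: wge_mon.
  by apply: wge_le (wgeM wc wG1); nia.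
apply: reducesM; have -> : (b * i + a * j = b * (i - a) + a * (j + b))%N by nia.
by apply: Hcase; lia.
Qed.

Let reduces_wge n f : wge b a n f -> reduces n f.
Proof.
move=> fn; pose p : cseries := \sum_(i < n.+1) \sum_(j < n.+1 | (b * i + a * j == n)%N)
  cst (f i j) * mon i j.
have pE i j : (b * i + a * j <= n)%N -> p i j = f i j.
  move=> ij; have i_n : (i < n.+1)%N by nia.
  have j_n : (j < n.+1)%N by nia.
  rewrite /p coef_sum (bigD1 (Ordinal i_n)) //= [X in _ + X]big1 ?addr0; last first.
    move=> i' ni; rewrite coef_sum big1 // => j' _; rewrite coef_cstM /=.
    by move: ni; rewrite -val_eqE /= eq_sym => /negbTE ->; rewrite mulr0.
  rewrite coef_sum; have [ijn|ijn] := eqVneq (b * i + a * j)%N n; last first.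
    rewrite fn; last by lia.
    rewrite big1 // => j' /eqP ij'; rewrite coef_cstM /=.
    have [jj|_] := eqVneq j (j' : nat); last by rewrite andbF mulr0.
    by move: ijn; rewrite jj ij' eqxx.
  have jP : (b * i + a * (Ordinal j_n : nat) == n)%N by rewrite /= ijn.
  rewrite (bigD1 _ jP) big1 => [|j' /andP[_]].
    by rewrite [LHS]addr0 coef_cstM /= !eqxx mulr1.
  by rewrite coef_cstM -val_eqE /= eq_sym => /negbTE ->; rewrite andbF mulr0.
have -> : f = p + (f - p) by ring.
apply: reducesD; last first.
  apply: (@reduces_ideal _ 0); first by have [] := ideal_gen2 G H.
  by move=> i j; rewrite ltnS => ij; rewrite subr0 coefB pE ?subrr.
have r0 : reduces n 0.
  apply: (@reduces_ideal _ 0); first by have [] := ideal_gen2 G H.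
  by rewrite subrr.
rewrite /p; apply: big_ind; [exact: r0|exact: (@reducesD n)|move=> i _].
apply: big_ind; [exact: r0|exact: (@reducesD n)|].
move=> j /eqP ijn; apply: reducesM.
by have := reduces_mon i j; rewrite ijn.
Qed.

(** Every monomial in [inB] has weight below W, so from weight W on a reduction leaves no
    remainder. *)
Let W := (b * (al + a) + a * b)%N.

Let supported_high n (g : cseries) : (W <= n)%N -> supported inB g -> wge b a n g -> g = 0.
Proof.
move=> Wn gB gn; apply: coefP => i j; rewrite coef0.
have [/andP[jb iB]|nB] := boolP (inB i j); last exact: gB.
apply: gn; apply: leq_trans Wn; rewrite /W.
have : (i < al + a)%N by apply: leq_trans iB _; case: (_ < _)%N; lia.
by nia.
Qed.

Let high_ideal (f : cseries) : ordge W f -> gen2 G H f.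
Proof.
move: f; apply: nakayama; first exact: ideal_gen2.
move=> f /(ordge_wge b0 a0) fW.
(* Weight (b + a)(W + 1) forces order W + 1, which is what Nakayama's lemma asks for. *)
suff [h hI hW] : exists2 h, gen2 G H h & wge b a (W + ((b + a) * W.+1 - W)) (f - h).
  exists h => //; apply: (@wge_ordge _ b a) => //; apply: wge_le hW; lia.
elim: (X in (W + X)%N) => [|n [h hI hn]].
  by exists 0; rewrite ?subr0 ?addn0 //; have [] := ideal_gen2 G H.
have [g [h' [gB gn h'I e]]] := reduces_wge hn.
have g0 : g = 0 by apply: supported_high gn => //; exact: leq_addr.
exists (h + h'); first by have [_ ID _] := ideal_gen2 G H; exact: ID.
rewrite addnS; have -> : f - (h + h') = f - h - g - h' by rewrite g0; ring.
exact: e.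
Qed.

Let spanning (f : cseries) : exists2 g, supported inB g & gen2 G H (f - g).
Proof.
have [_ ID _] := ideal_gen2 G H.
have approx n : exists g h, [/\ supported inB g, gen2 G H h & wge b a n (f - g - h)].
  elim: n => [|n [g [h [gB hI fn]]]].
    by exists 0, 0; split=> //; have [] := ideal_gen2 G H.
  have [g' [h' [g'B _ h'I e]]] := reduces_wge fn.
  exists (g + g'), (h + h'); split; [exact: supportedD|exact: ID|].
  by have -> : f - (g + g') - (h + h') = f - g - h - g' - h' by ring.
have [g [h [gB hI fn]]] := approx ((b + a) * W)%N.
exists g => //; have -> : f - g = (f - g - h) + h by ring.
by apply: ID => //; apply: high_ideal; exact: (@wge_ordge _ b a).
Qed.

Let s := [seq (i, j) | j <- iota 0 b, i <- iota 0 (al + (j < be) * a)].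

Let mem_s i j : ((i, j) \in s) = inB i j.
Proof.
apply/allpairsPdep/idP => [[j' [i' [jb iB [-> ->]]]]|/andP[jb iB]].
  by move: jb iB; rewrite !mem_iota /inB => /= -> ->.
by exists j, i; rewrite !mem_iota.
Qed.

Let uniq_s : uniq s.
Proof.
apply: allpairs_uniq_dep; [exact: iota_uniq|by move=> *; exact: iota_uniq|].
by move=> [j i] [j' i'] /= _ _ [-> ->].
Qed.

Let size_s : size s = D.
Proof.
rewrite size_allpairs_dep sumnE big_map.
under eq_bigr => j _ do rewrite size_iota.
by rewrite sum_steps (minn_idPl beb).
Qed.

Lemma regular_pair_codim : codim (gen2 G H) (b * al + a * be).
Proof.
rewrite -/D -size_s; exists (@monomials K s); split.
- move=> f; have [g gB gf] := spanning f.
  have gs : supported (fun i j => (i, j) \in s) g by move=> i j; rewrite mem_s; exact: gB.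
  exists (fun l : 'I_(size s) => g (nth (0, 0)%N s l).1 (nth (0, 0)%N s l).2).
  by rewrite -(supported_lincomb uniq_s gs).
- move=> c [u [v uv]] l; rewrite -(coef_lincomb_monomials c l uniq_s).
  have sB : supported inB (u * G + v * H).
    by rewrite -uv => i j ij; apply: lincomb_monomials_supported; rewrite mem_s.
  set i := _.1; set j := _.2.
  have [en _] := iterate (b * i + a * j).+1 sB.
  by rewrite uv; apply: en.
Qed.
End RegularPair.

Section EdgePair.
Variable K : numFieldType.
Local Notation cseries := (cseries K).
Implicit Types (G H : cseries).

Definition regular_codim G H n := codim (gen2 G H) n /\ syzygies G H.

Lemma regular_codim_addM G H c n : regular_codim G (H - c * G) n -> regular_codim G H n.
Proof.
move=> [cn syz]; split.
  apply: (codim_ext _ cn) => h; split=> -[u [v ->]].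
  - by exists (u - v * c), v; ring.
  - by exists (u + v * c), v; ring.
move=> u v N uv; have /syz-/(_ N)[w [wu wv]] : (u + v * c) * G + v * (H - c * G) = 0.
  by rewrite -uv; ring.
exists w; split; last exact: wv.
have -> : u - w * H = (u + v * c - w * (H - c * G)) - c * (v + w * G) by ring.
by apply: wgeB; [exact: wu|apply: wgeMl; exact: wv].
Qed.

Lemma regular_codimC G H n : regular_codim G H n -> regular_codim H G n.
Proof.
move=> [cn syz]; split.
  by apply: (codim_ext _ cn) => h; split; exact: gen2C.
move=> u v N uv; have /syz-/(_ N)[w [wu wv]] : v * G + u * H = 0 by rewrite addrC.
exists (- w); split; first by rewrite mulNr opprK.
by rewrite mulNr.
Qed.

Definition edge_form a b G := forall i j, (b * i + a * j <= a * b)%N -> G i j != 0 ->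
  (i, j) = (a, 0)%N \/ (i, j) = (0, b)%N.

(** Lifts the restriction be <= b: modulo the initial form of G, x^al y^be is a multiple of x^(al +
    a) y^(be - b), which has the same weight. *)
Lemma edge_monomial_codim G H a b al be : (0 < a)%N -> (0 < b)%N ->
  edge_form a b G -> G a 0 != 0 -> G 0 b != 0 ->
  (forall i j, (b * i + a * j <= b * al + a * be)%N -> H i j != 0 ->
    (i, j) = (al, be)) ->
  H al be != 0 -> regular_codim G H (b * al + a * be).
Proof.
move=> a0 b0 sG Ga Gb; elim/ltn_ind: be H al => be IH H al sH Hab.
have [beb|bbe] := leqP be b.
  split; first by apply: regular_pair_codim => //; right.
  by apply: (@regular_pair_syzygies _ G H a b al be) => //; right.
pose e := H al be / G 0 b.
pose c := cst e * mon al (be - b); apply: (@regular_codim_addM G H c).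
have cG i j : (c * G) i j = e *
    (if (al <= i)%N && (be - b <= j)%N then G (i - al)%N (j - (be - b))%N else 0).
  by rewrite /c -mulrA coef_cstM coef_monM.
have D : (b * al + a * be = b * (al + a) + a * (be - b))%N by rewrite mulnBr; nia.
rewrite D; apply: IH.
- by rewrite ltn_subrL b0; lia.
- move=> i j; rewrite -D => ij; rewrite coefB cG => nz.
  have [Hij|] := eqVneq (H i j) 0; last first.
    move=> /(sH _ _ ij)[ei ej]; exfalso; move/eqP: nz; apply.
    rewrite ei ej leqnn leq_subr /= subnn subKn ?(ltnW bbe) // /e mulfVK //.
    exact: subrr.
  move: nz; rewrite Hij sub0r oppr_eq0 mulf_eq0 negb_or => /andP[_].
  case: ifP => [/andP[ali bej] nz|_]; last by rewrite eqxx.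
  have ij' : (b * (i - al) + a * (j - (be - b)) <= a * b)%N.
    by rewrite !mulnBr; nia.
  have [[ei ej]|[ei ej]] := sG _ _ ij' nz.
    by congr (_, _); lia.
  have [ei' ej'] : i = al /\ j = be by lia.
  by move: Hab; rewrite -ei' -ej' Hij eqxx.
- have Hz : H (al + a)%N (be - b)%N = 0.
    apply/eqP/negPn/negP => /sH; rewrite -D => /(_ (leqnn _))[]; lia.
  rewrite coefB cG Hz sub0r oppr_eq0 leq_addr leqnn /= addKn subnn mulf_neq0 //.
  by rewrite mulf_neq0 ?invr_eq0.
Qed.

(** A multiple of G cancels the term x^(al + a) y^be of H. The minor decides whether the remaining
    term x^al y^(be + b) survives, that is, whether the two binomials are coprime. *)
Lemma edge_pair_codim G H a b al be : (0 < a)%N -> (0 < b)%N ->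
  edge_form a b G -> G a 0 != 0 -> G 0 b != 0 ->
  (forall i j, (b * i + a * j <= b * al + a * (be + b))%N -> H i j != 0 ->
    (i, j) = ((al + a)%N, be) \/ (i, j) = (al, (be + b)%N)) ->
  G a 0 * H al (be + b)%N != G 0 b * H (al + a)%N be ->
  regular_codim G H (b * al + a * (be + b)).
Proof.
move=> a0 b0 sG Ga Gb sH minor.
pose e := H (al + a)%N be / G a 0.
pose c := cst e * mon al be; apply: (@regular_codim_addM G H c).
have cG i j : (c * G) i j = e *
    (if (al <= i)%N && (be <= j)%N then G (i - al)%N (j - be)%N else 0).
  by rewrite /c -mulrA coef_cstM coef_monM.
apply: edge_monomial_codim => //.
- move=> i j ij; rewrite coefB cG => nz.
  have [eij|nij] := eqVneq (i, j) (al, (be + b)%N); first exact: eij.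
  exfalso; move/eqP: nz; apply.
  have [[-> ->]|nij'] := eqVneq (i, j) ((al + a)%N, be).
    by rewrite leq_addr leqnn /= addKn subnn /e mulfVK // subrr.
  have -> : H i j = 0.
    by apply/eqP/negPn/negP => /(sH _ _ ij)[] /eqP; apply/negP.
  rewrite sub0r; apply/eqP; rewrite oppr_eq0 mulf_eq0; apply/orP; right.
  case: ifP => // /andP[ali bej]; apply/negPn/negP => nz.
  have ij' : (b * (i - al) + a * (j - be) <= a * b)%N by rewrite !mulnBr; nia.
  have [[ei ej]|[ei ej]] := sG _ _ ij' nz.
    by move/eqP: nij'; apply; congr (_, _); lia.
  by move/eqP: nij; apply; congr (_, _); lia.
- rewrite coefB cG leqnn leq_addr /= subnn addKn subr_eq0.
  apply: contra minor => /eqP ->; rewrite /e; apply/eqP; field.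
  exact: Ga.
Qed.

End EdgePair.

(** * Newton polygons *)

(* If (a, b) is a vertex of the Newton polygon of G, where the adjacent edges have
   the weights (p1, q1) towards the x-axis and (p2, q2) towards the y-axis, then
   G factors up to arbitrarily high order as (x^a + L) (y^b + R). The corrections
   R and L are found by iterating (R, L) |-> the splitting of E - L R into
   x^a R + y^b L, where G = x^a y^b + E; this gains one degree at each step with
   respect to the sum of the two weights. *)
Section Hensel.
Variable K : numFieldType.
Local Notation cseries := (cseries K).
Implicit Types (G E F : cseries).
Variables (a b p1 q1 p2 q2 : nat).
Hypotheses (p1_gt0 : (0 < p1)%N) (q1_gt0 : (0 < q1)%N).
Hypotheses (p2_gt0 : (0 < p2)%N) (q2_gt0 : (0 < q2)%N).

Let right_part F : cseries := shift a 0 (restrict (fun i j => a <= i)%N F).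
Let left_part F : cseries := shift 0 b (restrict (fun i j => i < a)%N F).

(** The exponents lie on or above both edge lines through (a, b), and strictly above the line of the
    edge on the other side of the vertex. This strictness is what makes the iteration gain
    weight. *)
Let good F := [/\ wge p1 q1 (p1 * a + q1 * b) F, wge p2 q2 (p2 * a + q2 * b) F,
  (forall i j, (a <= i)%N -> (p2 * i + q2 * j <= p2 * a + q2 * b)%N -> F i j = 0) &
  (forall i j, (i < a)%N -> (p1 * i + q1 * j <= p1 * a + q1 * b)%N -> F i j = 0)].

Let right_ok F := wge p1 q1 (q1 * b) F /\ wge p2 q2 (q2 * b).+1 F.
Let left_ok F := wge p1 q1 (p1 * a).+1 F /\ wge p2 q2 (p2 * a) F.

Let P := (p1 + p2)%N.
Let Q := (q1 + q2)%N.

Let good_right F : good F -> right_ok (right_part F).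
Proof.
move=> [g1 g2 g3 g4]; split=> i j ij; rewrite /= leq_addl addn0.
- by apply: g1; rewrite mulnDr; lia.
- by apply: g3; rewrite ?leq_addl // mulnDr; lia.
Qed.

Let good_left F : good F -> left_ok (left_part F).
Proof.
move=> [g1 g2 g3 g4]; split=> i j ij; rewrite /= addn0; case: ifP => // ia.
- by apply: g4; rewrite ?mulnDr; lia.
- by apply: g2; rewrite mulnDr; lia.
Qed.

Let good_decomposition F : good F ->
  F = mon a 0 * right_part F + mon 0 b * left_part F.
Proof.
move=> [g1 g2 g3 g4]; apply: coefP => i j; rewrite coefD !coef_monM /= !subn0 andbT.
have [ai|ia] := leqP a i.
  by rewrite subnK // ai !addn0 ltnNge ai if_same addr0.
rewrite add0r !addn0; have [bj|jb] := leqP b j; first by rewrite subnK // ia.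
by apply: g1; nia.
Qed.

Let goodB F F' : good F -> good F' -> good (F - F').
Proof.
move=> [g1 g2 g3 g4] [h1 h2 h3 h4]; split; [exact: wgeB|exact: wgeB| |].
- by move=> i j ? ?; rewrite coefB g3 ?h3 ?subrr.
- by move=> i j ? ?; rewrite coefB g4 ?h4 ?subrr.
Qed.

Let goodM L R : left_ok L -> right_ok R -> good (L * R).
Proof.
move=> [l1 l2] [r1 r2]; have m1 := wgeM l1 r1; have m2 := wgeM l2 r2.
split.
- by apply: wge_le m1; lia.
- by apply: wge_le m2; lia.
- by move=> i j _ ij; apply: m2; lia.
- by move=> i j _ ij; apply: m1; lia.
Qed.

Let partB F F' : right_part F - right_part F' = right_part (F - F') /\
  left_part F - left_part F' = left_part (F - F').
Proof.
by split; apply: coefP => i j; rewrite coefB /=; case: ifP => _; rewrite ?subr0 ?coefB.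
Qed.

Let right_wge n F : wge P Q (P * a + n) F -> wge P Q n (right_part F).
Proof. by move=> Fn i j ij; rewrite /= leq_addl addn0; apply: Fn; rewrite mulnDr; lia. Qed.

Let left_wge n F : wge P Q (Q * b + n) F -> wge P Q n (left_part F).
Proof.
by move=> Fn i j ij; rewrite /= addn0; case: ifP => // _; apply: Fn; rewrite mulnDr; lia.
Qed.

Let right_ok_wge R : right_ok R -> wge P Q (Q * b).+1 R.
Proof.
move=> [r1 r2] i j; rewrite /P /Q !mulnDl => ij.
by have [h|h] := ltnP (p1 * i + q1 * j) (q1 * b); [exact: r1|apply: r2; lia].
Qed.

Let left_ok_wge L : left_ok L -> wge P Q (P * a).+1 L.
Proof.
move=> [l1 l2] i j; rewrite /P /Q !mulnDl => ij.
by have [h|h] := ltnP (p2 * i + q2 * j) (p2 * a); [exact: l2|apply: l1; lia].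
Qed.

Let approximation E n : good E -> exists R L R' L',
  [/\ right_ok R', left_ok L', R = right_part (E - L' * R'),
    L = left_part (E - L' * R') &
    wge P Q (Q * b + n) (R - R') /\ wge P Q (P * a + n) (L - L')].
Proof.
move=> gE; elim: n => [|n [R [L [R' [L' [okR' okL' eR eL [dR dL]]]]]]].
  have ok0 : right_ok 0 /\ left_ok 0 by [].
  exists (right_part E), (left_part E), 0, 0.
  rewrite mulr0 !subr0 !addn0; split; [by case: ok0|by case: ok0|by []|by []|].
  by split; apply: (@wge_le _ _ _ (_).+1);
    [|exact: (right_ok_wge (good_right gE))| |exact: (left_ok_wge (good_left gE))].
have gF' : good (E - L' * R') by apply: goodB => //; exact: goodM.
have okR : right_ok R by rewrite eR; exact: good_right.
have okL : left_ok L by rewrite eL; exact: good_left.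
have delta : wge P Q (P * a + Q * b + n.+1) (E - L * R - (E - L' * R')).
  have -> : E - L * R - (E - L' * R') = - ((L - L') * R' + L * (R - R')) by ring.
  apply: wgeN; apply: wgeD.
  - by apply: wge_le (wgeM dL (right_ok_wge okR')); lia.
  - by apply: wge_le (wgeM (left_ok_wge okL) dR); lia.
exists (right_part (E - L * R)), (left_part (E - L * R)), R, L; split; [exact: okR|exact: okL|by []|by []|].
have [eR' eL'] := partB (E - L * R) (E - L' * R').
split.
- by rewrite [in X in _ - X]eR eR'; apply: right_wge; rewrite addnA.
- by rewrite [in X in _ - X]eL eL'; apply: left_wge; rewrite addnA (addnC (Q * b)%N).
Qed.

Lemma hensel G N : G a b = 1 ->
  wge p1 q1 (p1 * a + q1 * b) G -> wge p2 q2 (p2 * a + q2 * b) G ->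
  (forall i j, (a <= i)%N -> (p2 * i + q2 * j <= p2 * a + q2 * b)%N ->
     G i j != 0 -> (i, j) = (a, b)) ->
  (forall i j, (i < a)%N -> (p1 * i + q1 * j <= p1 * a + q1 * b)%N -> G i j = 0) ->
  exists R L, [/\ wge p1 q1 (q1 * b) R, wge p2 q2 (q2 * b).+1 R,
    wge p1 q1 (p1 * a).+1 L & ordge N (G - (mon a 0 + L) * (mon 0 b + R))].
Proof.
move=> Gab G1 G2 G3 G4; pose E := G - mon a b.
have gE : good E.
  split.
  - by apply: wgeB => //; exact: wge_mon.
  - by apply: wgeB => //; exact: wge_mon.
  - move=> i j ai ij; rewrite coefB /=.
    have [Gij|/(G3 _ _ ai ij)[-> ->]] := eqVneq (G i j) 0; last first.
      by rewrite Gab !eqxx subrr.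
    rewrite Gij; have [ia|_] := eqVneq i a; last by rewrite subrr.
    have [jb|_] := eqVneq j b; last by rewrite subrr.
    by have := oner_neq0 K; rewrite -Gab -ia -jb Gij eqxx.
  - by move=> i j ia ij; rewrite coefB G4 //= (ltn_eqF ia) subrr.
have [R [L [R' [L' [okR' okL' eR eL [dR dL]]]]]] := approximation ((P + Q) * N) gE.
have gF' : good (E - L' * R') by apply: goodB => //; exact: goodM.
have [r1 r2] : right_ok R by rewrite eR; exact: good_right.
have okL : left_ok L by rewrite eL; exact: good_left.
exists R, L; split; [exact: r1|exact: r2|by case: okL|].
apply: (@wge_ordge _ P Q); rewrite ?addn_gt0 ?p1_gt0 ?q1_gt0 //.
have -> : G - (mon a 0 + L) * (mon 0 b + R) = (L' - L) * R' + L * (R' - R).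
  have decE : G - mon a b - L' * R' = mon a 0 * R + mon 0 b * L.
    by rewrite eR eL; exact: good_decomposition.
  have GE : G = mon a 0 * mon 0 b + L' * R' + (mon a 0 * R + mon 0 b * L).
    by rewrite -decE monM addn0 add0n; ring.
  by rewrite {1}GE; ring.
rewrite -(opprB R) -(opprB L) mulNr mulrN -opprD; apply: wgeN; apply: wgeD.
- by apply: wge_le (wgeM dL (right_ok_wge okR')); lia.
- by apply: wge_le (wgeM (left_ok_wge okL) dR); lia.
Qed.

End Hensel.

Section NewtonChain.
Variable K : numFieldType.
Local Notation cseries := (cseries K).
Implicit Types (G H : cseries).

(* The vertices (mx e, my e), e <= L, run from the x-axis to the y-axis; edge e
   leads from vertex e to vertex e+1 by (- X e, Y e). *)
Record newton_chain (L : nat) (X Y mx my : nat -> nat) : Prop := NewtonChain {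
  chainX : forall e, (e < L)%N -> mx e = (mx e.+1 + X e)%N;
  chainY : forall e, (e < L)%N -> my e.+1 = (my e + Y e)%N;
  chainX_gt0 : forall e, (e < L)%N -> (0 < X e)%N;
  chainY_gt0 : forall e, (e < L)%N -> (0 < Y e)%N;
  chain_end : mx L = 0%N;
  chain_convex : forall e e', (e < e' < L)%N -> (X e' * Y e < X e * Y e')%N }.

(* G, multiplied by y^s, has the chain as its Newton polygon, with no monomial
   on the polygon besides the vertices, where the coefficients are c e. *)
Definition has_polygon L (X Y mx my : nat -> nat) s (c : nat -> K) G :=
  (forall e, (e <= L)%N -> G (mx e) (my e - s)%N = c e) /\
  (forall e i j, (e < L)%N ->
    (Y e * i + X e * (j + s) <= Y e * mx e + X e * my e)%N -> G i j != 0 ->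
    (i, (j + s)%N) = (mx e, my e) \/ (i, (j + s)%N) = (mx e.+1, my e.+1)).

(* Induction on the number of edges: Hensel's lemma splits off the factor of G
   that belongs to edge 0. *)
Lemma chain_codim L X Y mx my (c d : nat -> K) G H :
  (0 < L)%N -> newton_chain L X Y mx my ->
  (forall e, (e <= L)%N -> c e != 0) ->
  (forall e, (e < L)%N -> c e * d e.+1 != c e.+1 * d e) ->
  has_polygon L X Y mx my (my 0%N) c G -> has_polygon L X Y mx my 0%N d H ->
  codim (gen2 G H) (\sum_(e < L) (Y e * mx e.+1 + X e * my e.+1)).
Proof.
case: L => // L _; elim: L X Y mx my c d G => [|L IH] X Y mx my c d G
  ch c0 cd [vG pG] [vH pH].
  have [eX eY X0 Y0 mx1 _] := ch.
  have mx0 : mx 0%N = X 0%N by rewrite eX // mx1.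
  have my1 : my 1%N = (my 0%N + Y 0%N)%N by rewrite eY.
  have G00 : G (X 0%N) 0%N = c 0%N by rewrite -vG // mx0 subnn.
  have G01 : G 0%N (Y 0%N) = c 1%N by rewrite -vG // mx1 my1 addKn.
  have H00 : H (0 + X 0%N)%N (my 0%N) = d 0%N by rewrite add0n -vH // mx0 subn0.
  have H01 : H 0%N (my 0%N + Y 0%N)%N = d 1%N by rewrite -vH // mx1 my1 subn0.
  have [] // := @edge_pair_codim K G H (X 0%N) (Y 0%N) 0 (my 0%N) (X0 0%N isT) (Y0 0%N isT).
  - move=> i j ij nz; have [|[-> e]|[-> e]] := pG 0%N i j isT _ nz.
    + by rewrite mx0; nia.
    + by left; rewrite mx0; congr (_, _); lia.
    + by right; rewrite mx1; congr (_, _); lia.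
  - by rewrite G00; exact: c0.
  - by rewrite G01; exact: c0.
  - move=> i j ij nz; have [|[-> e]|[-> e]] := pH 0%N i j isT _ nz.
    + by rewrite mx0; nia.
    + by left; rewrite mx0 add0n; congr (_, _); lia.
    + by right; rewrite mx1; congr (_, _); lia.
  - by rewrite G00 G01 H00 H01; exact: cd.
  by move=> cn _; rewrite big_ord1 /= mx1 my1.
have [eX eY X0 Y0 mxL conv] := ch.
set a := mx 1%N; set b := Y 0%N.
have mx0 : mx 0%N = (a + X 0%N)%N by rewrite eX.
have my1 : my 1%N = (my 0%N + b)%N by rewrite eY.
have mx2 : a = (mx 2%N + X 1%N)%N by rewrite /a eX.
have X00 := X0 0%N isT; have X01 := X0 1%N isT.
have Y00 := Y0 0%N isT; have Y01 := Y0 1%N isT.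
have c10 : c 1%N != 0 by exact: c0.
pose G1 := cst (c 1%N)^-1 * G.
have G1E i j : G1 i j = (c 1%N)^-1 * G i j by rewrite /G1 coef_cstM.
have G1nz i j : G1 i j != 0 -> G i j != 0.
  by rewrite G1E mulf_eq0 negb_or => /andP[].
pose n := (\sum_(e < L.+2) (Y e * mx e.+1 + X e * my e.+1))%N.
(* The factorisation is needed to order n + 1 for the final perturbation, and beyond all edge
   weights, which B bounds, for comparing coefficients. *)
pose B := (\sum_(e < L.+2) (Y e * mx e + X e * my e))%N.
have Bge e : (e < L.+2)%N -> (Y e * mx e + X e * my e <= B)%N.
  by move=> eL; rewrite /B (bigD1 (Ordinal eL)) //= leq_addr.
have Gab : G a b = c 1%N by rewrite -vG // my1 addKn.
have [|||||R [L' [R1 R2 L1 errN]]] := @hensel K a b (Y 0%N) (X 0%N) (Y 1%N) (X 1%N)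
    Y00 X00 Y01 X01 G1 (n.+1 + B) .
- by rewrite G1E Gab mulVf.
- move=> i j ij; apply/eqP/negPn/negP => /G1nz nz.
  have [|[ei ej]|[ei ej]] := pG 0%N i j isT _ nz; move: ij; rewrite ?mx0 ?my1; nia.
- move=> i j ij; apply/eqP/negPn/negP => /G1nz nz.
  have [|[ei ej]|[ei ej]] := pG 1%N i j isT _ nz; move: ij; rewrite -/a ?my1 ?mx2; try nia.
  by have := eY 1%N isT; nia.
- move=> i j ai ij /G1nz nz; have [|[-> ej]|[ei ej]] := pG 1%N i j isT _ nz.
  + by rewrite -/a my1; nia.
  + by congr (_, _); lia.
  + by exfalso; lia.
- move=> i j ia ij; apply/eqP/negPn/negP => /G1nz nz.
  have [|[ei ej]|[ei ej]] := pG 0%N i j isT _ nz; [|lia|lia].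
  by rewrite mx0; nia.
pose g := mon 0 b + R; pose G' := cst (c 1%N) * (mon a 0 + L').
have errE i j : (i + j < n.+1 + B)%N -> G i j = (G' * g) i j.
  move=> ij; apply/eqP; rewrite -subr_eq0 -coefB.
  have -> : G - G' * g = cst (c 1%N) * (G1 - (mon a 0 + L') * (mon 0 b + R)).
    by rewrite /G' /g /G1 mulrBr mulrA -rmorphM mulfV // rmorph1; ring.
  by rewrite coef_cstM errN ?mulr0 //; lia.
have Rlead i j : (Y 0%N * i + X 0%N * j = X 0%N * b)%N -> (i, j) <> (0, b)%N ->
    R i j = (c 1%N)^-1 * G (i + a)%N j.
  move=> ij nij; have ij_le : (i + a + j < n.+1 + B)%N.
    by have := Bge 0%N isT; rewrite mx0; nia.
  rewrite errE // /G' -mulrA coef_cstM mulKf // /g.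
  have -> : (mon a 0 + L') * (mon 0 b + R) =
     mon a 0 * mon 0 b + mon a 0 * R + mon 0 b * L' + L' * R by ring.
  rewrite monM !coefD !coef_monM coef_mon leq_addl !leq0n andbT andTb addnK !subn0 add0n addn0.
  have -> : (i + a == a)%N && (j == b) = false.
    by apply/negP => /andP[/eqP ia /eqP jb]; apply: nij; congr (_, _) => //; lia.
  rewrite add0r [(L' * R) _ _](wgeM L1 R1) ?addr0; last by nia.
  by case: ifP => [bj|_]; rewrite ?addr0 // L1 ?addr0 //; rewrite mulnBr; nia.
have g0b : g 0 b = 1.
  by rewrite /g coefD /= eqxx R2 ?addr0 // muln0 add0n ltnS.
have gX0 : g (X 0%N) 0 = (c 1%N)^-1 * c 0%N.
  rewrite /g coefD /= (gtn_eqF X00) add0r Rlead; first last.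
  - by case=> /eqP; rewrite (gtn_eqF X00).
  - by rewrite /b; nia.
  by rewrite -(vG 0%N) // mx0 subnn addnC.
(* On edge 0, [g] carries the binomial of G divided by c 1 x^a, so up to the factor c 1 the minor is
   that of [c] and [d] at e = 0. *)
have [cg syz] : regular_codim g H (Y 0%N * mx 1%N + X 0%N * (my 0%N + Y 0%N))%N.
  apply: edge_pair_codim => //.
  - move=> i j ij nz; have [[-> ->]|nij] := pselect ((i, j) = (0, b)%N); first by right.
    have Rij : R i j != 0.
      move: nz; rewrite /g coefD coef_mon.
      have -> : (i == 0%N) && (j == b) = false.
        by apply/negP => /andP[/eqP i0 /eqP jb]; case: nij; rewrite i0 jb.
      by rewrite add0r.
    have ijE : (Y 0%N * i + X 0%N * j = X 0%N * b)%N.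
      apply/eqP; rewrite eqn_leq ij /=.
      by rewrite leqNgt; apply: contra Rij => /R1 ->.
    have nzG : G (i + a)%N j != 0.
      by apply: contra Rij => /eqP Gz; rewrite (Rlead _ _ ijE nij) Gz mulr0.
    have [|[ei ej]|[ei ej]] := pG 0%N (i + a)%N j isT _ nzG.
    + by rewrite mx0; nia.
    + by left; congr (_, _); lia.
    + by right; congr (_, _); lia.
  - by rewrite gX0 mulf_neq0 ?invr_eq0 //; exact: c0.
  - by rewrite -/b g0b oner_neq0.
  - move=> i j ij nz; have [|[-> ej]|[-> ej]] := pH 0%N i j isT _ nz.
    + by rewrite mx0; nia.
    + by left; rewrite mx0; congr (_, _); lia.
    + by right; congr (_, _); lia.
  - rewrite gX0 -/b g0b mul1r -my1 -/a -mx0.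
    have -> : H a (my 1%N) = d 1%N by rewrite -vH // subn0.
    have -> : H (mx 0%N) (my 0%N) = d 0%N by rewrite -vH // subn0.
    apply: contra (cd 0%N isT) => /eqP <-.
    by apply/eqP; field.
(* By convexity R lies strictly above y^b for the weights of the later edges; there the initial form
   of [g] is y^b, and G' inherits the edges of G moved down by b. *)
have Rsteep e : (0 < e)%N -> (e < L.+2)%N -> wge (Y e) (X e) (X e * b).+1 R.
  move=> e0 eL i j ij; apply: R2.
  have [e1|ne1] := eqVneq e 1%N; first by rewrite -e1.
  have Xe := X0 e eL; have Ye := Y0 e eL.
  have cv : (X e * Y 1%N < X 1%N * Y e)%N by apply: conv; rewrite eL andbT; lia.
  have [jb|bj] := ltnP j b; last first.
    have [-> ->] : i = 0%N /\ j = b by nia.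
    lia.
  rewrite ltnS in ij; rewrite ltnS.
  have h1 : (Y e * i <= X e * (b - j))%N by rewrite mulnBr; lia.
  suff : (X e * (Y 1%N * i) <= X e * (X 1%N * (b - j)))%N.
    by rewrite leq_pmul2l // mulnBr; have : (X 1%N * j <= X 1%N * b)%N; [rewrite leq_mul2l (ltnW jb) orbT|lia].
  apply: (@leq_trans (X 1%N * Y e * i)); first by rewrite mulnA leq_mul2r (ltnW cv) orbT.
  by rewrite -mulnA [in leqRHS]mulnCA leq_mul2l h1 orbT.
have G'lead e i j : (0 < e)%N -> (e < L.+2)%N ->
    wge (Y e) (X e) (Y e * i + X e * j) G' ->
    (Y e * i + X e * (j + my 1%N) <= Y e * mx e + X e * my e)%N ->
    G' i j = G i (j + b)%N.
  move=> e0 eL wG' ij; rewrite errE; last first.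
    by have := Bge e eL; have := X0 e eL; have := Y0 e eL; nia.
  have -> : G' * g = mon 0 b * G' + G' * R by rewrite /g; ring.
  rewrite coefD coef_monM leq0n leq_addl addnK subn0 andbT.
  by rewrite (wgeM wG' (Rsteep e e0 eL)) ?addr0 //; nia.
(* [G'lead] presupposes a lower bound on the weight of G', so the bound is raised by one at a time:
   the coefficients of weight m are those of G, which vanish. *)
have G'wge e m : (0 < e)%N -> (e < L.+2)%N ->
    (m + X e * my 1%N <= Y e * mx e + X e * my e)%N -> wge (Y e) (X e) m G'.
  move=> e0 eL; elim: m => [|m IHm] mle; first exact: wge0.
  have wG' : wge (Y e) (X e) m G' by apply: IHm; lia.
  move=> i j; rewrite ltnS leq_eqVlt => /orP[/eqP ijm|]; last exact: wG'.
  rewrite (G'lead e) ?ijm //; last by rewrite mulnDr; lia.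
  apply/eqP/negPn/negP => nz.
  have ee : (Y e * mx e + X e * my e = Y e * mx e.+1 + X e * my e.+1)%N.
    by rewrite eX // eY //; nia.
  have [|[ei ej]|[ei ej]] := pG e i (j + b)%N eL _ nz;
    have := my1; rewrite ?ei; nia.
have G'E e i j : (0 < e)%N -> (e < L.+2)%N ->
    (Y e * i + X e * (j + my 1%N) <= Y e * mx e + X e * my e)%N ->
    G' i j = G i (j + b)%N.
  move=> e0 eL ij; apply: (G'lead e) => //; apply: G'wge => //.
  by rewrite mulnDr in ij; lia.
have my_mono e : (e <= L.+1)%N -> (my 1%N <= my e.+1)%N.
  by elim: e => // e IHe eL; rewrite (eY e.+1) //; have := IHe (ltnW eL); lia.
have cG' : codim (gen2 G' H) (\sum_(e < L.+1) (Y e.+1 * mx e.+2 + X e.+1 * my e.+2)).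
  apply: (IH (fun e => X e.+1) (fun e => Y e.+1) (fun e => mx e.+1)
    (fun e => my e.+1) (fun e => c e.+1) (fun e => d e.+1)).
  - split=> [e eL|e eL|e eL|e eL||e e' eL] //=.
    + by rewrite eX.
    + by rewrite eY.
    + exact: X0.
    + exact: Y0.
    + by apply: conv; lia.
  - by move=> e eL; exact: c0.
  - by move=> e eL; exact: cd.
  - split=> [e eL|e i j eL ij nz].
    + have mye := my_mono e eL.
      rewrite -(vG e.+1) //.
      have -> : (my e.+1 - my 0%N = my e.+1 - my 1%N + b)%N by lia.
      have [eL1|] := ltnP e L.+1.
        by apply: (G'E e.+1) => //; rewrite subnK.
      move=> Le; have eE : e = L.+1 by lia.
      rewrite eE; apply: (G'E L.+1) => //; rewrite subnK; last by rewrite -eE.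
      by rewrite (eX L.+1) // (eY L.+1) //; nia.
    + have := nz; rewrite (G'E e.+1) // => nzG.
      have -> : (j + my 1%N = j + b + my 0%N)%N by lia.
      by apply: (pG e.+1) => //; move: ij; rewrite my1; nia.
  - split=> [e eL|e i j eL ij nz]; first exact: vH.
    exact: pH.
have cgG' := codim_mul cg cG' _.
have nE : n = (Y 0%N * mx 1%N + X 0%N * (my 0%N + Y 0%N) +
    \sum_(e < L.+1) (Y e.+1 * mx e.+2 + X e.+1 * my e.+2))%N.
  by rewrite /n big_ord_recl /= my1.
(* G and g G' agree in all degrees up to n + B, and n is the codimension just computed for g G'. *)
rewrite -/n; apply: (@gen2_perturb _ (g * G')).
  rewrite nE; apply: cgG' => u v N uv.
  by have [w [? _]] := syz u v N uv; exists w.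
move=> i j ij; rewrite coefB [g * G']mulrC -errE ?subrr //.
by rewrite !mul1n in ij; lia.
Qed.

End NewtonChain.

(** * The Milnor number *)

Section Milnor.
Variable K : numFieldType.
Local Notation cseries := (cseries K).
Implicit Types (f g h : cseries).

Lemma convergent2_scaled (f : cseries) (g : series2 K) a b :
  (forall i j, `|g i j| <= `|f (i + a)%N (j + b)%N| * 2 ^+ (i + j + a + b)) ->
  convergent2 g.
Proof.
move=> gf; have [r [M [r0 H]]] := coef_cvg f.
exists (r / 2), (M / (r / 2) ^+ (a + b)); split=> [|i j]; first by rewrite divr_gt0.
rewrite ler_pdivlMr ?exprn_gt0 ?divr_gt0 // -mulrA -exprD.
apply: le_trans (ler_wpM2r _ (gf i j)) _; first by rewrite exprn_ge0 // divr_ge0 // ltW.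
have <- : (i + j + a + b = i + j + (a + b))%N by rewrite addnA.
rewrite -mulrA -exprMn mulrCA divff ?mulr1 ?pnatr_eq0 //.
by apply: le_trans (H (i + a)%N (j + b)%N); rewrite ler_wpM2l //; have -> : (i + j + a + b = i + a + (j + b))%N by lia.
Qed.

Lemma convergent2_dx f : convergent2 (dx (coef f)).
Proof.
apply: (@convergent2_scaled f _ 1 0) => i j.
rewrite /dx normrMn addn1 !addn0 -[X in X <= _]mulr_natr ler_wpM2l //.
apply: le_trans (leq_S_exp2 _ i) _; apply: ler_weXn2l; first by rewrite ler1n.
by lia.
Qed.

Lemma convergent2_dy f : convergent2 (dy (coef f)).
Proof.
apply: (@convergent2_scaled f _ 0 1) => i j.
rewrite /dy normrMn addn1 !addn0 -[X in X <= _]mulr_natr ler_wpM2l //.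
apply: le_trans (leq_S_exp2 _ j) _; apply: ler_weXn2l; first by rewrite ler1n.
by lia.
Qed.

Definition cdx f : cseries := mkcs (convergent2_dx f).
Definition cdy f : cseries := mkcs (convergent2_dy f).

Lemma coef_lincomb m (a : 'I_m -> K) (e : 'I_m -> cseries) i j :
  lincomb a e i j = \sum_l a l * e l i j.
Proof. by rewrite coef_sum; apply: eq_bigr => l _; rewrite coef_cstM. Qed.

Lemma ideal2_gen2 f g h : ideal2 (coef f) (coef g) (coef h) <-> gen2 f g h.
Proof.
split=> [[u [v [cu cv e]]]|[u [v ->]]].
  exists (mkcs cu), (mkcs cv); apply: coefP => i j.
  by rewrite coefD !coefM -[coef h]/(coef h) e.
exists (coef u), (coef v); split; [exact: coef_cvg|exact: coef_cvg|].
by apply/funext => i; apply/funext => j; rewrite coefD !coefM.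
Qed.

Lemma milnor_codim f m :
  milnor_number (coef f) m <-> codim (gen2 (cdx f) (cdy f)) m.
Proof.
have idE (g : cseries) (e : 'I_m -> cseries) (a : 'I_m -> K) :
    ideal2 (dx (coef f)) (dy (coef f)) (fun i j => g i j - \sum_l a l * e l i j)
    <-> gen2 (cdx f) (cdy f) (g - lincomb a e).
  rewrite -ideal2_gen2; suff -> : coef (g - lincomb a e) =
    fun i j => g i j - \sum_l a l * e l i j by [].
  by apply/funext => i; apply/funext => j; rewrite coefB coef_lincomb.
split=> [[e [ce H]]|[e [se fe]]].
- pose E l := mkcs (ce l); exists E; split=> [g|a Ia l].
    have [a [Ha _]] := H _ (coef_cvg g); exists a; exact/idE.
  have [b [_ ub]] := H _ (coef_cvg (lincomb a E)).
  have b0 : b = [ffun => 0].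
    apply: ub; apply/(idE _ E); rewrite (_ : lincomb [ffun=> 0] E = 0); first by rewrite subr0.
    by rewrite /lincomb big1 // => k _; rewrite ffunE rmorph0 mul0r.
  have ba : b = [ffun k => a k].
    apply: ub; apply/(idE _ E); rewrite (_ : lincomb [ffun k => a k] E = lincomb a E).
      by rewrite subrr; have [] := ideal_gen2 (cdx f) (cdy f).
    by rewrite /lincomb; apply: eq_bigr => k _; rewrite ffunE.
  by have := congr1 (fun F : {ffun _} => F l) ba; rewrite b0 !ffunE.
- exists (fun l => coef (e l)); split=> [l|g cg]; first exact: coef_cvg.
  have [a Ia] := se (mkcs cg); exists [ffun k => a k]; split.
    apply/(idE (mkcs cg) e); rewrite (_ : lincomb [ffun k => a k] e = lincomb a e) //.
    by rewrite /lincomb; apply: eq_bigr => k _; rewrite ffunE.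
  move=> b /(idE (mkcs cg) e) Ib; apply/ffunP => l; rewrite ffunE.
  apply/eqP; rewrite -subr_eq0; apply/eqP; apply: (fe (fun k => a k - b k)).
  have -> : lincomb (fun k => a k - b k) e =
     (mkcs cg - lincomb b e) - (mkcs cg - lincomb a e).
    rewrite opprB addrC addrA subrK /lincomb -sumrB; apply: eq_bigr => k _.
    by rewrite rmorphB mulrBl.
  exact: ideal_sub (ideal_gen2 _ _) Ib Ia.
Qed.

Lemma coef_xdx f i j : (mon 1 0 * cdx f) i j = f i j *+ i.
Proof.
rewrite coef_monM leq0n andbT subn0; case: i => [|i]; first by rewrite mulr0n.
by rewrite subn1.
Qed.

Lemma coef_ydy f i j : (mon 0 1 * cdy f) i j = f i j *+ j.
Proof.
rewrite coef_monM leq0n andTb subn0; case: j => [|j]; first by rewrite mulr0n.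
by rewrite subn1.
Qed.

(* The series x f_x + y f_y and y f_y have the Newton polygon of f and generate
   the same ideal as x f_x and y f_y; additivity then removes the factors x
   and y. *)
Lemma milnor_chain L X Y mx my (c : nat -> K) f : (0 < L)%N ->
  newton_chain L X Y mx my -> my 0%N = 0%N -> (1 < mx 0%N)%N ->
  (forall e, (e <= L)%N -> c e != 0) -> has_polygon L X Y mx my 0%N c f ->
  exists m, codim (gen2 (cdx f) (cdy f)) m /\
    (m + my L + mx 0 = (\sum_(e < L) (Y e * mx e.+1 + X e * my e.+1)).+1)%N.
Proof.
move=> L0 ch my0 Q1 c0 [vf pf].
have [eX eY X0 Y0 mxL _] := ch.
set n := (\sum_(e < L) _)%N.
set x := mon 1 0 : cseries; set y := mon 0 1 : cseries.
pose G := x * cdx f + y * cdy f; pose H := y * cdy f.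
have GE i j : G i j = f i j *+ (i + j) by rewrite coefD coef_xdx coef_ydy mulrnDr.
have HE i j : H i j = f i j *+ j by rewrite coef_ydy.
have fnz i j k : f i j *+ k != 0 -> f i j != 0.
  by apply: contra => /eqP ->; rewrite mul0rn.
have pos e : (e <= L)%N -> (0 < mx e + my e)%N.
  rewrite leq_eqVlt => /orP[/eqP ->|eL]; last by rewrite eX //; have := X0 e eL; lia.
  by case: L L0 eY Y0 {ch vf pf eX X0 mxL c0 n} => // L _ eY Y0; rewrite eY //; have := Y0 L (ltnSn L); lia.
have cGH : codim (gen2 G H) n.
  apply: (@chain_codim K L X Y mx my (fun e => c e *+ (mx e + my e)) (fun e => c e *+ my e)) => //.
  - by move=> e eL; rewrite mulrn_eq0 negb_or -lt0n pos //= c0.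
  (* The minor is c e c (e + 1) times the determinant of the vertices e and e + 1, a positive
     integer. *)
  - move=> e eL; have z0 : c e * c e.+1 != 0 by rewrite mulf_neq0 ?c0 // ltnW.
    rewrite !mulrnAl !mulrnAr -!mulrnA (mulrC (c e.+1)).
    move: (c e * c e.+1) z0 => z z0.
    rewrite -[X in X == _]mulr_natr -[X in _ == X]mulr_natr (inj_eq (mulfI z0)) eqr_nat.
    rewrite eX // eY //; have := X0 e eL; have := Y0 e eL; nia.
  - split=> [e eL|e i j eL ij]; first by rewrite my0 subn0 GE -(vf e) // subn0.
    by rewrite GE my0 => /fnz; move: ij; rewrite my0; exact: pf.
  - split=> [e eL|e i j eL ij]; first by rewrite HE -(vf e) // !subn0.
    by rewrite HE => /fnz; exact: pf.
have f0j j : (j < my L)%N -> f 0%N j = 0.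
  case: L L0 eX eY X0 Y0 mxL {ch c0 n cGH pos} vf pf => // L _ eX eY X0 Y0 mxL vf pf jP.
  have XL := X0 L (ltnSn L); have YL := Y0 L (ltnSn L).
  apply/eqP/negPn/negP => nz; have [||] := pf L 0%N j (ltnSn L) _ nz.
  - by rewrite eX // mxL addn0 muln0 add0n add0n; move: jP; rewrite eY //; nia.
  - by case=> e0; rewrite eX // in e0; lia.
  - by case=> _ ej; lia.
have fi0 i : (i < mx 0%N)%N -> f i 0%N = 0.
  move=> iQ; have X00 := X0 0%N L0; have Y00 := Y0 0%N L0.
  apply/eqP/negPn/negP => nz; have [||] := pf 0%N i 0%N L0 _ nz.
  - by rewrite my0 addn0 muln0 addn0; nia.
  - by case=> ei; lia.
  - by case=> _ e0; rewrite eY // my0 in e0; lia.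
have fP : f 0%N (my L) != 0 by rewrite -mxL -[my L]subn0 vf // c0.
have fQ : f (mx 0%N) 0%N != 0 by rewrite -{2}my0 -[my 0%N]subn0 vf // c0.
have P0 : (0 < my L)%N by have := pos L (leqnn L); rewrite mxL.
have cxy : codim (gen2 (x * cdx f) H) n.
  apply: (codim_ext _ cGH) => h; split; apply: gen2_sub.
  - exact: ideal_gen2.
  - by exists 1, 1; rewrite /G /H; ring.
  - exact: gen2_r.
  - exact: ideal_gen2.
  - by exists 1, (-1); rewrite /G /H; ring.
  - exact: gen2_r.
(* Finite codimension passes to the larger ideal; additivity presupposes it for both factors. *)
have [n' _ cn'] : exists2 n', (n' <= n)%N & codim (gen2 (cdx f) H) n'.
  apply: (codim_sub (ideal_gen2 _ _) _ cxy); apply: gen2_sub.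
  - exact: ideal_gen2.
  - by exists x, 0; ring.
  - exact: gen2_r.
(* Here x is viewed as an edge form with a = 1 and an absent term y^b; b = my L + 1 is large enough
   for the condition be <= b. *)
have hx : forall i j, ((my L).+1 * i + 1 * j <= 1 * (my L).+1)%N -> x i j != 0 ->
    (i, j) = (1, 0)%N \/ (i, j) = (0, (my L).+1)%N.
  move=> i j _; rewrite coef_mon; have [->|_] := eqVneq i 1%N; last by rewrite eqxx.
  by have [->|_] := eqVneq j 0%N; [left|rewrite eqxx].
have hH : forall i j, ((my L).+1 * i + 1 * j <= (my L).+1 * 0 + 1 * my L)%N ->
    H i j != 0 -> (i, j) = (0%N, my L).
  move=> i j ij; rewrite HE => /fnz nz.
  have i0 : i = 0%N by nia.
  move: nz; rewrite i0 => nz; congr (_, _); apply/eqP; rewrite eqn_leq.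
  rewrite leqNgt; apply/andP; split; first by rewrite -leqNgt; nia.
  by rewrite leqNgt; apply: contra nz => /f0j ->.
have x10 : x 1%N 0%N != 0 by rewrite coef_mon oner_neq0.
have HP : H 0%N (my L) != 0 by rewrite HE mulrn_eq0 negb_or -lt0n P0.
have cx := @regular_pair_codim K x H 1 (my L).+1 0 (my L) isT isT hx x10
   (or_introl erefl) hH HP (leqnSn _).
have sx := @regular_pair_syzygies K x H 1 (my L).+1 0 (my L) isT isT hx x10
   (or_introl erefl) hH HP (leqnSn _).
have nE : n = (my L + n')%N.
  apply: (codim_uniq (ideal_gen2 _ _) cxy).
  rewrite muln0 add0n mul1n in cx.
  apply: (codim_mul cx cn') => u v N uv.
  by have [w [? _]] := sx u v N uv; exists w.
have [m _ cm] : exists2 m, (m <= n')%N & codim (gen2 (cdx f) (cdy f)) m.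
  apply: (codim_sub (ideal_gen2 _ _) _ cn'); apply: gen2_sub.
  - exact: ideal_gen2.
  - exact: gen2_l.
  - by exists 0, y; rewrite /H; ring.
have a0 : (0 < (mx 0%N).-1)%N by lia.
have dxE i j : cdx f i j = f i.+1 j *+ i.+1 by [].
(* The lowest pure power of x in f_x is x^(mx 0 - 1), which is therefore the multiplicity of f_x
   against y. *)
have hdx : forall i j, (1 * i + (mx 0%N).-1 * j <= (mx 0%N).-1 * 1)%N -> cdx f i j != 0 ->
    (i, j) = ((mx 0%N).-1, 0)%N \/ (i, j) = (0, 1)%N.
  move=> i [|j] ij nz; last by right; congr (_, _); nia.
  left; congr (_, _); move: nz; rewrite dxE => /fnz nz; apply/eqP.
  rewrite eqn_leq (_ : (i <= _)%N); last by lia.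
  by rewrite leqNgt; apply: contra nz => ilt; rewrite fi0 //; lia.
have hy : forall i j, (1 * i + (mx 0%N).-1 * j <= 1 * 0 + (mx 0%N).-1 * 1)%N -> y i j != 0 ->
    (i, j) = (0, 1)%N.
  move=> i j _; rewrite coef_mon; have [->|_] := eqVneq i 0%N; last by rewrite eqxx.
  by have [->|_] := eqVneq j 1%N; [|rewrite eqxx].
have dxQ : cdx f (mx 0%N).-1 0%N != 0.
  rewrite dxE prednK; last by lia.
  by rewrite mulrn_eq0 negb_or fQ andbT -lt0n; lia.
have y01 : y 0%N 1%N != 0 by rewrite coef_mon oner_neq0.
have cy := @regular_pair_codim K (cdx f) y (mx 0%N).-1 1 0 1 a0 isT hdx dxQ
   (or_introl erefl) hy y01 isT.
have sy := @regular_pair_syzygies K (cdx f) y (mx 0%N).-1 1 0 1 a0 isT hdx dxQ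
   (or_introl erefl) hy y01 isT.
have [cy' sy'] := regular_codimC (conj cy sy).
have n'E : n' = ((mx 0%N).-1 + m)%N.
  have cn'C : codim (gen2 H (cdx f)) n'.
    by apply: (codim_ext _ cn') => h; split; exact: gen2C.
  apply: (codim_uniq (ideal_gen2 _ _) cn'C).
  rewrite muln0 add0n muln1 in cy'.
  apply: (codim_mul cy').
    by apply: (codim_ext _ cm) => h; split; exact: gen2C.
  by move=> u v N uv; have [w [? _]] := sy' u v N uv; exists w.
exists m; split; first exact: cm.
by rewrite nE n'E; lia.
Qed.

End Milnor.

(** * Convex lattice chains *)

Section LatticeChains.
Local Open Scope nat_scope.
Implicit Types (u v w : nat * nat) (vs ws : seq (nat * nat)).

Definition sumx vs := \sum_(v <- vs) v.1.
Definition sumy vs := \sum_(v <- vs) v.2.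

Definition flatter u v := v.1 * u.2 < u.1 * v.2.
Definition wflatter u v := v.1 * u.2 <= u.1 * v.2.

(* The sum of the determinants of all pairs of vectors of the list, which is
   twice the area between the chain formed by the vectors and the segment
   joining its end points. *)
Fixpoint dets vs :=
  if vs is v :: vs' then v.1 * sumy vs' - sumx vs' * v.2 + dets vs' else 0.

Lemma sumx_cons v vs : sumx (v :: vs) = v.1 + sumx vs.
Proof. by rewrite /sumx big_cons. Qed.
Lemma sumy_cons v vs : sumy (v :: vs) = v.2 + sumy vs.
Proof. by rewrite /sumy big_cons. Qed.

Lemma wflatter_sum v vs : all (wflatter v) vs -> sumx vs * v.2 <= v.1 * sumy vs.
Proof.
elim: vs => [|u vs IH] /=; first by rewrite /sumx big_nil.
by rewrite /wflatter sumx_cons sumy_cons => /andP[uv /IH]; nia.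
Qed.

Definition convex_chain vs := pairwise flatter vs && all (fun v => 0 < v.1 + v.2) vs.

(** Zero vectors and parallel pairs have determinant zero, so dropping the former and adding up the
    latter preserves [dets]. The last clause compares a new first vector with the merged tail in the
    induction. *)
Lemma merge_parallel ws : pairwise wflatter ws -> exists vs,
  [/\ convex_chain vs, sumx vs = sumx ws, sumy vs = sumy ws, dets vs = dets ws &
    forall u, all (wflatter u) ws -> all (wflatter u) vs].
Proof.
elim: ws => [|w ws IH] /=; first by exists [::].
move=> /andP[wws /IH[vs [cv sx sy dv wv]]].
have [w0|w_neq0] := posnP (w.1 + w.2).
  exists vs; rewrite sumx_cons sumy_cons sx sy dv; split=> //; try lia.
  by move=> u /andP[_ /wv].
case: vs cv sx sy dv wv => [|v vs] cv sx sy dv wv.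
  exists [:: w]; rewrite !sumx_cons !sumy_cons /= -sx -sy -dv /convex_chain /= w_neq0.
  by split=> // u /andP[-> _].
have := wv _ wws => /= /andP[wv1 wvs].
move: cv; rewrite /convex_chain /= => /andP[/andP[vvs pvs] /andP[v0 avs]].
have [wv_eq|wv_lt] := leqP (w.1 * v.2) (v.1 * w.2).
  have wvE : w.1 * v.2 = v.1 * w.2 by move: wv1; rewrite /wflatter; lia.
  have v_sum : sumx vs * v.2 <= v.1 * sumy vs.
    by apply: wflatter_sum; apply: sub_all vvs => u; exact: ltnW.
  have w_sum := wflatter_sum wvs.
  exists ((w.1 + v.1, w.2 + v.2) :: vs); split.
  - rewrite /convex_chain /= pvs avs !andbT; apply/andP; split; last by lia.
    apply/allP => u uvs; have := allP vvs u uvs; have := allP wvs u uvs.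
    by rewrite /flatter /wflatter /=; nia.
  - by rewrite !sumx_cons -sx sumx_cons /=; lia.
  - by rewrite !sumy_cons -sy sumy_cons /=; lia.
  - rewrite -sx -sy -dv /= sumx_cons sumy_cons; nia.
  - move=> u /andP[uw /wv/=/andP[uv uvs]]; rewrite uvs andbT.
    by move: uw uv; rewrite /wflatter /=; nia.
exists (w :: v :: vs); split=> /=.
- rewrite /convex_chain /= vvs pvs w_neq0 v0 avs !andbT; apply/andP; split=> //.
  apply/allP => u uvs; have := allP vvs u uvs; rewrite /flatter => vu.
  have h : (v.1 * w.2) * (u.1 * v.2) < (w.1 * v.2) * (v.1 * u.2) by exact: ltn_mul.
  have e1 : (v.1 * w.2) * (u.1 * v.2) = (v.1 * v.2) * (u.1 * w.2) by lia.
  have e2 : (w.1 * v.2) * (v.1 * u.2) = (v.1 * v.2) * (w.1 * u.2) by lia.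
  by move: h; rewrite e1 e2 ltn_mul2l => /andP[].
- by rewrite sumx_cons sx [RHS]sumx_cons.
- by rewrite sumy_cons sy [RHS]sumy_cons.
- by rewrite -sx -sy -dv.
- by move=> u /andP[-> /wv].
Qed.

(* The chain (s, 0), (sg, 0), (a, b), (0, rh), (0, r), with parallel edges
   merged. *)
Lemma two_step_chain s r sg rh a b : 0 < sg -> 0 < rh -> sg <= s -> rh <= r ->
  sg * b + rh * a <= sg * rh -> exists vs,
  [/\ convex_chain vs, sumx vs = s, sumy vs = r & dets vs = s * r - (sg * b + rh * a)].
Proof.
move=> sg0 rh0 sgs rhr n_le.
(* The quadrilateral (0, 0), (sg, 0), (a, b), (0, rh) has double area sg b + rh a. The last
   hypothesis places (a, b) on or below the line through (sg, 0) and (0, rh), which makes the chain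
   convex. *)
have asg : a <= sg by nia.
have brh : b <= rh by nia.
pose ws := [:: (s - sg, 0); (sg - a, b); (a, rh - b); (0, r - rh)].
have abE : (sg - a) * (rh - b) + (sg * b + rh * a) = sg * rh + a * b.
  by rewrite mulnBl mulnBr; nia.
have [|vs [cv sx sy dv _]] := @merge_parallel ws.
  by rewrite /= /wflatter /=; do ?[apply/andP; split] => //; nia.
exists vs; split; [exact: cv| | |].
- by rewrite sx /sumx !big_cons big_nil /=; lia.
- by rewrite sy /sumy !big_cons big_nil /=; lia.
- rewrite dv /ws /= /sumx /sumy !big_cons !big_nil /= !muln0 !mul0n !subn0 !addn0.
  have e1 : (s - sg) * (b + (rh - b + (r - rh))) = (s - sg) * r by congr (_ * _); lia.
  have e2 : (sg - a) * (rh - b + (r - rh)) = (sg - a) * (rh - b) + (sg - a) * (r - rh).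
    by rewrite mulnDr.
  have e3 : (s - sg) * r + sg * r = s * r by rewrite -mulnDl subnK.
  have e4 : (sg - a) * (r - rh) + a * (r - rh) = sg * (r - rh) by rewrite -mulnDl subnK.
  have e5 : sg * (r - rh) + sg * rh = sg * r by rewrite -mulnDr subnK.
  rewrite e1 e2; move: e3 e4 e5 abE n_le.
  move: ((s - sg) * r) (sg * r) (s * r) ((sg - a) * (r - rh)) (a * (r - rh)) (sg * (r - rh)).
  move: (sg * rh) ((sg - a) * (rh - b)) (sg * b) (rh * a) (a * b).
  by clear; lia.
Qed.

(** Selects a triangle with legs rh and rh + 1 for the double area n: the lower bound makes n a
    combination of the legs, the upper bound keeps the middle vertex inside the triangle. *)
Lemma oblong_interval n r : 0 < r -> n <= r * r.+1 ->
  exists2 rh, 0 < rh <= r & rh * rh.-1 <= n <= rh * rh.+1.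
Proof.
elim: r => // r IH _ nr; have [r0|r0] := posnP r.
  by exists 1 => //; rewrite r0 in nr.
have [nle|nlt] := leqP n (r * r.+1).
  by have [rh /andP[? ?] ?] := IH r0 nle; exists rh => //; lia.
by exists r.+1; [lia|rewrite nr andbT /= mulnC ltnW].
Qed.

(** Write n = q rh + m with m < rh and raise m of the q summands rh to rh + 1; this is possible
    because m <= rh - 1 <= q. *)
Lemma consecutive_combination rh n : 0 < rh -> rh * rh.-1 <= n ->
  exists a b, rh.+1 * b + rh * a = n.
Proof.
move=> rh0 n_ge; have nE := divn_eq n rh; have m_lt := ltn_pmod n rh0.
have q_ge : n %% rh <= n %/ rh.
  apply: (@leq_trans rh.-1); first by lia.
  by rewrite leq_divRL // mulnC.
exists (n %/ rh - n %% rh), (n %% rh); rewrite mulnBr.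
have : rh * (n %% rh) <= rh * (n %/ rh) by rewrite leq_mul2l q_ge orbT.
lia.
Qed.

Definition transform (a b c d : nat) vs :=
  [seq (a * v.1 + b * v.2, c * v.1 + d * v.2) | v <- vs].

Lemma sumx_transform a b c d vs :
  sumx (transform a b c d vs) = a * sumx vs + b * sumy vs.
Proof.
rewrite /sumx big_map; elim: vs => [|v vs IH]; first by rewrite /sumy !big_nil; lia.
by rewrite sumy_cons !big_cons /= IH /sumy; lia.
Qed.

Lemma sumy_transform a b c d vs :
  sumy (transform a b c d vs) = c * sumx vs + d * sumy vs.
Proof.
rewrite /sumy big_map; elim: vs => [|v vs IH]; first by rewrite /sumx !big_nil; lia.
by rewrite sumx_cons !big_cons /= IH /sumx; lia.
Qed.

(** Each pairwise determinant is multiplied by that of the matrix, which is 1; the condition is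
    written without subtraction. *)
Lemma dets_transform a b c d vs : a * d = b * c + 1 ->
  dets (transform a b c d vs) = dets vs.
Proof.
move=> det1; elim: vs => //= v vs ->; rewrite sumx_transform sumy_transform.
congr (_ + _); set x := sumx vs; set y := sumy vs.
have e1 : (a * v.1 + b * v.2) * (c * x + d * y) =
    v.1 * y + (a * c * (v.1 * x) + b * c * (v.1 * y) + b * c * (v.2 * x) + b * d * (v.2 * y)).
  have -> : (a * v.1 + b * v.2) * (c * x + d * y) =
    a * d * (v.1 * y) + (a * c * (v.1 * x) + b * c * (v.2 * x) + b * d * (v.2 * y)) by lia.
  by rewrite det1; lia.
have e2 : (a * x + b * y) * (c * v.1 + d * v.2) =
    x * v.2 + (a * c * (v.1 * x) + b * c * (v.1 * y) + b * c * (v.2 * x) + b * d * (v.2 * y)).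
  have -> : (a * x + b * y) * (c * v.1 + d * v.2) =
    a * d * (x * v.2) + (a * c * (v.1 * x) + b * c * (v.1 * y) + b * d * (v.2 * y)) by lia.
  by rewrite det1; lia.
by rewrite e1 e2 subnDr.
Qed.

Lemma convex_transform a b c d vs : a * d = b * c + 1 ->
  convex_chain vs -> convex_chain (transform a b c d vs).
Proof.
move=> det1 /andP[pv av]; apply/andP; split.
  rewrite pairwise_map; apply: sub_pairwise pv => u v; rewrite /flatter /= => uv.
  have e1 : (a * v.1 + b * v.2) * (c * u.1 + d * u.2) =
    v.1 * u.2 + (b * c * (v.1 * u.2) + b * c * (v.2 * u.1) + a * c * (v.1 * u.1) + b * d * (v.2 * u.2)).
    have -> : (a * v.1 + b * v.2) * (c * u.1 + d * u.2) =
      a * d * (v.1 * u.2) + (b * c * (v.2 * u.1) + a * c * (v.1 * u.1) + b * d * (v.2 * u.2)) by lia.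
    by rewrite det1; lia.
  have e2 : (a * u.1 + b * u.2) * (c * v.1 + d * v.2) =
    u.1 * v.2 + (b * c * (v.1 * u.2) + b * c * (v.2 * u.1) + a * c * (v.1 * u.1) + b * d * (v.2 * u.2)).
    have -> : (a * u.1 + b * u.2) * (c * v.1 + d * v.2) =
      a * d * (u.1 * v.2) + (b * c * (v.1 * u.2) + a * c * (v.1 * u.1) + b * d * (v.2 * u.2)) by lia.
    by rewrite det1; lia.
  by rewrite e1 e2 ltn_add2r.
have a0 : 0 < a by case: a det1 => //; lia.
have d0 : 0 < d by case: d det1 => //; lia.
by rewrite all_map; apply: sub_all av => v /=; nia.
Qed.

(* Shears reduce the small values of k to a smaller pair, as in Euclid's
   algorithm; the remaining ones are reached by chains through (sg, 0), (a, b),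
   (0, rh) with sg and rh consecutive, because every n >= rh (rh - 1) is a
   combination of rh and rh + 1. *)
Lemma convex_chain_dets s r k : 0 < s -> 0 < r -> coprime s r -> k <= s * r ->
  exists vs, [/\ convex_chain vs, sumx vs = s, sumy vs = r & dets vs = k].
Proof.
have [n] := ubnP (s + r); elim: n s r k => // n IH s r k srn s0 r0 cop ksr.
(* s r - k is the double area left between the axes and the chain. *)
have kE : k = s * r - (s * r - k) by lia.
case: (ltngtP s r) => [sr|rs|srE].
- have [kle|klt] := leqP k (s * (r - s)).
    have [|||vs [cv sx sy dv]] := IH s (r - s) k _ s0 _ _ kle; try lia.
      by rewrite -(subnK (ltnW sr)) /coprime gcdnDr in cop.
    exists (transform 1 0 1 1 vs); rewrite sumx_transform sumy_transform sx sy.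
    by split; [exact: convex_transform| | |rewrite dets_transform]; lia.
  (* Now s r - k < s^2, so some rh <= s works; the other leg rh + 1 fits because s < r. *)
  have [rh rhs /andP[nge nle]] : exists2 rh, 0 < rh <= s &
      rh * rh.-1 <= s * r - k <= rh * rh.+1.
    by apply: oblong_interval => //; move: klt; rewrite mulnBr; lia.
  have [rh0 rh_s] := andP rhs.
  have [b [a abE]] := consecutive_combination rh0 nge.
  have [||vs [cv sx sy dv]] := @two_step_chain s r rh rh.+1 a b rh0 isT rh_s; try lia.
  by exists vs; split=> //; rewrite dv; lia.
- have [kle|klt] := leqP k ((s - r) * r).
    have [|||vs [cv sx sy dv]] := IH (s - r) r k _ _ r0 _ kle; try lia.
      by rewrite -(subnK (ltnW rs)) coprime_sym /coprime gcdnDr -/(coprime _ _) coprime_sym in cop.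
    exists (transform 1 1 0 1 vs); rewrite sumx_transform sumy_transform sx sy.
    by split; [exact: convex_transform| | |rewrite dets_transform]; lia.
  have [rh rhs /andP[nge nle]] : exists2 rh, 0 < rh <= r &
      rh * rh.-1 <= s * r - k <= rh * rh.+1.
    by apply: oblong_interval => //; move: klt; rewrite mulnBl; lia.
  have [rh0 rh_r] := andP rhs.
  have [a [b abE]] := consecutive_combination rh0 nge.
  have [||vs [cv sx sy dv]] := @two_step_chain s r rh.+1 rh a b isT rh0 _ rh_r; try lia.
  by exists vs; split=> //; rewrite dv; lia.
- have s1 : s = 1 by apply/eqP; move: cop; rewrite -srE /coprime gcdnn.
  rewrite -srE s1 in ksr *; rewrite s1 in srE.
  have [|||vs [cv sx sy dv]] := @two_step_chain 1 1 1 1 (1 - k) 0 isT isT; try lia.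
  by exists vs; split=> //; rewrite dv; lia.
Qed.

Definition positive_chain vs := convex_chain vs && all (fun v => (0 < v.1) && (0 < v.2)) vs.

(* With q = m p + r, the matrix with rows (m + 1, m) and (1, 1) maps the triangle
   with legs r and p - r to the triangle spanned by (q, 0), (0, p) and
   (m (p - r), r). *)
Lemma positive_chain_dets p q k : 0 < p -> p < q -> coprime p q -> 0 < q %% p ->
  k <= (q %% p) * (p - q %% p) -> exists vs ws,
  [/\ positive_chain vs, sumx vs = q, sumy vs = p & dets vs = k] /\
  [/\ positive_chain ws, sumx ws = p, sumy ws = q & dets ws = k].
Proof.
move=> p0 pq cop r0 kle; set r := q %% p in r0 kle *.
have rp : r < p by exact: ltn_pmod.
have qE : q = q %/ p * p + r by exact: divn_eq.
set m := q %/ p in qE.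
have m0 : 0 < m by rewrite divn_gt0 // ltnW.
have coprp : coprime r p by rewrite coprime_modl coprime_sym.
have cop1 : coprime r (p - r).
  by rewrite -(subnK (ltnW rp)) addnC /coprime gcdnDl in coprp.
have [|vs [cv sx sy dv]] := convex_chain_dets r0 _ cop1 kle; first by lia.
have [|||ws [cw tx ty dw]] := @convex_chain_dets (p - r) r k _ r0 _; try lia.
  by rewrite coprime_sym.
(* The second chain serves the diagram with interchanged axes, from (p, 0) to (0, q). *)
exists (transform m.+1 m 1 1 vs), (transform 1 1 m m.+1 ws); split.
- split; rewrite ?sumx_transform ?sumy_transform ?dets_transform ?sx ?sy //; try lia.
  apply/andP; split; first by apply: convex_transform => //; lia.
  by move: cv => /andP[_ av]; rewrite all_map; apply: sub_all av => v /=; nia.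
- split; rewrite ?sumx_transform ?sumy_transform ?dets_transform ?tx ?ty //; try lia.
  apply/andP; split; first by apply: convex_transform => //; lia.
  by move: cw => /andP[_ av]; rewrite all_map; apply: sub_all av => v /=; nia.
Qed.

Lemma sumx_cat vs ws : sumx (vs ++ ws) = sumx vs + sumx ws.
Proof. by rewrite /sumx big_cat. Qed.
Lemma sumy_cat vs ws : sumy (vs ++ ws) = sumy vs + sumy ws.
Proof. by rewrite /sumy big_cat. Qed.

(** The determinant of the two sums is the sum of the pairwise determinants, all positive. It puts
    the inner vertices of a chain strictly below its chord. *)
Lemma flatter_sums vs ws : 0 < size vs -> 0 < size ws -> allrel flatter vs ws ->
  sumx ws * sumy vs < sumx vs * sumy ws.
Proof.
move=> vs0 ws0.
have one v : all (flatter v) ws -> sumx ws * v.2 < v.1 * sumy ws.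
  case: ws ws0 => // w ws _ /= /andP[vw vws]; rewrite sumx_cons sumy_cons.
  have := @wflatter_sum v ws; move: vw; rewrite /flatter => vw.
  move=> /(_ (sub_all _ vws)) h; have {}h := h (fun u => @ltnW _ _).
  by nia.
elim: vs vs0 => // v vs IH _; rewrite allrel_consl => /andP[/one hv].
case: vs IH => [|u vs] IH h; first by rewrite /sumx /sumy !big_seq1.
by rewrite sumx_cons sumy_cons; have := IH isT h; nia.
Qed.

(** The e-th summand is the determinant of the vertices e and e + 1, twice the area of their
    triangle with the origin. These triangles fill the region under the chain, and [dets] accounts
    for the rest of the right triangle. *)
Lemma area_dets vs : pairwise flatter vs ->
  \sum_(e < size vs) ((nth (0, 0) vs e).2 * sumx (drop e.+1 vs)
    + (nth (0, 0) vs e).1 * sumy (take e.+1 vs)) + dets vs = sumx vs * sumy vs.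
Proof.
elim: vs => [|v vs IH] /=; first by rewrite big_ord0 /sumx big_nil.
move=> /andP[vvs /IH{}IH]; rewrite big_ord_recl /= drop0 take0 sumy_cons.
have h : sumx vs * v.2 <= v.1 * sumy vs.
  by apply: wflatter_sum; apply: sub_all vvs => u; exact: ltnW.
under eq_bigr => e _ do rewrite sumy_cons mulnDr addnCA.
rewrite big_split /=.
have -> : \sum_(i < size vs) (nth (0, 0) vs i).1 * v.2 = sumx vs * v.2.
  rewrite -big_distrl /=; congr (_ * _).
  by rewrite /sumx (big_nth (0, 0)) big_mkord.
rewrite sumx_cons sumy_cons /sumy big_nil -/(sumy vs); move: IH.
set A := \sum_(i < _) _; nia.
Qed.

End LatticeChains.

(** * Convergence *)

(** The form of completeness suited to power series; with it the analysis can be done over an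
    abstract [K] and specialised to [R[i]] at the end. *)
Definition geometrically_complete (K : numFieldType) := forall (z : nat -> K) (C : K),
  (forall n, `|z n.+1 - z n| <= C / 2 ^+ n) -> cvgn z.

Lemma cvgn_dist (K : numFieldType) (z : nat -> K) l :
  (forall e, 0 < e -> \forall n \near \oo, `|l - z n| < e) -> cvgn z.
Proof. by move=> zl; apply/cvg_ex; exists l; apply/cvgrPdist_lt. Qed.

Lemma real_geometrically_complete (R : realType) (z : nat -> R) (C : R) :
  (forall n, `|z n.+1 - z n| <= C / 2 ^+ n) -> cvgn z.
Proof.
move=> zC; pose u : R^nat := fun n => z n.+1 - z n.
have zE : z = (fun n => z 0%N + series u n).
  apply/funext; elim=> [|n IH]; first by rewrite /series /= big_geq // addr0.
  by rewrite seriesSr addrA -IH /u addrC subrK.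
have u_cvg : cvgn (series u).
  apply: normed_cvg; apply: (@series_le_cvg _ _ (geometric C (1 / 2))).
  - by move=> n; exact: normr_ge0.
  - move=> n; rewrite /geometric /= mulr_ge0 ?exprn_ge0 //.
    by have := le_trans (normr_ge0 _) (zC 0%N); rewrite expr0 divr1.
  - by move=> n; rewrite /geometric /= expr_div_n expr1n mul1r; exact: zC.
  - apply: is_cvg_geometric_series; rewrite ger0_norm ?divr_ge0 //; lra.
by rewrite zE; apply: is_cvgD => //; exact: is_cvg_cst.
Qed.

Section ComplexCompleteness.
Variable R : realType.
Local Open Scope complex_scope.

Lemma complex_geometrically_complete : geometrically_complete R[i].
Proof.
move=> z C zC.
have C_real : 0 <= C.
  by have := le_trans (normr_ge0 _) (zC 0%N); rewrite expr0 divr1.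
have CE n : C / 2 ^+ n = (complex.Re C / 2 ^+ n)%:C.
  have -> : C = (complex.Re C)%:C by apply/eqP; rewrite eq_complex /= eqxx; case: C C_real {zC} => a b; rewrite lecE /= => /andP[].
  by rewrite rmorphM rmorphV ?unitfE ?expf_neq0 // rmorphXn /= rmorph_nat.
have re_le (w : R[i]) (c : R) : `|w| <= c%:C -> `|complex.Re w| <= c.
  by move=> wc; rewrite -lecR; apply: le_trans (normc_ge_Re w) wc.
have im_le (w : R[i]) (c : R) : `|w| <= c%:C -> `|complex.Im w| <= c.
  move=> wc; have -> : complex.Im w = complex.Re (- (0 +i* 1) * w) by case: w {wc} => a b /=; ring.
  by apply: re_le; rewrite normrM normrN normc_def /= expr0n expr1n add0r sqrtr1 mul1r.
have re_cvg : cvgn (fun n => complex.Re (z n)).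
  apply: (@real_geometrically_complete _ _ (complex.Re C)) => n.
  have -> : complex.Re (z n.+1) - complex.Re (z n) = complex.Re (z n.+1 - z n) by case: (z n.+1) (z n) => [? ?] [? ?].
  by apply: re_le; rewrite -CE.
have im_cvg : cvgn (fun n => complex.Im (z n)).
  apply: (@real_geometrically_complete _ _ (complex.Re C)) => n.
  have -> : complex.Im (z n.+1) - complex.Im (z n) = complex.Im (z n.+1 - z n) by case: (z n.+1) (z n) => [? ?] [? ?].
  by apply: im_le; rewrite -CE.
move: re_cvg im_cvg => /cvg_ex[a /= za] /cvg_ex[b /= zb].
apply: (@cvgn_dist _ _ (a +i* b)) => e e0.
have eE : e = (complex.Re e)%:C.
  apply/eqP; rewrite eq_complex /= eqxx; move: e0; case: e => x y.
  by rewrite ltcE /= => /andP[].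
have e'0 : 0 < complex.Re e / 2.
  by rewrite divr_gt0 //; move: e0; rewrite {1}eE ltcR.
move/cvgrPdist_lt: za => /(_ _ e'0) za; move/cvgrPdist_lt: zb => /(_ _ e'0) zb.
near=> n.
have zaE : `|a - complex.Re (z n)| < complex.Re e / 2 by near: n.
have zbE : `|b - complex.Im (z n)| < complex.Re e / 2 by near: n.
have -> : a +i* b - z n = (a - complex.Re (z n))%:C + (0 +i* 1) * (b - complex.Im (z n))%:C.
  by case: (z n) => x y; apply/eqP; rewrite eq_complex /=; apply/andP; split; apply/eqP; ring.
apply: le_lt_trans (ler_normD _ _) _; rewrite normrM.
have normi : `|0 +i* 1 : R[i]| = 1 by rewrite normc_def /= expr0n expr1n add0r sqrtr1.
have normR (x : R) : `|x%:C| = `|x|%:C.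
  by rewrite normc_def /= expr0n addr0 sqrtr_sqr.
rewrite normi mul1r !normR -rmorphD /= eE ltcR.
by rewrite [X in _ < X](splitr (complex.Re e)); exact: ltrD.
Unshelve. all: by end_near. Qed.

End ComplexCompleteness.

(** * Evaluation of convergent series *)

Section Analysis.
Variable K : numFieldType.
Hypothesis K_complete : geometrically_complete K.

Lemma limn_dist_le (z : nat -> K) (c D : K) n0 : cvgn z ->
  (forall n, (n0 <= n)%N -> `|z n - c| <= D) -> `|limn z - c| <= D.
Proof.
move=> zc zD; have D_ge0 : 0 <= D by apply: le_trans (zD n0 _).
rewrite real_leNgt ?normr_real ?ger0_real //; apply/negP => lt.
move/cvgrPdist_lt: zc => /(_ (`|limn z - c| - D)); rewrite subr_gt0 => /(_ lt) near_lim.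
have [n [n0n zn]] : exists n, (n0 <= n)%N /\ `|limn z - z n| < `|limn z - c| - D.
  have [N _ HN] := near_lim; exists (maxn n0 N); split; first exact: leq_maxl.
  by apply: HN; rewrite /= leq_maxr.
have := ler_distD (z n) (limn z) c; have := ltr_leD zn (zD n n0n); rewrite subrK.
by move=> h1 h2; have := le_lt_trans h2 h1; rewrite ltxx.
Qed.

Lemma limn_eventually (z : nat -> K) c n0 : (forall n, (n0 <= n)%N -> z n = c) ->
  limn z = c.
Proof.
move=> zc; apply: cvg_lim => //; apply: cvg_near_cst.
by exists n0 => // n /= n0n; exact: zc.
Qed.

Lemma slice_small (F : series3 K) i j : convergent3 F ->
  exists C r : K, [/\ 0 <= C, 0 < r &
    forall t, `|t| <= r -> `|slice F t i j - F 0%N i j| <= C * `|t|].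
Proof.
move=> [r [M [r0 H]]].
have M0 : 0 <= M by apply: le_trans (H 0%N 0%N 0%N); rewrite mulr_ge0 // exprn_ge0 // ltW.
pose M' := M / r ^+ (i + j).
have M'0 : 0 <= M' by rewrite divr_ge0 // exprn_ge0 // ltW.
have H' k : `|F k i j| <= M' / r ^+ k.
  rewrite /M' -mulrA -invfM -exprD ler_pdivlMr ?exprn_gt0 //.
  by have -> : (i + j + k = k + i + j)%N by lia.
clearbody M'; exists (2 * M' / r), (r / 2).
split; [by rewrite divr_ge0 ?mulr_ge0 // ltW|by rewrite divr_gt0|].
move=> t tr; pose e := `|t| / r.
have e0 : 0 <= e by rewrite divr_ge0 // ltW.
have e2 : e <= 1 / 2 by rewrite ler_pdivrMr // mulrC mulrA mulr1.
have term k : `|F k i j * t ^+ k| <= M' * e ^+ k.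
  rewrite normrM normrX /e expr_div_n.
  have -> : M' * (`|t| ^+ k / r ^+ k) = M' / r ^+ k * `|t| ^+ k by ring.
  by rewrite ler_wpM2r // exprn_ge0.
have cv : cvgn (fun n => \sum_(k < n) F k i j * t ^+ k).
  apply: (K_complete (C := M')) => n; rewrite big_ord_recr /= addrAC subrr add0r.
  apply: le_trans (term n) _; rewrite ler_wpM2l //.
  rewrite -exprVn lerXn2r ?nnegrE ?invr_ge0 //.
  by move: e2; rewrite div1r.
apply: (limn_dist_le (n0 := 1) cv) => -[//|n] _.
rewrite big_ord_recl expr0 mulr1 addrAC subrr add0r.
apply: le_trans (ler_norm_sum _ _ _) _.
apply: (@le_trans _ _ (\sum_(k < n) M' * e ^+ k.+1)).
  by apply: ler_sum => k _; exact: term.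
rewrite -mulr_sumr; apply: le_trans (ler_wpM2l M'0 (geometric_sum_le n e0 e2)) _.
by rewrite /e le_eqVlt; apply/orP; left; apply/eqP; ring.
Qed.

Definition partial_eval (f : series2 K) (x y : K) n :=
  \sum_(i < n) \sum_(j < n) f i j * x ^+ i * y ^+ j.

Let h : K := 2^-1.

Let hX_ge0 n : 0 <= h ^+ n.
Proof. by rewrite exprn_ge0 // invr_ge0. Qed.

Let hX_le m n : (m <= n)%N -> h ^+ n <= h ^+ m.
Proof. by move=> mn; rewrite ler_wiXn2l // ?invr_ge0 // invf_le1 // ler1n. Qed.

Let half_pow_sum n : \sum_(i < n) h ^+ i <= 2.
Proof.
suff -> : \sum_(i < n) h ^+ i = 2 - 2 * h ^+ n.
  by rewrite gerBl mulr_ge0.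
elim: n => [|n IH]; first by rewrite big_ord0 expr0 mulr1 subrr.
by rewrite big_ord_recr /= IH exprS /h; field.
Qed.

Lemma shifted_sum (V : zmodType) n a (G : nat -> V) : (a <= n)%N ->
  \sum_(i < n | (a <= i)%N) G (i - a)%N = \sum_(c < n | (a + c < n)%N) G c.
Proof.
move=> /subnKC <-; set m := (n - a)%N.
rewrite big_split_ord /= big_pred0 ?add0r; last first.
  by move=> i; rewrite leqNgt ltn_ord.
transitivity (\sum_(i < m) G i).
  by apply: eq_big => i; rewrite ?leq_addr ?addKn.
rewrite (big_ord_widen (a + m) G (leq_addl _ _)); apply: eq_bigl => i.
by rewrite ltn_add2l.
Qed.

Lemma triangle_sum (V : zmodType) n (F : nat -> nat -> V) :
  \sum_(i < n) \sum_(a < i.+1) F a (i - a)%N =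
  \sum_(a < n) \sum_(c < n | (a + c < n)%N) F a c.
Proof.
transitivity (\sum_(i < n) \sum_(a < n | (a <= i)%N) F a (i - a)%N).
  by apply: eq_bigr => i _; rewrite (big_ord_widen n (fun a => F a (i - a)%N)).
rewrite (exchange_big_dep predT) //=; apply: eq_bigr => a _.
by rewrite (shifted_sum (F a)) // ltnW.
Qed.

Lemma partial_eval_mul (u g : series2 K) x y n :
  partial_eval (mul2 u g) x y n =
  \sum_(a < n) \sum_(c < n | (a + c < n)%N) \sum_(b < n) \sum_(d < n | (b + d < n)%N)
    (u a b * x ^+ a * y ^+ b) * (g c d * x ^+ c * y ^+ d).
Proof.
pose T (a b c d : nat) := (u a b * x ^+ a * y ^+ b) * (g c d * x ^+ c * y ^+ d).
rewrite -(triangle_sum n (fun a c => \sum_(b < n) \sum_(d < n | (b + d < n)%N) T a b c d)).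
apply: eq_bigr => i _.
transitivity (\sum_(j < n) \sum_(a < i.+1) \sum_(b < j.+1) T a b (i - a)%N (j - b)%N).
  apply: eq_bigr => j _; rewrite /mul2 !mulr_suml; apply: eq_bigr => a _.
  rewrite !mulr_suml; apply: eq_bigr => b _; rewrite /T.
  have ai := ltn_ord a; have bj := ltn_ord b.
  have -> : x ^+ i = x ^+ a * x ^+ (i - a) by rewrite -exprD subnKC.
  have -> : y ^+ j = y ^+ b * y ^+ (j - b) by rewrite -exprD subnKC.
  ring.
rewrite exchange_big /=; apply: eq_bigr => a _.
exact: (triangle_sum n (fun b d => T a b (i - a)%N d)).
Qed.

Let half_pow_sum2 n (M : K) : 0 <= M ->
  \sum_(i < n) \sum_(j < n) M * (h ^+ i * h ^+ j) <= 4 * M.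
Proof.
move=> M0; under eq_bigr => i _ do rewrite -mulr_sumr.
rewrite -mulr_sumr -big_distrlr /= mulrC.
have -> : 4 * M = 2 * 2 * M by ring.
have S0 : 0 <= \sum_(i < n) h ^+ i by exact: sumr_ge0.
by apply: ler_wpM2r => //; apply: ler_pM => //; exact: half_pow_sum.
Qed.

Section Bounds.
Variables (u : series2 K) (r M x y : K).
Hypotheses (r0 : 0 < r) (uM : forall i j, `|u i j| * r ^+ (i + j) <= M).
Hypotheses (xr : `|x| <= r / 4) (yr : `|y| <= r / 4).

Let M0 : 0 <= M.
Proof. by apply: le_trans (uM 0 0); rewrite mulr_ge0 // exprn_ge0 // ltW. Qed.

(** The radius r / 4 leaves two factors 2^-(i + j): one is spent on summation, the other makes tails
    small. *)
Lemma term_bound i j :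
  `|u i j * x ^+ i * y ^+ j| <= M * (h ^+ (i + j) * h ^+ (i + j)).
Proof.
have pow_le (z : K) k : `|z| <= r / 4 -> `|z ^+ k| <= (r / 4) ^+ k.
  by move=> zr; rewrite normrX lerXn2r // nnegrE divr_ge0 // ltW.
rewrite !normrM -mulrA.
apply: (@le_trans _ _ (`|u i j| * ((r / 4) ^+ i * (r / 4) ^+ j))).
  by rewrite ler_wpM2l // ler_pM // pow_le.
rewrite -exprD -!exprMn.
have -> : r / 4 = r * (h * h) by rewrite /h; field.
rewrite [(r * _) ^+ _]exprMn [leLHS]mulrA; apply: ler_wpM2r => //; exact: exprn_ge0 (mulr_ge0 (hX_ge0 1) (hX_ge0 1)).
Qed.

Let weak_bound i j : `|u i j * x ^+ i * y ^+ j| <= M * (h ^+ i * h ^+ j).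
Proof.
apply: le_trans (term_bound i j) _; rewrite -[h ^+ i * h ^+ j]exprD; apply: ler_wpM2l => //; rewrite ler_piMr //.
by rewrite -[leRHS](expr0 h) hX_le.
Qed.

Lemma partial_eval_bound n : `|partial_eval u x y n| <= 4 * M.
Proof.
apply: le_trans (half_pow_sum2 n M0).
apply: le_trans (ler_norm_sum _ _ _) _; apply: ler_sum => i _.
by apply: le_trans (ler_norm_sum _ _ _) _; apply: ler_sum => j _.
Qed.

Lemma partial_eval_cvg : cvgn (partial_eval u x y).
Proof.
apply: (K_complete (C := 4 * M)) => n.
have -> : partial_eval u x y n.+1 - partial_eval u x y n =
    \sum_(i < n) u i n * x ^+ i * y ^+ n + \sum_(j < n.+1) u n j * x ^+ n * y ^+ j.
  rewrite /partial_eval big_ord_recr /=.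
  under eq_bigr => i _ do rewrite big_ord_recr /=.
  by rewrite big_split /=; ring.
have -> : 4 * M / 2 ^+ n = M * h ^+ n * 2 + M * h ^+ n * 2.
  by rewrite -exprVn -/h; ring.
have Mh : 0 <= M * h ^+ n by rewrite mulr_ge0.
apply: le_trans (ler_normD _ _) _; apply: lerD.
- apply: le_trans (ler_norm_sum _ _ _) _.
  apply: (@le_trans _ _ (\sum_(i < n) M * h ^+ n * h ^+ i)).
    by apply: ler_sum => i _; rewrite [leRHS]mulrAC -[leRHS]mulrA.
  by rewrite -mulr_sumr ler_wpM2l.
- apply: le_trans (ler_norm_sum _ _ _) _.
  apply: (@le_trans _ _ (\sum_(i < n.+1) M * h ^+ n * h ^+ i)).
    by apply: ler_sum => i _; rewrite -[leRHS]mulrA.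
  by rewrite -mulr_sumr ler_wpM2l.
Qed.

End Bounds.

(** The terms by which the two sides differ have total degree at least n, hence a common factor h^n;
    the two double sums over what is left contribute 4 each. *)
Lemma partial_eval_mul_bound (u g : series2 K) r M M' x y n : 0 < r ->
  (forall i j, `|u i j| * r ^+ (i + j) <= M) ->
  (forall i j, `|g i j| * r ^+ (i + j) <= M') ->
  `|x| <= r / 4 -> `|y| <= r / 4 ->
  `|partial_eval u x y n * partial_eval g x y n - partial_eval (mul2 u g) x y n|
    <= 16 * (M * M') * h ^+ n.
Proof.
move=> r0 uM gM xr yr.
have M0 : 0 <= M by apply: le_trans (uM 0 0); rewrite mulr_ge0 // exprn_ge0 // ltW.
have M'0 : 0 <= M' by apply: le_trans (gM 0 0); rewrite mulr_ge0 // exprn_ge0 // ltW.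
pose t a c b d := (u a b * x ^+ a * y ^+ b) * (g c d * x ^+ c * y ^+ d).
pose C := M * M' * h ^+ n.
have C0 : 0 <= C by rewrite !mulr_ge0.
have tb a c b d : (n <= a + b + (c + d))%N ->
    `|t a c b d| <= C * (h ^+ a * h ^+ c) * (h ^+ b * h ^+ d).
  move=> nE; rewrite normrM; apply: le_trans (ler_pM _ _ (term_bound r0 uM xr yr a b)
    (term_bound r0 gM xr yr c d)) _ => //.
  have -> : M * (h ^+ (a + b) * h ^+ (a + b)) * (M' * (h ^+ (c + d) * h ^+ (c + d))) =
     M * M' * (h ^+ a * h ^+ c * (h ^+ b * h ^+ d)) * h ^+ (a + b + (c + d)).
    by rewrite !exprD; ring.
  have -> : C * (h ^+ a * h ^+ c) * (h ^+ b * h ^+ d) =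
     M * M' * (h ^+ a * h ^+ c * (h ^+ b * h ^+ d)) * h ^+ n by rewrite /C; ring.
  by rewrite ler_wpM2l ?hX_le // !mulr_ge0.
have -> : 16 * (M * M') * h ^+ n = 4 * (4 * C) by rewrite /C; ring.
rewrite partial_eval_mul /partial_eval big_distrlr /=.
under eq_bigr => a _ do under eq_bigr => c _ do rewrite big_distrlr /=.
under [X in _ - X]eq_bigr => a _ do rewrite big_mkcond /=.
rewrite -sumrB; under eq_bigr => a _ do rewrite -sumrB.
apply: le_trans (half_pow_sum2 n _); last by rewrite mulr_ge0.
apply: le_trans (ler_norm_sum _ _ _) _; apply: ler_sum => a _.
apply: le_trans (ler_norm_sum _ _ _) _; apply: ler_sum => c _.
rewrite -mulrA; apply: le_trans (half_pow_sum2 n _); last by rewrite !mulr_ge0.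
have [ac|ac] := ltnP (a + c) n; last first.
  rewrite subr0; apply: le_trans (ler_norm_sum _ _ _) _; apply: ler_sum => b _.
  apply: le_trans (ler_norm_sum _ _ _) _; apply: ler_sum => d _.
  by apply: (tb a c b d); lia.
under [X in _ - X]eq_bigr => b _ do rewrite big_mkcond /=.
rewrite -sumrB; apply: le_trans (ler_norm_sum _ _ _) _; apply: ler_sum => b _.
rewrite -sumrB; apply: le_trans (ler_norm_sum _ _ _) _; apply: ler_sum => d _.
have [bd|bd] := ltnP (b + d) n; first by rewrite subrr normr0 !mulr_ge0.
by rewrite subr0; apply: (tb a c b d); lia.
Qed.

(** Instead of an archimedean argument: the limit l exists by completeness, and h l = l forces l =
    0. *)
Let half_pow_cvg0 : (fun n => h ^+ n) @ \oo --> (0 : K).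
Proof.
have cv : cvgn (fun n => h ^+ n).
  apply: (K_complete (C := 1)) => n; rewrite exprS mulrC.
  have -> : h ^+ n * h - h ^+ n = - (h ^+ n * h) by rewrite /h; field.
  have h0 : 0 <= h by exact: (hX_ge0 1).
  rewrite normrN ger0_norm ?mulr_ge0 // div1r -exprVn -/h ler_piMr //.
  exact: (hX_le (leq0n 1)).
move/cvg_ex: cv => [l /= hl].
suff <- : l = 0 by [].
have hl' : (fun n => h ^+ n.+1) @ \oo --> h * l.
  under eq_fun => n do rewrite exprS.
  by apply: cvgM => //; exact: cvg_cst.
have : h * l = l by move: hl; rewrite -cvg_shiftS => hl; exact: cvg_unique hl' hl.
move=> hll; apply/eqP; have : (1 - h) * l == 0 by rewrite mulrBl mul1r hll subrr.
rewrite mulf_eq0 => /orP[|//]; have -> : 1 - h = h by rewrite /h; field.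
by rewrite invr_eq0 pnatr_eq0.
Qed.

Lemma partial_eval_mon a b x y n : (a < n)%N -> (b < n)%N ->
  partial_eval (coef (mon a b : cseries K)) x y n = x ^+ a * y ^+ b.
Proof.
move=> an bn; rewrite /partial_eval (bigD1 (Ordinal an)) //= [X in _ + X]big1 ?addr0; last first.
  move=> i; rewrite -val_eqE /= => /negbTE ia; rewrite big1 // => j _.
  by rewrite ia !mul0r.
rewrite (bigD1 (Ordinal bn)) //= [X in _ + X]big1 ?addr0; last first.
  by move=> j; rewrite -val_eqE /= => /negbTE jb; rewrite jb andbF !mul0r.
by rewrite !eqxx mul1r.
Qed.

Lemma partial_evalD (f g : cseries K) x y n :
  partial_eval (coef (f + g)) x y n =
  partial_eval (coef f) x y n + partial_eval (coef g) x y n.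
Proof.
rewrite /partial_eval -big_split; apply: eq_bigr => i _.
rewrite -[RHS]/(_ + _) -big_split; apply: eq_bigr => j _.
by rewrite -[RHS]/(_ + _) coefD !mulrDl.
Qed.

(** Evaluating the identity at a common zero should give 0. Evaluation is multiplicative on partial
    sums up to an error O(h^n), which is enough. *)
Lemma common_zero (u g v k : cseries K) a b : u * g + v * k = mon a b ->
  exists2 rho : K, 0 < rho & forall x y, `|x| < rho -> `|y| < rho ->
    eval2 (coef g) x y = 0 -> eval2 (coef k) x y = 0 -> x ^+ a * y ^+ b = 0.
Proof.
move=> e.
have [r [M [r0 r1 M0 uM gM]]] := convergent2_common (coef_cvg u) (coef_cvg g).
have [s [M' [s0 s1 M'0 vM kM]]] := convergent2_common (coef_cvg v) (coef_cvg k).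
exists (r * s / 4); first by rewrite divr_gt0 ?mulr_gt0.
move=> x y xr yr gz kz.
have le_r : r * s / 4 <= r / 4 by rewrite ler_wpM2r ?invr_ge0 // ler_piMr // ltW.
have le_s : r * s / 4 <= s / 4 by rewrite ler_wpM2r ?invr_ge0 // ler_piMl // ltW.
have xr' := le_trans (ltW xr) le_r; have yr' := le_trans (ltW yr) le_r.
have xs' := le_trans (ltW xr) le_s; have ys' := le_trans (ltW yr) le_s.
have gcv : partial_eval (coef g) x y @ \oo --> (0 : K).
  by rewrite -gz; apply: (partial_eval_cvg r0 gM xr' yr').
have kcv : partial_eval (coef k) x y @ \oo --> (0 : K).
  by rewrite -kz; apply: (partial_eval_cvg s0 kM xs' ys').
apply/eqP/negPn/negP => nz; set z := x ^+ a * y ^+ b in nz.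
have z0 : 0 < `|z| by rewrite normr_gt0.
(* A bound for everything that multiplies d in the estimate of |z| below; d is chosen so that D d =
   |z| / 4. *)
pose D := 16 * (M * M) + 16 * (M' * M') + 4 * M + 4 * M' + 1.
have D0 : 0 < D by rewrite ltr_wpDl // !addr_ge0 // !mulr_ge0.
pose d := `|z| / 4 / D; have d0 : 0 < d by rewrite !divr_gt0.
move/cvgrPdist_lt: gcv => /(_ d d0) gcv; move/cvgrPdist_lt: kcv => /(_ d d0) kcv.
move/cvgrPdist_lt: half_pow_cvg0 => /(_ d d0) hcv.
have near_n : \forall n \near \oo, False.
  near=> n.
  have gn : `|partial_eval (coef g) x y n| <= d.
    by apply: ltW; rewrite -normrN -sub0r; near: n.
  have kn : `|partial_eval (coef k) x y n| <= d.
    by apply: ltW; rewrite -normrN -sub0r; near: n.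
  have hn : h ^+ n <= d.
    by apply: ltW; rewrite -[h ^+ n]ger0_norm // -normrN -sub0r; near: n.
  have zE : z = partial_eval (mul2 (coef u) (coef g)) x y n
              + partial_eval (mul2 (coef v) (coef k)) x y n.
    rewrite /z -(@partial_eval_mon a b x y n); [|by near: n; exact: nbhs_infty_gt|by near: n; exact: nbhs_infty_gt].
    by rewrite -e partial_evalD !coefM.
  have := partial_eval_mul_bound n r0 uM gM xr' yr'.
  have := partial_eval_mul_bound n s0 vM kM xs' ys'.
  have ub := partial_eval_bound r0 uM xr' yr' n.
  have vb := partial_eval_bound s0 vM xs' ys' n.
  set U := partial_eval (coef u) x y n in ub *; set G := partial_eval (coef g) x y n in gn *.
  set V := partial_eval (coef v) x y n in vb *; set T := partial_eval (coef k) x y n in kn *.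
  move: zE; set UG := partial_eval (mul2 _ _) x y n; set VT := partial_eval (mul2 _ (coef k)) x y n.
  move=> zE b1 b2.
  have zle : `|z| <= D * d.
    have -> : z = U * G + V * T - (U * G - UG) - (V * T - VT) by rewrite zE; ring.
    apply: le_trans (ler_normB _ _) _.
    apply: le_trans (lerD (ler_normB _ _) (lexx _)) _.
    apply: le_trans (lerD (lerD (ler_normD _ _) (lexx _)) (lexx _)) _.
    rewrite !normrM.
    have dd := ltW d0.
    apply: le_trans (lerD (lerD (lerD (ler_pM _ _ ub gn) (ler_pM _ _ vb kn)) b2) b1) _ => //.
    apply: le_trans (lerD (lerD (lexx _) (ler_wpM2l _ hn)) (ler_wpM2l _ hn)) _; rewrite ?mulr_ge0 //.
    have -> : D * d = 4 * M * d + 4 * M' * d + 16 * (M * M) * d + 16 * (M' * M') * d + d.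
      by rewrite /D; ring.
    by rewrite lerDl.
  have : D * d = `|z| / 4 by rewrite /d mulrC divfK // gt_eqF.
  move=> e4; move: zle; rewrite e4 ler_pdivlMr // => zle.
  have : `|z| < `|z| * 4 by rewrite ltr_pMr // ltr1n.
  by move=> lt; have := lt_le_trans lt zle; rewrite ltxx.
by have [N _ HN] := near_n; apply: (HN N); rewrite /= leqnn.
Unshelve. all: by end_near. Qed.

Lemma eval2_00 (f : series2 K) : eval2 f 0 0 = f 0%N 0%N.
Proof.
apply: (@limn_eventually _ _ 1%N) => -[//|n] _.
rewrite big_ord_recl [X in _ + X]big1 ?addr0; last first.
  by move=> i _; rewrite big1 // => j _; rewrite expr0n /= mulr0 mul0r.
rewrite big_ord_recl [X in _ + X]big1 ?addr0; last first.
  by move=> j _; rewrite [_ ^+ (lift _ _)]expr0n /= mulr0.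
by rewrite /= !expr0 !mulr1.
Qed.

(** Finite codimension puts x^m and y^m into the gradient ideal, so near 0 the gradient vanishes
    only at 0. *)
Lemma isolated_of_codim (f : cseries K) m :
  codim (gen2 (cdx f) (cdy f)) m -> f 0%N 0%N = 0 -> f 1%N 0%N = 0 -> f 0%N 1%N = 0 ->
  isolated_singularity (coef f).
Proof.
move=> cm f00 f10 f01; split; first exact: coef_cvg.
have high := codim_ord (ideal_gen2 _ _) cm.
have [|u [v /esym uv]] := high (mon m 0).
  by move=> i j ij; rewrite coef_mon; case: eqP => //= ei; case: eqP => //= ej; lia.
have [|u' [v' /esym uv']] := high (mon 0 m).
  by move=> i j ij; rewrite coef_mon; case: eqP => //= ei; case: eqP => //= ej; lia.
have [r r0 Hr] := common_zero uv; have [s s0 Hs] := common_zero uv'.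
have rs : r >=< s by rewrite real_comparable ?gtr0_real.
exists (Num.min r s); split; first by rewrite comparable_lt_min // r0 s0.
move=> x y; rewrite !comparable_lt_min // => /andP[xr xs] /andP[yr ys].
split=> [[ez1 ez2 _]|[-> ->]]; last first.
  rewrite !eval2_00 /dx /dy f10 f01 f00; split=> //; exact: mul0rn.
have /eqP := Hr x y xr yr ez1 ez2; have /eqP := Hs x y xs ys ez1 ez2.
by rewrite !expr0 mul1r mulr1 !expf_eq0 => /andP[_ /eqP ->] /andP[_ /eqP ->].
Qed.

End Analysis.

(** * Semicontinuity *)

Lemma pos_lower_bound (K : numFieldType) (r s : K) : 0 < r -> 0 < s ->
  exists t, [/\ 0 < t, t <= r & t <= s].
Proof.
move=> r0 s0; have rs : r >=< s by rewrite real_comparable ?gtr0_real.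
exists (Num.min r s); split; first by rewrite comparable_lt_min // r0 s0.
- by rewrite comparable_ge_min // lexx.
- by rewrite comparable_ge_min // lexx orbT.
Qed.

Section Semicontinuity.
Variable K : numFieldType.
Hypothesis K_complete : geometrically_complete K.
Local Notation cseries := (cseries K).

Definition lipschitz0 (h : K -> K) := exists C r : K,
  [/\ 0 <= C, 0 < r & forall t, `|t| <= r -> `|h t| <= C * `|t|].

Lemma lipschitz0D g h : lipschitz0 g -> lipschitz0 h -> lipschitz0 (fun t => g t + h t).
Proof.
move=> [C [r [C0 r0 H]]] [C' [r' [C'0 r'0 H']]].
have [s [s0 sr sr']] := pos_lower_bound r0 r'0.
exists (C + C'), s; split=> [||t ts]; [exact: addr_ge0|exact: s0|].
apply: le_trans (ler_normD _ _) _; rewrite mulrDl.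
by apply: lerD; [apply: H|apply: H']; apply: le_trans ts _.
Qed.

Lemma lipschitz0_0 : lipschitz0 (fun=> 0).
Proof. by exists 0, 1; split=> // t _; rewrite normr0 mul0r. Qed.

Lemma lipschitz0_sum (I : Type) (s : seq I) (h : I -> K -> K) :
  (forall i, lipschitz0 (h i)) -> lipschitz0 (fun t => \sum_(i <- s) h i t).
Proof.
move=> H; elim: s => [|i s IH].
  by under eq_fun => t do rewrite big_nil; exact: lipschitz0_0.
by under eq_fun => t do rewrite big_cons; exact: lipschitz0D.
Qed.

Lemma lipschitz0M c h : lipschitz0 h -> lipschitz0 (fun t => c * h t).
Proof.
move=> [C [r [C0 r0 H]]]; exists (`|c| * C), r; split=> // [|t tr].
  by rewrite mulr_ge0.
by rewrite normrM -mulrA ler_wpM2l // H.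
Qed.

Lemma lipschitz0_norm h : lipschitz0 h -> lipschitz0 (fun t => `|h t|).
Proof. by move=> [C [r [C0 r0 H]]]; exists C, r; split=> // t /H; rewrite normr_id. Qed.

Lemma lipschitz0_slice F i j : convergent3 F ->
  lipschitz0 (fun t => slice F 0 i j - slice F t i j).
Proof.
move=> cF; have [C [r [C0 r0 H]]] := slice_small K_complete i j cF.
exists C, r; split=> // t tr.
have -> : slice F 0 i j = F 0%N i j.
  have := H 0; rewrite normr0 mulr0 => /(_ (ltW r0)); rewrite normr_le0 subr_eq0.
  by move/eqP.
by rewrite distrC; exact: H.
Qed.

(** A vector of the kernel satisfies v = v E, so its l1 norm S is at most S times a number below
    1. *)
Lemma perturbed_identity_unit D (E : 'M[K]_D) :
  \sum_p \sum_q `|E p q| < 1 -> 1%:M - E \in unitmx.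
Proof.
move=> E1; rewrite -row_free_unit -kermx_eq0; apply/rowV0P => v /sub_kermxP vE.
have {}vE : v = v *m E by apply/eqP; rewrite -subr_eq0 -[X in X - _]mulmx1 -mulmxBr vE.
pose S := \sum_q `|v 0 q|.
have S0 : 0 <= S by exact: sumr_ge0.
have SE : S <= S * \sum_p \sum_q `|E p q|.
  apply: (@le_trans _ _ (\sum_q \sum_p `|v 0 p| * `|E p q|)).
    apply: ler_sum => q _; rewrite {1}vE mxE.
    apply: le_trans (ler_norm_sum _ _ _) _.
    by apply: ler_sum => p _; rewrite normrM.
  rewrite exchange_big mulr_sumr /=; apply: ler_sum => p _.
  rewrite -mulr_sumr ler_wpM2r ?sumr_ge0 //.
  by rewrite /S (bigD1 p) //= lerDl sumr_ge0.
have {}S0 : S = 0.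
  apply/eqP/negPn/negP => Sn0; have {}S0 : 0 < S by rewrite lt_def Sn0.
  have lt : S * \sum_p \sum_q `|E p q| < S * 1 by rewrite ltr_pM2l.
  by have := le_lt_trans SE lt; rewrite mulr1 ltxx.
apply/rowP => q; rewrite mxE; apply/eqP; rewrite -normr_eq0.
by move/eqP: S0; rewrite psumr_eq0 // => /allP/(_ q); rewrite mem_index_enum => /(_ isT).
Qed.

(* Modulo m^N the partial derivatives of f and n elements generate all monomials.
   Replacing f by the slice at t changes these relations by a matrix of size
   O(t), so they can still be solved; with N = n + 1 the chain of the ideals
   I + m^i then bounds the codimension of I by n. *)
Lemma codim_semicontinuous (F : series3 K) (f : cseries) n m :
  convergent3 F -> slice F 0 = coef f -> codim (gen2 (cdx f) (cdy f)) n ->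
  (exists eps : K, 0 < eps /\ forall t, `|t| < eps -> convergent2 (slice F t)) ->
  deformation_milnor_number F m -> (m <= n)%N.
Proof.
move=> cF F0 [e [se _]] [eps [eps0 Heps]] [eps' [eps'0 Heps']].
pose N := n.+1.
pose s : seq (nat * nat) := [seq (i, j) | i <- iota 0 N, j <- iota 0 N].
have us : uniq s by apply: allpairs_uniq; rewrite ?iota_uniq // => -[? ?] [? ?].
have mem_s i j : ((i, j) \in s) = (i < N)%N && (j < N)%N.
  apply/allpairsP/andP => [[ab [aN bN [-> ->]]]|[iN jN]].
    by move: aN bN; rewrite !mem_iota => /andP[_ ?] /andP[_ ?].
  by exists (i, j); rewrite ?mem_iota.
pose D := size s; pose M := @monomials K s.
pose k (p : 'I_D) := (nth (0, 0)%N s p).1; pose l (p : 'I_D) := (nth (0, 0)%N s p).2.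
have /choice[A HA] : forall p, exists a, gen2 (cdx f) (cdy f) (M p - lincomb a e).
  by move=> p; exact: se.
have /choice[u /choice[v uv]] := HA.
(* The error, at the monomial q, in the relation for the monomial p after f is replaced by its slice
   at t. *)
pose E t p q := mul2 (coef (u p)) (fun i j => dx (coef f) i j - dx (slice F t) i j) (k q) (l q)
  + mul2 (coef (v p)) (fun i j => dy (coef f) i j - dy (slice F t) i j) (k q) (l q).
have lipE p q : lipschitz0 (fun t => E t p q).
  apply: lipschitz0D; apply: lipschitz0_sum => a; apply: lipschitz0_sum => b;
  apply: lipschitz0M; rewrite -F0 /dx /dy.
  - under eq_fun => t do rewrite -mulrnBl -mulr_natl.
    by apply: lipschitz0M; exact: lipschitz0_slice.
  - under eq_fun => t do rewrite -mulrnBl -mulr_natl.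
    by apply: lipschitz0M; exact: lipschitz0_slice.
have [C [r [C0 r0 Hr]]] : lipschitz0 (fun t => \sum_p \sum_q `|E t p q|).
  by apply: lipschitz0_sum => p; apply: lipschitz0_sum => q; exact: lipschitz0_norm.
have C10 : 0 < (C + 1)^-1 by rewrite invr_gt0 ltr_wpDl.
have [r1 [r10 r1r r1C]] := pos_lower_bound r0 C10.
have [r2 [r20 r2e r2e']] := pos_lower_bound eps0 eps'0.
have [t [t0 tr1 tr2]] := pos_lower_bound r10 r20.
(* [t] satisfies only weak bounds; halving it makes them strict. *)
pose t' := t / 2; have t'0 : 0 < t' by rewrite divr_gt0.
have t't : t' < t by rewrite ltr_pdivrMr // ltr_pMr // ltr1n.
have nt' : `|t'| = t' by rewrite ger0_norm // ltW.
have ct : convergent2 (slice F t').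
  by apply: Heps; rewrite nt'; apply: lt_le_trans t't (le_trans tr2 r2e).
pose ft := mkcs ct.
have cm : codim (gen2 (cdx ft) (cdy ft)) m.
  apply/(milnor_codim ft m); apply: Heps'; rewrite nt' //.
  by apply: lt_le_trans t't (le_trans tr2 r2e').
set I := gen2 (cdx ft) (cdy ft) in cm.
have idI : ideal I := ideal_gen2 _ _.
have Esmall : \sum_p \sum_q `|E t' p q| < 1.
  have t'r : `|t'| <= r by rewrite nt'; apply: le_trans (ltW t't) (le_trans tr1 r1r).
  have := Hr t' t'r; rewrite ger0_norm; last by rewrite sumr_ge0 // => p _; exact: sumr_ge0.
  move=> le1; apply: le_lt_trans le1 _; rewrite nt'.
  have C1 : 0 < C + 1 by rewrite ltr_wpDl.
  apply: (@lt_le_trans _ _ ((C + 1) * t')); first by rewrite ltr_pM2r // ltrDl.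
  by rewrite -ler_pdivlMl // mulr1; apply: le_trans (ltW t't) (le_trans tr1 r1C).
pose Em : 'M[K]_D := \matrix_(p, q) E t' p q.
have unitE : 1%:M - Em \in unitmx.
  apply: perturbed_identity_unit.
  by under eq_bigr => p _ do under eq_bigr => q _ do rewrite mxE.
have idN := ideal_addord N idI; have [N0 ND NM] := idN.
pose S (h : cseries) := exists a, addord I N (h - lincomb a e).
have SD g h : S g -> S h -> S (g + h).
  move=> [a Ia] [b Ib]; exists (fun i => a i + b i).
  have -> : lincomb (fun i => a i + b i) e = lincomb a e + lincomb b e.
    by rewrite /lincomb -big_split; apply: eq_bigr => i _; rewrite rmorphD mulrDl.
  rewrite opprD addrACA; exact: (ND _ _ Ia Ib).
have SM c h : S h -> S (cst c * h).
  move=> [a Ia]; exists (fun i => c * a i).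
  have -> : lincomb (fun i => c * a i) e = cst c * lincomb a e.
    by rewrite /lincomb mulr_sumr; apply: eq_bigr => i _; rewrite rmorphM mulrA.
  rewrite -mulrBr; exact: (NM _ _ Ia).
have S_I h : addord I N h -> S h.
  move=> Ih; exists (fun=> 0); rewrite (_ : lincomb _ e = 0) ?subr0 //.
  by rewrite /lincomb big1 // => i _; rewrite rmorph0 mul0r.
have Ssum (J : finType) (G : J -> cseries) : (forall j, S (G j)) -> S (\sum_j G j).
  by move=> SG; apply: big_ind; [exact: S_I|exact: SD|].
have trunc_S (h : cseries) : addord I N (h - lincomb (fun p => h (k p) (l p)) M).
  exists 0; first by case: idI.
  rewrite subr0 => i j; rewrite !mul1n => ijN.
  have ijs : (i, j) \in s.
    by rewrite mem_s (leq_ltn_trans (leq_addr j i) ijN) (leq_ltn_trans (leq_addl i j) ijN).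
  have ltD : (index (i, j) s < D)%N by rewrite index_mem.
  have eq_ij : lincomb (fun p => h (k p) (l p)) M i j = h i j.
    have := coef_lincomb_monomials (fun p : 'I_D => h (k p) (l p)) (Ordinal ltD) us.
    by rewrite /k /l /= nth_index.
  by rewrite coefB eq_ij subrr.
have S_row p : S (M p - lincomb (fun q => Em p q) M).
  pose Dp := u p * (cdx f - cdx ft) + v p * (cdy f - cdy ft).
  have -> : M p - lincomb (fun q => Em p q) M =
     (M p - Dp) + (Dp - lincomb (fun q => Em p q) M) by ring.
  apply: SD.
    exists (A p); have -> : M p - Dp - lincomb (A p) e = u p * cdx ft + v p * cdy ft.
      rewrite addrAC uv /Dp; ring.
    by apply: addord_sub; exists (u p), (v p).
  apply: S_I; have := trunc_S Dp; congr (addord I N (_ - _)).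
  rewrite /lincomb; apply: eq_bigr => q _; congr (cst _ * _).
  by rewrite mxE /Dp coefD !coefM.
have S_mon p : S (M p).
  (* The rows of (1 - E) M lie in S; the inverse of 1 - E isolates the single monomials. *)
  have -> : M p = \sum_q cst (invmx (1%:M - Em) p q) * (M q - lincomb (fun q' => Em q q') M).
    have H : invmx (1%:M - Em) *m (1%:M - Em) = 1%:M by exact: mulVmx.
    have -> : \sum_q cst (invmx (1%:M - Em) p q) * (M q - lincomb (fun q' => Em q q') M)
       = \sum_q' cst ((invmx (1%:M - Em) *m (1%:M - Em)) p q') * M q'.
      transitivity (\sum_q \sum_q' cst (invmx (1%:M - Em) p q * (1%:M - Em) q q') * M q').
        apply: eq_bigr => q _.
        under [RHS]eq_bigr => q' _ do rewrite rmorphM -mulrA.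
        rewrite -mulr_sumr; congr (_ * _).
        have -> : M q - lincomb (fun q' => Em q q') M =
           \sum_q' cst ((1%:M : 'M[K]_D) q q') * M q' - lincomb (fun q' => Em q q') M.
          congr (_ - _); rewrite (bigD1 q) // big1 => [|q' /andP[_ qq']].
            by rewrite [RHS]addr0 mxE eqxx rmorph1 mul1r.
          by rewrite mxE eq_sym (negbTE qq') rmorph0 mul0r.
        rewrite /lincomb -sumrB; apply: eq_bigr => q' _.
        rewrite -mulrBl -rmorphB; congr (cst _ * _).
        by rewrite [RHS]mxE; congr (_ + _); rewrite [RHS]mxE.
      rewrite exchange_big; apply: eq_bigr => q' _ /=.
      by rewrite -mulr_suml -rmorph_sum mxE.
    rewrite H (bigD1 p) // big1 => [|q' /andP[_ pq']].
      by rewrite [RHS]addr0 mxE eqxx rmorph1 mul1r.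
    by rewrite mxE eq_sym (negbTE pq') rmorph0 mul0r.
  by apply: Ssum => q; apply: SM.
have span_t : spans (addord I N) e.
  move=> h; suff : S h by [].
  have -> : h = lincomb (fun p => h (k p) (l p)) M + (h - lincomb (fun p => h (k p) (l p)) M) by ring.
  apply: SD; last by apply: S_I; exact: trunc_S.
  by apply: Ssum => p; exact: SM.
(* N = n + 1 independent classes are impossible against n generators. Hence I contains m^i for some
   i < N, and independence modulo I is independence modulo I + m^N. *)
have [[i iN Hi]|[e' fe']] := chain_dichotomy N idI; last first.
  by have := steinitz idN span_t fe'; rewrite /N ltnn.
have [e' [_ fe']] := cm.
apply: (steinitz idN span_t (e' := e')) => a [g Ig Ng]; apply: fe'.
have -> : lincomb a e' = g + (lincomb a e' - g) by ring.
have [_ ID _] := idI; apply: ID => //; apply: Hi.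
by apply: wge_le Ng; exact: ltnW.
Qed.

End Semicontinuity.

(** * The deformations *)

Section ChainGeometry.
Local Open Scope nat_scope.
Variables (L : nat) (X Y mx my : nat -> nat).
Hypothesis ch : newton_chain L X Y mx my.

Let weight e i j := Y e * i + X e * j.

(** By convexity every step away from edge e raises the weight belonging to e by at least 1. *)
Lemma chain_weight_up e d : e < L -> e.+1 + d <= L ->
  weight e (mx e) (my e) + d <= weight e (mx (e.+1 + d)) (my (e.+1 + d)).
Proof.
have [eX eY X0 Y0 _ conv] := ch => eL; rewrite /weight.
elim: d => [|d IH] dL; first by rewrite !addn0 eX // eY //; nia.
have {IH} := IH ltac:(lia); rewrite addnS in dL *.
have : e < e.+1 + d by lia.
move: (e.+1 + d) dL => k kL ek; have := conv e k; rewrite ek kL => /(_ isT).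
by rewrite (eX k) // (eY k) //; lia.
Qed.

Lemma chain_weight_down e d : e < L -> d <= e ->
  weight e (mx e) (my e) + d <= weight e (mx (e - d)) (my (e - d)).
Proof.
have [eX eY X0 Y0 _ conv] := ch => eL; rewrite /weight.
elim: d => [|d IH] de; first by rewrite subn0 addn0.
have {IH} := IH (ltnW de); have -> : e - d = (e - d.+1).+1 by lia.
have : e - d.+1 < e by lia.
move: (e - d.+1) => k ke; have := conv k e; rewrite ke eL => /(_ isT).
by rewrite (eX k) ?(eY k) ?(ltn_trans ke) //; lia.
Qed.

Lemma chain_weight_min e e' : e < L -> e' <= L ->
  weight e (mx e) (my e) <= weight e (mx e') (my e') /\
  (weight e (mx e') (my e') <= weight e (mx e) (my e) -> e' = e \/ e' = e.+1).
Proof.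
move=> eL e'L; have [ee'|e'e] := ltnP e e'.
- have := @chain_weight_up e (e' - e.+1) eL; rewrite subnKC // => /(_ e'L) h.
  by split; [|move=> h'; right]; lia.
- have := @chain_weight_down e (e - e') eL (leq_subr _ _); rewrite subKn // => h.
  by split; [|move=> h'; left]; lia.
Qed.

(** The monomials of f lie on or above the segment, so they can touch the polygon of the deformation
    only at vertices. An edge line of the chain meets the segment at most at its end points, unless
    the chain is the segment itself. *)
Lemma chain_above_segment e i j : e < L -> my 0 = 0 -> 0 < mx 0 -> 0 < my L ->
  coprime (my L) (mx 0) -> my L * mx 0 <= my L * i + mx 0 * j ->
  weight e i j <= weight e (mx e) (my e) ->
  (i, j) = (mx e, my e) \/ (i, j) = (mx e.+1, my e.+1).
Proof.
move=> eL my0 Q0 P0 cop above wij.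
have [eX eY X0 Y0 mxL conv] := ch.
have Xe := X0 e eL; have Ye := Y0 e eL.
have [w0 w0'] := chain_weight_min eL (leq0n L).
have [wL wL'] := chain_weight_min eL (leqnn L).
move: w0 w0' wL wL' wij; rewrite /weight my0 mxL !muln0 !addn0 !add0n.
set w := Y e * mx e + _; set P := my L in P0 cop above *; set Q := mx 0 in Q0 cop above *.
move=> w0 w0' wL wL' wij.
(* Over the region on or above the segment, the weight is least at (Q, 0) or at (0, P); the
   comparison tells at which. *)
have [le|lt] := leqP (Y e * Q) (X e * P).
- have h1 : Y e * (P * Q) <= P * (Y e * i + X e * j).
    have : Y e * Q * j <= X e * P * j by rewrite leq_mul2r le orbT.
    by nia.
  have w_eq : Y e * i + X e * j = Y e * Q.
    apply/eqP; rewrite eqn_leq (leq_trans wij w0) /= -(leq_pmul2l P0).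
    by apply: leq_trans h1; lia.
  have e0 : e = 0 by case: w0' => //; lia.
  have jE : X e * P * j = Y e * Q * j.
    apply/eqP; rewrite eqn_leq [X in _ && X]leq_mul2r le orbT andbT; nia.
  have [j0|j0] := posnP j.
    left; rewrite e0 j0 my0; congr (_, _); move: w_eq; rewrite j0; nia.
  have PQ : X e * P = Y e * Q by nia.
  have Le : L = 1 by case: wL' => [||]; lia.
  have sumE : P * i + Q * j = P * Q by nia.
  (* The chain is the segment here, and coprimality leaves no lattice points on it besides the
     ends. *)
  have Pj : P %| j.
    by rewrite -(Gauss_dvdr j cop) -(dvdn_addr _ (dvdn_mulr i (dvdnn P))) sumE dvdn_mulr.
  have jP : j = P.
    apply/eqP; rewrite eqn_leq (dvdn_leq j0 Pj) andbT -(leq_pmul2l Q0); lia.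
  right; rewrite e0 -Le mxL jP; congr (_, _); move: sumE; rewrite jP; nia.
- have h1 : X e * (P * Q) <= Q * (Y e * i + X e * j).
    have : X e * P * i <= Y e * Q * i by rewrite leq_mul2r (ltnW lt) orbT.
    by nia.
  have w_eq : Y e * i + X e * j = X e * P.
    apply/eqP; rewrite eqn_leq (leq_trans wij wL) /= -(leq_pmul2l Q0).
    by apply: leq_trans h1; lia.
  have i0 : i = 0.
    apply/eqP; rewrite -leqn0 leqNgt; apply/negP => i0.
    have : X e * P * i < Y e * Q * i by rewrite ltn_pmul2r.
    by nia.
  have eL1 : L = e.+1 by case: wL' => //; lia.
  by right; rewrite -eL1 mxL i0; congr (_, _); move: w_eq; rewrite i0; nia.
Qed.

End ChainGeometry.

Section VectorChain.
Local Open Scope nat_scope.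
Variable vs : seq (nat * nat).
Hypothesis vsP : positive_chain vs.

Definition chain_X e := (nth (0, 0) vs e).1.
Definition chain_Y e := (nth (0, 0) vs e).2.
Definition chain_x e := sumx (drop e vs).
Definition chain_y e := sumy (take e vs).

Let pv : pairwise flatter vs.
Proof. by case/andP: vsP => /andP[]. Qed.

Lemma newton_chain_vectors : newton_chain (size vs) chain_X chain_Y chain_x chain_y.
Proof.
have pos e : e < size vs -> (0 < chain_X e) && (0 < chain_Y e).
  by move=> eL; case/andP: vsP => _ /all_nthP-/(_ (0, 0) e eL).
split=> [e eL|e eL|e eL|e eL||e e' /andP[ee' e'L]].
- by rewrite /chain_x (drop_nth (0, 0) eL) sumx_cons addnC.
- rewrite /chain_y (take_nth (0, 0) eL) -cats1 sumy_cat.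
  by rewrite {2}/sumy big_seq1.
- by case/andP: (pos e eL).
- by case/andP: (pos e eL).
- by rewrite /chain_x drop_size /sumx big_nil.
- by move/(pairwiseP (0, 0)): pv => /(_ e e' (ltn_trans ee' e'L) e'L ee').
Qed.

Lemma chain_x0 : chain_x 0 = sumx vs. Proof. by rewrite /chain_x drop0. Qed.
Lemma chain_y0 : chain_y 0 = 0. Proof. by rewrite /chain_y take0 /sumy big_nil. Qed.
Lemma chain_yL : chain_y (size vs) = sumy vs. Proof. by rewrite /chain_y take_size. Qed.

Lemma chain_interior e : 0 < e < size vs ->
  [/\ 0 < chain_x e, 0 < chain_y e &
    sumy vs * chain_x e + sumx vs * chain_y e < sumy vs * sumx vs].
Proof.
move=> /andP[e0 eL]; have [eX eY X0 Y0 _ _] := newton_chain_vectors.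
split; first by rewrite eX //; have := X0 e eL; lia.
  by have := eY e.-1; have := Y0 e.-1; rewrite prednK // => h1 ->; have := h1; lia.
have -> : sumx vs = sumx (take e vs) + sumx (drop e vs) by rewrite -sumx_cat cat_take_drop.
have -> : sumy vs = sumy (take e vs) + sumy (drop e vs) by rewrite -sumy_cat cat_take_drop.
rewrite /chain_x /chain_y.
have := @flatter_sums (take e vs) (drop e vs).
rewrite size_takel ?(ltnW eL) // size_drop subn_gt0 => /(_ e0 eL).
have -> : allrel flatter (take e vs) (drop e vs).
  by move: pv; rewrite -{1}(cat_take_drop e vs) pairwise_cat => /and3P[].
by move=> /(_ isT); nia.
Qed.

Lemma chain_area : \sum_(e < size vs) (chain_Y e * chain_x e.+1 + chain_X e * chain_y e.+1)
  + dets vs = sumx vs * sumy vs.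
Proof. exact: area_dets. Qed.

End VectorChain.

Section Deformation.
Variable K : numFieldType.
Hypothesis K_complete : geometrically_complete K.
Variables (f : cseries K) (P Q : nat) (vs : seq (nat * nat)).
Hypotheses (fPQ : newton_form P Q (coef f)) (copPQ : coprime P Q).
Hypotheses (P1 : (1 < P)%N) (Q1 : (1 < Q)%N).
Hypotheses (vsP : positive_chain vs) (vsx : sumx vs = Q) (vsy : sumy vs = P).

Definition interior_vertex i j :=
  has (fun e => (i == chain_x vs e) && (j == chain_y vs e)) (iota 1 (size vs).-1).

Lemma interior_vertexP i j : reflect
  (exists2 e, (0 < e < size vs)%N & (i, j) = (chain_x vs e, chain_y vs e))
  (interior_vertex i j).
Proof.
apply: (iffP hasP) => [[e]|[e /andP[e0 eL] [-> ->]]].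
  rewrite mem_iota => /andP[e0 eL] /andP[/eqP -> /eqP ->]; exists e => //.
  by rewrite e0; lia.
by exists e; rewrite ?eqxx // mem_iota e0; lia.
Qed.

Lemma convergent2_vertices :
  convergent2 (fun i j => (interior_vertex i j)%:R : K).
Proof.
exists 1, 1; split=> // i j; rewrite expr1n mulr1.
by case: (interior_vertex _ _); rewrite ?normr1 ?normr0.
Qed.

Definition vertex_series : cseries K := mkcs convergent2_vertices.

Let ft t := f + cst t * vertex_series.

Let ftE t i j : ft t i j = f i j + t * (interior_vertex i j)%:R.
Proof. by rewrite coefD coef_cstM. Qed.

Let f_interior e : (0 < e < size vs)%N -> f (chain_x vs e) (chain_y vs e) = 0.
Proof.
move=> /(chain_interior vsP)[_ _ lt]; apply/eqP/negPn/negP.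
have [below _ _] := fPQ; move=> /below; move: lt; rewrite vsx vsy; lia.
Qed.

Let not_interior i j : (i == 0)%N || (j == 0)%N -> interior_vertex i j = false.
Proof.
move=> ij; apply/negP => /interior_vertexP[e /(chain_interior vsP)[x0 y0 _] [ei ej]].
by move: ij; rewrite ei ej; lia.
Qed.

(** The alternative of a single edge includes t = 0, and so gives the Milnor number of f itself. *)
Lemma deformed_codim t : (t != 0) || (size vs == 1%N) ->
  exists m, codim (gen2 (cdx (ft t)) (cdy (ft t))) m /\
    (m + P + Q + dets vs = (P * Q).+1)%N.
Proof.
move=> t_or; have [below fQ0 f0P] := fPQ.
have ch := newton_chain_vectors vsP; have [eX eY X0 Y0 mxL _] := ch.
have vs0 : (0 < size vs)%N.
  by move: vsx Q1; case: (vs) => //; rewrite /sumx big_nil => <-.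
pose L := size vs; pose c e := ft t (chain_x vs e) (chain_y vs e).
have c0 e : (e <= L)%N -> c e != 0.
  move=> eL; rewrite /c ftE; have [->|e0] := posnP e.
    by rewrite chain_x0 chain_y0 vsx not_interior ?eqxx ?orbT // mulr0 addr0.
  move: eL; rewrite leq_eqVlt => /orP[/eqP ->|eL].
    by rewrite mxL chain_yL vsy not_interior ?eqxx // mulr0 addr0.
  have e_int : (0 < e < size vs)%N by rewrite e0.
  rewrite f_interior // add0r.
  have -> : interior_vertex (chain_x vs e) (chain_y vs e) by apply/interior_vertexP; exists e.
  rewrite mulr1; move: t_or; rewrite orbC => /orP[/eqP L1|//].
  by move: eL e0; rewrite /L L1; lia.
have pol : has_polygon L (chain_X vs) (chain_Y vs) (chain_x vs) (chain_y vs) 0%N c (ft t).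
  split=> [e eL|e i j eL ij nz]; first by rewrite subn0.
  rewrite !addn0 in ij *.
  have [/interior_vertexP[e' /andP[e'0 e'L] [ei ej]]|not_int] := boolP (interior_vertex i j).
    have [_ h] := chain_weight_min ch eL (ltnW e'L).
    by move: ij; rewrite ei ej => /h[->|->]; [left|right].
  have fij : f i j != 0 by move: nz; rewrite ftE (negbTE not_int) mulr0 addr0.
  apply: (chain_above_segment ch eL _ _ _ _ _ ij); rewrite ?chain_y0 ?chain_x0 ?chain_yL ?vsx ?vsy //.
  - by lia.
  - by lia.
  - exact: below.
have [|m [cm mE]] := milnor_chain vs0 ch (chain_y0 vs) _ c0 pol.
  by rewrite chain_x0 vsx.
exists m; split; first exact: cm.
by have := chain_area vsP; move: mE; rewrite chain_x0 chain_yL vsx vsy; lia.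
Qed.

Definition vertex_deformation : series3 K := fun k i j =>
  if k == 0%N then f i j else if k == 1%N then vertex_series i j else 0.

Lemma slice_vertex_deformation t : slice vertex_deformation t = coef (ft t).
Proof.
apply/funext => i; apply/funext => j; apply: (@limn_eventually _ _ _ 2).
move=> [//|[//|n]] _; rewrite !big_ord_recl big1 => [|k _]; last by rewrite mul0r.
by rewrite ftE /= expr0 expr1 mulr1 addr0 mulrC.
Qed.

Lemma deformation_attained : isolated_singularity (coef f) -> exists m,
  (m + P + Q + dets vs = (P * Q).+1)%N /\
  exists F, deformation (coef f) F /\ deformation_milnor_number F m.
Proof.
move=> iso_f; have [below fQ0 f0P] := fPQ.
have f0 : ft 0 = f by rewrite /ft rmorph0 mul0r addr0.
(* Inner vertices lie off both axes, so they have degree at least 2 and every slice stays singular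
   at 0. *)
have f_small i j : (i + j <= 1)%N -> ft 0 i j = 0 /\ forall t, ft t i j = f i j.
  move=> ij; split.
    rewrite f0; apply/eqP/negPn/negP => /below; nia.
  by move=> t; rewrite ftE not_interior ?mulr0 ?addr0 //; lia.
(* The area formula determines m, so the value at t = 1 is the value at every t other than 0. *)
have [m [_ mE]] : exists m, codim (gen2 (cdx (ft 1)) (cdy (ft 1))) m /\
    (m + P + Q + dets vs = (P * Q).+1)%N.
  by apply: deformed_codim; rewrite oner_neq0.
have cm t : t != 0 -> codim (gen2 (cdx (ft t)) (cdy (ft t))) m.
  move=> t0; have [|m' [cm' mE']] := @deformed_codim t; first by rewrite t0.
  by have -> : m = m' by lia.
exists m; split; first exact: mE.
exists vertex_deformation; split; last first.
  exists 1; split=> // t t0 _; rewrite slice_vertex_deformation; apply/milnor_codim.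
  by apply: cm; rewrite -normr_gt0.
split; last 1 first.
- exists 1; split=> // t _; rewrite slice_vertex_deformation.
  have [->|t0] := eqVneq t 0; first by rewrite f0.
  apply: (isolated_of_codim K_complete (cm t t0)).
  + by have [e1 e2] := f_small 0%N 0%N isT; rewrite e2 -(e2 0).
  + by have [e1 e2] := f_small 1%N 0%N isT; rewrite e2 -(e2 0).
  + by have [e1 e2] := f_small 0%N 1%N isT; rewrite e2 -(e2 0).
- have [r [M [r0 r1 M0 fM]]] := convergent2_bound (coef_cvg f).
  exists r, (M + 1); split=> // k i j; rewrite /vertex_deformation.
  have rX n : 0 <= r ^+ n <= 1 by rewrite exprn_ge0 ?exprn_ile1 // ltW.
  case: eqP => [->|_]; first by rewrite add0n; apply: le_trans (fM i j) _; rewrite lerDl.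
  case: eqP => [_|_]; last by rewrite normr0 mul0r addr_ge0.
  rewrite -[X in X <= _]add0r lerD //; have /andP[rX0 rX1] := rX (k + i + j)%N.
  by rewrite mkcsE; case: (interior_vertex i j); rewrite ?normr1 ?normr0 ?mul1r ?mul0r.
- by rewrite slice_vertex_deformation f0.
Qed.

End Deformation.

(** * The sequence of jumps *)

Section Jumps.
Local Open Scope nat_scope.

Lemma jumps_consecutive N a (s : seq nat) :
  prefix (nseq N 1) (jumps (rev (iota a N.+1) ++ s)).
Proof.
elim: N => [|N IH]; first by rewrite prefix0s.
have iotaS : iota a N.+2 = rcons (iota a N.+1) (a + N.+1).
  by rewrite -[in LHS]addn1 iotaD cats1.
rewrite iotaS rev_rcons; move: IH.
have [t ->] : exists t, rev (iota a N.+1) = (a + N) :: t.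
  by rewrite -addn1 iotaD cats1 rev_rcons; eexists.
move=> IH; rewrite /jumps /= -/(jumps ((a + N) :: t ++ s)).
by have -> : a + N.+1 - (a + N) = 1 by lia.
Qed.

Lemma milnor_sequence_exists (K : numFieldType) (f : series2 K) n N :
  N < n -> 
  (forall m F, deformation f F -> deformation_milnor_number F m -> m <= n) ->
  (forall k, k <= N -> exists F, deformation f F /\ deformation_milnor_number F (n - k)) ->
  exists s, milnor_sequence f s /\ prefix (nseq N 1) (jumps s).
Proof.
move=> Nn bounded attained.
pose att m := `[< exists F, deformation f F /\ deformation_milnor_number F m >].
exists (rev [seq m <- iota 1 n | att m]); split; first split.
- rewrite rev_sorted; apply: sorted_filter; last exact: iota_ltn_sorted.
  by move=> a b c; exact: ltn_trans.
- move=> m; rewrite mem_rev mem_filter mem_iota; split.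
    by move=> /andP[/asboolP am /andP[m0 _]].
  move=> [m0 [F [dF mF]]]; apply/andP; split; first by apply/asboolP; exists F.
  by rewrite m0 add1n ltnS (bounded m F).
(* The N + 1 largest candidates all survive the filter, and after reversal they head the sequence as
   consecutive integers. *)
- have -> : iota 1 n = iota 1 (n - N.+1) ++ iota (n - N) N.+1.
    have -> : n - N = 1 + (n - N.+1) by lia.
    by rewrite -iotaD subnK.
  rewrite filter_cat rev_cat [X in rev X ++ _](_ : _ = iota (n - N) N.+1).
    exact: jumps_consecutive.
  apply/all_filterP/allP => m; rewrite mem_iota => mN; apply/asboolP.
  have -> : m = n - (n - m) by lia.
  by apply: attained; lia.
Qed.

End Jumps.

Lemma newton_form_jumps (K : numFieldType) (f : series2 K) P Q N :
  geometrically_complete K -> isolated_singularity f -> newton_form P Q f ->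
  coprime P Q -> (1 < P)%N -> (1 < Q)%N -> (N < P.-1 * Q.-1)%N ->
  (forall k, (k <= N)%N -> exists vs,
    [/\ positive_chain vs, sumx vs = Q, sumy vs = P & dets vs = k]) ->
  exists s, milnor_sequence f s /\ prefix (nseq N 1%N) (jumps s).
Proof.
move=> Kc iso fPQ cop P1 Q1 NPQ chains.
have [cf _] := iso; pose g := mkcs cf.
(* The segment as a one-edge chain, with t = 0, yields the Milnor number (P - 1)(Q - 1) of f. *)
have one_edge : positive_chain [:: (Q, P)].
  by rewrite /positive_chain /convex_chain /=; lia.
have [m [cm mE]] : exists m, codim (gen2 (cdx g) (cdy g)) m /\
    (m + P + Q + dets [:: (Q, P)] = (P * Q).+1)%N.
  have := @deformed_codim K g P Q [:: (Q, P)] fPQ cop P1 Q1 one_edge _ _ 0.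
  rewrite /sumx /sumy !big_seq1 => /(_ erefl erefl).
  by rewrite eqxx orbT rmorph0 mul0r addr0 => /(_ isT).
have {}mE : m = (P.-1 * Q.-1)%N.
  by move: mE; rewrite /= /sumx /sumy !big_nil muln0 mul0n; nia.
apply: (@milnor_sequence_exists K f m); first by rewrite mE.
- move=> m' F [cF F0 [eps [eps0 iso_t]]] mF.
  apply: (codim_semicontinuous Kc cF _ cm _ mF); first exact: F0.
  by exists eps; split=> // t /iso_t[].
- move=> k /chains[vs [vsP vsx vsy vsd]].
  have [m' [m'E defm]] := deformation_attained Kc (f := g) fPQ cop P1 Q1 vsP vsx vsy iso.
  by have -> : (m - k = m')%N by rewrite mE; move: m'E; rewrite vsd; nia.
Qed.

Local Close Scope ring_scope.
Local Close Scope classical_set_scope.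

Theorem corollary1p2 (R : realType) (f : series2 R[i]) (p q : nat) :
  isolated_singularity f -> irreducible2 f -> nondegenerate f ->
  (0 < p)%N -> (p < q)%N -> coprime p q ->
  newton_form p q f \/ newton_form p q (swap f) ->
  exists s : seq nat, milnor_sequence f s /\
    prefix (nseq ((q %% p) * (p - q %% p)) 1%N) (jumps s).
Proof.
move=> iso _ _ p0 pq cop form.
have {form} form : newton_form p q f \/ newton_form q p f.
  case: form => [|[below fq fp]]; [by left|right; split].
  - by move=> a b nz; have := below b a nz; lia.
  - exact: fp.
  - exact: fq.
(* The gradient vanishes at 0, so f has no linear terms; this excludes p = 1. *)
have [f10 f01] : f 1%N 0%N = 0%R /\ f 0%N 1%N = 0%R.
  have [_ [eps [eps0 H]]] := iso.
  have e0 : (`|0 : R[i]| < eps)%R by rewrite normr0.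
  have [_ H0] := H 0%R 0%R e0 e0; have [fx fy _] := H0 (conj erefl erefl).
  by move: fx fy; rewrite !eval2_00 /dx /dy !mulr1n.
have p1 : (1 < p)%N.
  rewrite ltn_neqAle p0 andbT; apply/eqP => p1.
  by case: form => -[_]; rewrite -p1 ?f10 ?f01 eqxx.
have q1 := ltn_trans p1 pq.
have r0 : (0 < q %% p)%N.
  rewrite lt0n; apply/negP => /dvdnP[k qk].
  by move: cop; rewrite qk /coprime gcdnMl; lia.
set r := (q %% p)%N in r0 *.
have rp : (r < p)%N by exact: ltn_pmod.
(* Keeps all r (p - r) + 1 topmost values positive. *)
have NPQ : (r * (p - r) < p.-1 * q.-1)%N.
  have : (r * (p - r) <= p.-1 * (p - r))%N by rewrite leq_mul2r; apply/orP; right; lia.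
  have : (p.-1 * (p - r) < p.-1 * q.-1)%N; last by lia.
  by rewrite ltn_pmul2l; lia.
have Kc := @complex_geometrically_complete R.
have chains k : (k <= r * (p - r))%N -> _ :=
  fun kN => positive_chain_dets p0 pq cop r0 kN.
case: form => form.
- apply: (newton_form_jumps Kc iso form) => // k /chains[vs [ws [vsP _]]].
  by exists vs.
- apply: (newton_form_jumps Kc iso form) => //.
  + by rewrite coprime_sym.
  + by rewrite [X in (_ < X)%N]mulnC.
  + by move=> k /chains[vs [ws [_ wsP]]]; exists ws.
Qed.
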